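(* Let $n\equiv 2$ or $3 \pmod 4$ and let $\psi\in L^2(\mathbb{R}^n;Cl_n)$ be an admissible Clifford mother wavelet with admissibility constant $C_\psi$. Then every $f\in L^2(\mathbb{R}^n;Cl_n)$ can be decomposed as $$f(x)=\int_{\mathcal{G}} T_\psi f(a,\theta,b)\,\psi_{a,\theta,b}(x)\,C_\psi^{-1}\,d\mu\,d^nb=\int_{\mathcal{G}} (f,\psi_{a,\theta,b})_{L^2(\mathbb{R}^n;Cl_n)}\,\psi_{a,\theta,b}(x)\,C_\psi^{-1}\,d\mu\,d^nb ,$$ the integral converging in the weak sense, i.e. for every $g\in L^2(\mathbb{R}^n;Cl_n)$, $$(f,g)_{L^2(\mathbb{R}^n;Cl_n)}=\int_{\mathcal{G}} T_\psi f(a,\theta,b)\,\bigl(\psi_{a,\theta,b}C_\psi^{-1},g\bigr)_{L^2(\mathbb{R}^n;Cl_n)}\,d\mu\,d^nb .$$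
   Context: $Cl_n=Cl_{n,0}$ is the real Clifford algebra of Euclidean $\mathbb{R}^n$ with orthonormal vectors $e_1,\dots,e_n$ ($e_k^2=1$, $e_je_k=-e_ke_j$ for $j\ne k$) and basis blades $e_A$ (ordered products of basis vectors); $M=\sum_A M_Ae_A$ with $M_A\in\mathbb{R}$. $\langle M\rangle_k$ is the grade-$k$ part, $\langle M\rangle=\langle M\rangle_0$ the scalar part. The reverse is $\widetilde M=\sum_k(-1)^{k(k-1)/2}\langle M\rangle_k$ (also written $\{M\}^\sim$), an anti-automorphism; $|M|^2=\langle M\widetilde M\rangle=\sum_A M_A^2$. $Cl_n^{+}$, $Cl_n^{-}$ are the subspaces of elements with only even, respectively only odd grades. $i_n=e_1e_2\cdots e_n$ satisfies $i_n^2=-1$ for $n\equiv 2,3\pmod 4$. Inner product of $f,g:\mathbb{R}^n\to Cl_n$: $(f,g)=\int_{\mathbb{R}^n}f(x)\widetilde{g(x)}\,d^nx\in Cl_n$; $\|f\|^2=\langle(f,f)\rangle=\int|f|^2$; $L^2(\mathbb{R}^n;Cl_n)=\{f:\|f\|<\infty\}$. Clifford Fourier transform: $\widehat f(\omega)=\mathcal F\{f\}(\omega)=\int_{\mathbb{R}^n}f(x)e^{-i_n\omega\cdot x}d^nx$ (extended to $L^2$ in the usual way). Similitude group: $\mathcal G=\{(a,r_\theta,b): a>0,\ r_\theta\in SO(n),\ b\in\mathbb{R}^n\}$, with left Haar measure $d\lambda=d\mu\,d^nb$, $d\mu=a^{-(n+1)}\,da\,d\theta$, $d\theta$ the normalized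 Haar measure on $SO(n)$. Daughter wavelets: $\psi_{a,\theta,b}(x)=a^{-n/2}\psi\bigl(r_\theta^{-1}((x-b)/a)\bigr)$. Admissibility: $\psi\in L^2(\mathbb{R}^n;Cl_n)$ is admissible if $C_\psi=\int_{\mathbb{R}^+}\int_{SO(n)}a^n\{\widehat\psi(a r_\theta^{-1}(\omega))\}^{\sim}\,\widehat\psi(a r_\theta^{-1}(\omega))\,d\mu$ is, for a.e. $\omega\in\mathbb{R}^n$, a finite invertible multivector constant (independent of $\omega$). In addition, if $n\equiv2\pmod 4$ the mother wavelet is required to take values either entirely in $Cl_n^+$ or entirely in $Cl_n^-$; if $n\equiv 3\pmod 4$ there is no grade restriction. Clifford wavelet transform: $T_\psi f(a,\theta,b)=\int_{\mathbb{R}^n}f(x)\widetilde{\psi_{a,\theta,b}(x)}\,d^nx=(f,\psi_{a,\theta,b})$. *)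

(* Defs.v *)
From HB Require Import structures.
From mathcomp Require Import all_boot all_order all_algebra.
From mathcomp Require Import ring lra zify.
From mathcomp Require Import all_classical all_reals all_analysis.

Set Implicit Arguments.
Unset Strict Implicit.
Unset Printing Implicit Defensive.
Import Order.TTheory GRing.Theory Num.Theory.
Import numFieldNormedType.Exports.

Local Open Scope classical_set_scope.
Local Open Scope ring_scope.

(* Elements of Cl_{n,0} over R are given by their coordinates in the blades
   e_A, where A is a set of indices in {0, ..., n-1} and e_A is the product of
   the e_k, k in A, in increasing order. *)
Definition clifford (R : Type) (n : nat) : Type := {ffun {set 'I_n} -> R}.

Section CliffordAlgebra.
Variables (R : comNzRingType) (n : nat).

HB.instance Definition _ := GRing.Lmodule.copy (clifford R n)
  {ffun {set 'I_n} -> R^o}.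

Implicit Types (A B C : {set 'I_n}) (M N P : clifford R n).

Definition blade A : clifford R n := [ffun B => (B == A)%:R].

Definition symdiff A B : {set 'I_n} := (A :\: B) :|: (B :\: A).

(* Moving e_B past e_A costs one sign for each pair (i, j) in A x B with
   j < i; as e_k^2 = 1, this gives e_A e_B = blade_sign A B * e_(A + B), where
   + is the symmetric difference. *)
Definition blade_sign A B : R :=
  \prod_(i in A) \prod_(j in B | (j < i)%N) (-1).

Definition cl_mul M N : clifford R n :=
  [ffun C => \sum_A \sum_(B | symdiff A B == C)
     blade_sign A B * M A * N B].

Lemma in_symdiff A B i : (i \in symdiff A B) = (i \in A) (+) (i \in B).
Proof. by rewrite !inE; do 2!case: (_ \in _). Qed.

Lemma symdiffA : associative symdiff.
Proof. by move=> A B C; apply/setP=> i; rewrite !in_symdiff addbA. Qed.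

Lemma symdiffC : commutative symdiff.
Proof. by move=> A B; apply/setP=> i; rewrite !in_symdiff addbC. Qed.

Lemma symdiff0 : left_id finset.set0 symdiff.
Proof. by move=> A; apply/setP=> i; rewrite !in_symdiff inE. Qed.

Lemma symdiffx0 A : symdiff A finset.set0 = A.
Proof. by rewrite symdiffC symdiff0. Qed.

Lemma symdiffxx A : symdiff A A = finset.set0.
Proof. by apply/setP=> i; rewrite in_symdiff addbb inE. Qed.

Lemma symdiffK A B : symdiff A (symdiff A B) = B.
Proof. by apply/setP=> i; rewrite !in_symdiff addbA addbb. Qed.

Lemma symdiff_eq A B C : (symdiff A B == C) = (B == symdiff A C).
Proof. by apply/eqP/eqP => [<-|->]; rewrite symdiffK. Qed.

Lemma prod_symdiff (f : 'I_n -> R) A B : (forall i, f i * f i = 1) ->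
  \prod_(i in symdiff A B) f i = (\prod_(i in A) f i) * (\prod_(i in B) f i).
Proof.
move=> ff; rewrite [LHS]big_mkcond [X in _ = X * _]big_mkcond.
rewrite [X in _ = _ * X]big_mkcond -big_split /=; apply: eq_bigr => i _.
by rewrite in_symdiff; do 2!case: (_ \in _); rewrite /= ?mul1r ?mulr1.
Qed.

Definition row_sign B (i : 'I_n) : R := \prod_(j in B | (j < i)%N) (-1).

Lemma prodN1_sqr (I : finType) (D : pred I) :
  (\prod_(i | D i) (-1 : R)) * (\prod_(i | D i) (-1)) = 1.
Proof. by rewrite -big_split /= big1 // => i _; rewrite mulrNN mulr1. Qed.

Lemma row_sign_symdiff A B i :
  row_sign (symdiff A B) i = row_sign A i * row_sign B i.
Proof.
rewrite /row_sign !big_mkcondr /= prod_symdiff // => j.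
by case: ifP; rewrite ?mulrNN mulr1.
Qed.

Lemma blade_sign_symdiffl A B C :
  blade_sign (symdiff A B) C = blade_sign A C * blade_sign B C.
Proof. by rewrite /blade_sign prod_symdiff // => i; apply: prodN1_sqr. Qed.

Lemma blade_sign_symdiffr A B C :
  blade_sign A (symdiff B C) = blade_sign A B * blade_sign A C.
Proof.
rewrite /blade_sign -big_split /=; apply: eq_bigr => i _.
exact: row_sign_symdiff.
Qed.

Lemma blade_sign0l A : blade_sign finset.set0 A = 1.
Proof. by rewrite /blade_sign big_set0. Qed.

Lemma blade_sign0r A : blade_sign A finset.set0 = 1.
Proof. by rewrite /blade_sign big1 // => i _; rewrite big1 // => j; rewrite inE. Qed.

Lemma cl_mulE M N C :
  cl_mul M N C = \sum_A blade_sign A (symdiff A C) * M A * N (symdiff A C).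
Proof.
rewrite ffunE; apply: eq_bigr => A _.
by rewrite (big_pred1 (symdiff A C)) // => B; rewrite symdiff_eq.
Qed.

Lemma cl_mulA : associative cl_mul.
Proof.
move=> M N P; apply/ffunP => D; rewrite !cl_mulE.
under eq_bigr => A _ do rewrite cl_mulE mulr_sumr.
under [RHS]eq_bigr => B _ do rewrite cl_mulE mulr_sumr mulr_suml.
rewrite [RHS]exchange_big /=; apply: eq_bigr => A _.
rewrite [RHS](reindex_inj (h := symdiff A)); last exact: can_inj (symdiffK A).
apply: eq_bigr => C _ /=.
have -> : symdiff C (symdiff A D) = symdiff (symdiff A C) D.
  by rewrite symdiffA (symdiffC A).
have -> : symdiff A D = symdiff C (symdiff (symdiff A C) D).
  by apply/setP=> i; rewrite !in_symdiff; do 3!case: (_ \in _).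
rewrite symdiffK blade_sign_symdiffr blade_sign_symdiffl; ring.
Qed.

Lemma cl_mul1l : left_id (blade finset.set0) cl_mul.
Proof.
move=> M; apply/ffunP => C; rewrite cl_mulE (bigD1 finset.set0) //=.
rewrite (symdiff0 C).
rewrite blade_sign0l ffunE eqxx !mul1r big1 ?addr0 // => A nA.
by rewrite ffunE (negPf nA) mulr0 mul0r.
Qed.

Lemma cl_mul1r : right_id (blade finset.set0) cl_mul.
Proof.
move=> M; apply/ffunP => C; rewrite cl_mulE (bigD1 C) //= ffunE.
rewrite symdiffxx eqxx mulr1 blade_sign0r mul1r big1 ?addr0 // => A nA.
by rewrite ffunE symdiff_eq (symdiffx0 A) eq_sym (negPf nA) mulr0.
Qed.

Lemma cl_mulDl : left_distributive cl_mul +%R.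
Proof.
move=> M N P; apply/ffunP => C; rewrite [RHS]ffunE !cl_mulE -big_split /=.
by apply: eq_bigr => A _; rewrite ffunE mulrDr mulrDl.
Qed.

Lemma cl_mulDr : right_distributive cl_mul +%R.
Proof.
move=> M N P; apply/ffunP => C; rewrite [RHS]ffunE !cl_mulE -big_split /=.
by apply: eq_bigr => A _; rewrite ffunE mulrDr.
Qed.

Lemma cl_oner_neq0 : blade finset.set0 != 0.
Proof.
apply/eqP => /ffunP/(_ finset.set0); rewrite !ffunE eqxx => /eqP.
by rewrite oner_eq0.
Qed.

HB.instance Definition _ := GRing.Zmodule_isNzRing.Build (clifford R n)
  cl_mulA cl_mul1l cl_mul1r cl_mulDl cl_mulDr cl_oner_neq0.

Lemma cl_mulrE M N C :
  (M * N) C = \sum_A blade_sign A (symdiff A C) * M A * N (symdiff A C).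
Proof. exact: cl_mulE. Qed.

Lemma cl_addE M N A : (M + N) A = M A + N A.
Proof. exact: ffunE. Qed.

Lemma cl_scaleE (a : R) M A : (a *: M) A = a * M A.
Proof. exact: ffunE. Qed.

Lemma cl_scaleAl (a : R) M N : a *: (M * N) = (a *: M) * N.
Proof.
apply/ffunP => C; rewrite cl_scaleE !cl_mulrE mulr_sumr.
by apply: eq_bigr => A _; rewrite cl_scaleE; ring.
Qed.

HB.instance Definition _ :=
  GRing.Lmodule_isLalgebra.Build R (clifford R n) cl_scaleAl.

Lemma cl_scaleAr (a : R) M N : a *: (M * N) = M * (a *: N).
Proof.
apply/ffunP => C; rewrite cl_scaleE !cl_mulrE mulr_sumr.
by apply: eq_bigr => A _; rewrite cl_scaleE; ring.
Qed.

HB.instance Definition _ :=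
  GRing.Lalgebra_isAlgebra.Build R (clifford R n) cl_scaleAr.

Definition cl_unit (M : clifford R n) : bool :=
  `[< exists N, N * M = 1 /\ M * N = 1 >].

Definition cl_inv (M : clifford R n) : clifford R n :=
  if pselect (exists N, N * M = 1 /\ M * N = 1) is left h
  then projT1 (cid h) else M.

Lemma cl_mulV : {in cl_unit, left_inverse 1 cl_inv *%R}.
Proof.
move=> M /asboolP h; rewrite /cl_inv; case: pselect => // h'.
by case: (cid h') => N [].
Qed.

Lemma cl_divrr : {in cl_unit, right_inverse 1 cl_inv *%R}.
Proof.
move=> M /asboolP h; rewrite /cl_inv; case: pselect => // h'.
by case: (cid h') => N [].
Qed.

Lemma cl_unitP M N : N * M = 1 /\ M * N = 1 -> cl_unit M.
Proof. by move=> h; apply/asboolP; exists N. Qed.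

Lemma cl_inv_out : {in [predC cl_unit], cl_inv =1 id}.
Proof.
move=> M /= /asboolP h; rewrite /cl_inv; case: pselect => //.
Qed.

HB.instance Definition _ := GRing.NzRing_hasMulInverse.Build (clifford R n)
  cl_mulV cl_divrr cl_unitP cl_inv_out.

Lemma blade0 : blade finset.set0 = 1. Proof. by []. Qed.

Lemma bladeM A B : blade A * blade B = blade_sign A B *: blade (symdiff A B).
Proof.
apply/ffunP => C; rewrite cl_mulrE cl_scaleE (bigD1 A) //= !ffunE eqxx mulr1.
rewrite symdiff_eq big1 ?addr0.
  by case: eqP => [->|]; rewrite ?mulr0 // symdiffK.
by move=> D nD; rewrite ffunE (negPf nD) mulr0 mul0r.
Qed.

Definition basis_vec (k : 'I_n) : clifford R n := blade [set k]%SET.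

Lemma basis_vec_sqr k : basis_vec k * basis_vec k = 1.
Proof.
rewrite /basis_vec bladeM; rewrite symdiffxx blade0 /blade_sign big_set1 big_pred0 ?scale1r // => j.
by rewrite inE; case: eqP => [->|//]; rewrite ltnn.
Qed.

Lemma blade_sign1l k B : blade_sign [set k]%SET B = \prod_(j in B | (j < k)%N) (-1).
Proof. by rewrite /blade_sign big_set1. Qed.

Lemma blade_sign1r k A : blade_sign A [set k]%SET = \prod_(i in A | (k < i)%N) (-1).
Proof.
rewrite /blade_sign big_mkcondr /=; apply: eq_bigr => i _.
rewrite (eq_bigl (fun j => (j == k) && (k < i)%N)); last first.
  by move=> j; rewrite inE; case: eqP => [->|].
case: (k < i)%N; first by rewrite (big_pred1 k) // => j; rewrite andbT.
by rewrite big_pred0 // => j; rewrite andbF.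
Qed.

Lemma blade_sign1C k B : k \notin B ->
  blade_sign [set k]%SET B * blade_sign B [set k]%SET = (-1) ^+ #|B|.
Proof.
move=> kB; rewrite blade_sign1l blade_sign1r !big_mkcondr /= -big_split /=.
rewrite -prodr_const; apply: eq_bigr => j jB.
case: (ltngtP j k); rewrite ?mulr1 ?mul1r //.
by move=> /val_inj jk; rewrite jk (negPf kB) in jB.
Qed.

Lemma symdiff1 k B : k \notin B -> symdiff [set k]%SET B = (k |: B)%SET.
Proof.
move=> kB; apply/setP => i; rewrite in_symdiff !inE.
by case: eqP => [->|]; rewrite ?(negPf kB).
Qed.

Lemma basis_vecC j k : j != k ->
  basis_vec j * basis_vec k = - (basis_vec k * basis_vec j).
Proof.
move=> jk; rewrite /basis_vec !bladeM symdiffC -scaleNr; congr (_ *: _).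
have : j \notin [set k]%SET by rewrite inE.
move=> /blade_sign1C; rewrite cards1 expr1 => h.
have sq : blade_sign [set k]%SET [set j]%SET * blade_sign [set k]%SET [set j]%SET = 1.
  by rewrite blade_sign1l prodN1_sqr.
by rewrite -[LHS]mulr1 -sq mulrA h mulN1r.
Qed.

Lemma blade_sign_sqr A : blade_sign A A = (-1) ^+ (#|A| * #|A|.-1)./2.
Proof.
move: {2}#|A| (erefl #|A|) => m; elim: m A => [|m IHm] A.
  by move=> /cards0_eq ->; rewrite blade_sign0l cards0.
move=> Am; have [k kA] : exists k, k \in A by apply/set0Pn; rewrite -card_gt0 Am.
have kB : k \notin (A :\ k)%SET by rewrite !inE eqxx.
rewrite -(finset.setD1K kA) cardsU1 kB -(symdiff1 kB).
have Bm : #|(A :\ k)%SET| = m by move: Am; rewrite (cardsD1 k) kA add1n => -[].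
rewrite blade_sign_symdiffl !blade_sign_symdiffr (IHm _ Bm) Bm add1n /=.
rewrite blade_sign1l big_pred0; last first.
  by move=> j; rewrite inE; case: eqP => [->|//]; rewrite ltnn.
rewrite mul1r mulrA blade_sign1C // Bm -exprD; congr (_ ^+ _).
by case: m {IHm Am Bm} => //= m; nia.
Qed.

Definition grade_part (k : nat) M : clifford R n :=
  [ffun A : {set 'I_n} => if #|A| == k then M A else 0].

Definition scalar_part M : R := M finset.set0.

Definition reverse M : clifford R n :=
  \sum_(k < n.+1) (-1) ^+ (k * k.-1)./2 *: grade_part k M.

Lemma reverseE M A : reverse M A = (-1) ^+ (#|A| * #|A|.-1)./2 * M A.
Proof.
have h : (#|A| < n.+1)%N by rewrite ltnS -[n in (_ <= n)%N]card_ord max_card.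
rewrite /reverse sum_ffunE (bigD1 (Ordinal h)) //= cl_scaleE ffunE eqxx.
rewrite big1 ?addr0 // => k nk; rewrite cl_scaleE ffunE ifN ?mulr0 //.
by apply: contra nk => /eqP e; apply/eqP/val_inj; rewrite /= e.
Qed.

Definition is_even M := forall A, odd #|A| -> M A = 0.
Definition is_odd M := forall A, ~~ odd #|A| -> M A = 0.

(* e_0 e_1 ... e_(n-1), the factors being taken in increasing order. *)
Definition pseudoscalar : clifford R n := \prod_(k < n) basis_vec k.

Lemma pseudoscalarE : pseudoscalar = blade finset.setT.
Proof.
have H (s : seq 'I_n) : sorted ltn (map val s) ->
    \prod_(k <- s) basis_vec k = blade [set k in s]%SET.
  elim: s => [_|k s IHs /= ks].
    by rewrite big_nil -blade0; congr blade; apply/setP=> i; rewrite !inE.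
  rewrite big_cons IHs ?(path_sorted ks) // /basis_vec bladeM.
  have {}ks : all (fun j : 'I_n => (k < j)%N) s.
    by have := order_path_min ltn_trans ks; rewrite all_map.
  have kn : k \notin [set j in s]%SET.
    by rewrite inE; apply/negP => /(allP ks); rewrite ltnn.
  rewrite (symdiff1 kn) blade_sign1l big_pred0; last first.
    move=> j; rewrite inE; apply/negP => /andP[/(allP ks) kj jk].
    by have := ltn_trans kj jk; rewrite ltnn.
  by rewrite scale1r; congr blade; apply/setP=> j; rewrite !inE.
rewrite /pseudoscalar H; last by rewrite /index_enum unlock -enumT val_enum_ord iota_ltn_sorted.
by congr blade; apply/setP => i; rewrite !inE mem_index_enum.
Qed.

Lemma pseudoscalar_sqr : pseudoscalar * pseudoscalar = ((-1) ^+ (n * n.-1)./2)%:A.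
Proof.
by rewrite pseudoscalarE bladeM symdiffxx blade_sign_sqr cardsT card_ord blade0.
Qed.

Lemma pseudoscalar_sqrN1 : (n %% 4 = 2 \/ n %% 4 = 3)%N ->
  pseudoscalar * pseudoscalar = -1.
Proof.
move=> hn; rewrite pseudoscalar_sqr -signr_odd.
have -> : odd (n * n.-1)./2; last by rewrite expr1 scaleN1r.
rewrite (divn_eq n 4); case: hn => ->; set q := (n %/ 4)%N.
  have -> : (((q * 4 + 2) * (q * 4 + 2).-1)./2 = ((2 * q + 1) * (4 * q + 1)))%N.
    by rewrite addnS /=; nia.
  by rewrite !(ssrnat.oddM, ssrnat.oddD).
have -> : (((q * 4 + 3) * (q * 4 + 3).-1)./2 = ((4 * q + 3) * (2 * q + 1)))%N.
  by rewrite addnS /=; nia.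
by rewrite !(ssrnat.oddM, ssrnat.oddD).
Qed.

Lemma reverse_sign M A : reverse M A = blade_sign A A * M A.
Proof. by rewrite reverseE blade_sign_sqr. Qed.

Lemma blade_signK A B : blade_sign A B * blade_sign A B = 1.
Proof.
rewrite /blade_sign -big_split /= big1 // => i _; exact: prodN1_sqr.
Qed.

Lemma reverseM M N : reverse (M * N) = reverse N * reverse M.
Proof.
apply/ffunP => C; rewrite reverse_sign !cl_mulrE mulr_sumr.
rewrite [RHS](reindex_inj (h := fun A => symdiff A C)) /=; last first.
  by apply: (can_inj (g := fun A => symdiff A C)) => A; rewrite -symdiffA symdiffxx symdiffx0.
apply: eq_bigr => A _; rewrite -[symdiff (symdiff A C) C]symdiffA symdiffxx (symdiffx0 A).
rewrite !reverse_sign !blade_sign_symdiffl !blade_sign_symdiffr.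
rewrite -[LHS]mulr1 -(blade_signK A A) -[LHS]mulr1 -(blade_signK C A); ring.
Qed.

End CliffordAlgebra.

Section CliffordAnalysis.
Variables (R : realType) (n : nat).
Implicit Types (M N : clifford R n).

Definition cl_sqrnorm M : R := scalar_part (M * reverse M).

Lemma cl_sqrnormE M : cl_sqrnorm M = \sum_A M A ^+ 2.
Proof.
rewrite /cl_sqrnorm /scalar_part cl_mulrE; apply: eq_bigr => A _.
rewrite !(symdiffx0 A) reverse_sign expr2.
by rewrite -[RHS]mul1r -(blade_signK R A A); ring.
Qed.

Definition cl_exp M : clifford R n :=
  [ffun A => limn (series (fun k => (k`!%:R^-1 *: M ^+ k) A))].

Lemma cl_exp_sqrN1 (I : clifford R n) (t : R) : I * I = -1 ->
  cl_exp (t *: I) = (cos t)%:A + sin t *: I.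
Proof.
move=> II; apply/ffunP => A; rewrite cl_addE !cl_scaleE ffunE.
have Ik k : I ^+ k = (-1) ^+ k./2 *: (if odd k then I else 1).
  elim: k => [|k IHk]; first by rewrite expr0 scale1r.
  rewrite exprSr IHk /= uphalf_half -scalerAl.
  by case: odd; rewrite /= ?add0n ?mul1r // exprS II scalerN mulN1r scaleNr.
rewrite (_ : series _ = (fun m => series (cos_coeff t) m * (1 : clifford R n) A
    + series (sin_coeff t) m * I A)); last first.
  apply/funext => m; rewrite /series /= !mulr_suml -big_split /=.
  apply: eq_bigr => k _; rewrite exprZn Ik !cl_scaleE /cos_coeff /sin_coeff /=.
  have -> : (-1) ^ k./2 = (-1) ^+ k./2 :> R by [].
  case: (boolP (odd k)) => [ok|_]; rewrite /= ?mul1r ?mul0r; last by ring.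
  have -> : k.-1./2 = k./2 by case: k ok => //= k; rewrite uphalf_half => /negPf->.
  ring.
apply/cvg_lim => //; rewrite cos.unlock sin.unlock.
apply: cvgD; apply: cvgM (cvg_cst _); first exact: is_cvg_series_cos_coeff.
exact: is_cvg_series_sin_coeff.
Qed.

Definition cl_integrable d (T : measurableType d)
    (mu : {measure set T -> \bar R}) (D : set T) (F : T -> clifford R n) :=
  forall A, mu.-integrable D (fun x => (F x A)%:E).

Definition cl_integral d (T : measurableType d)
    (mu : {measure set T -> \bar R}) (D : set T) (F : T -> clifford R n) :
    clifford R n :=
  [ffun A => \int[mu]_(x in D) F x A].

Definition cl_measurable d (T : measurableType d) (F : T -> clifford R n) :=
  forall A, measurable_fun setT (fun x => F x A).

End CliffordAnalysis.

Definition measure_matrix_display : measure_display. Proof. exact. Qed.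

Section MeasurableMatrix.
Variables (R : realType) (m n : nat).

(* The product sigma-algebra of the m * n copies of the Borel sigma-algebra of
   R, i.e., the Borel sigma-algebra of 'M[R]_(m, n). *)
Definition matrix_salgebra : set (set 'M[R]_(m, n)) :=
  <<s [set E | exists i j (B : set R),
         measurable B /\ E = (fun A : 'M[R]_(m, n) => A i j) @^-1` B] >>.

HB.instance Definition _ := @isMeasurable.Build measure_matrix_display
  'M[R]_(m, n) matrix_salgebra (@sigma_algebra0 _ _ _)
  (@sigma_algebraC _ _ ) (@sigma_algebra_bigcup _ _ _).

Lemma measurable_coord i j :
  measurable_fun setT (fun A : 'M[R]_(m, n) => A i j).
Proof.
move=> _ B mB; rewrite setTI; apply: sub_sigma_algebra.
by exists i, j, B.
Qed.

Lemma measurable_fun_matrix d (T : measurableType d) (f : T -> 'M[R]_(m, n)) :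
  (forall i j, measurable_fun setT (fun x => f x i j)) -> measurable_fun setT f.
Proof.
move=> mf; apply: measurability => //.
by move=> _ [_ [i [j [B [mB ->]]]] <-]; apply: (mf i j).
Qed.

End MeasurableMatrix.

Section LebesgueMeasure.
Variable R : realType.

Definition cons_cv n (p : R * 'cV[R]_n) : 'cV[R]_n.+1 :=
  \col_i oapp (p.2^~ 0) p.1 (unlift ord0 i).

Definition uncons_cv n (x : 'cV[R]_n.+1) : R * 'cV[R]_n :=
  (x ord0 0, \col_i x (lift ord0 i) 0).

Lemma cons_cv0 n (p : R * 'cV[R]_n) : cons_cv p ord0 0 = p.1.
Proof. by rewrite mxE unlift_none. Qed.

Lemma cons_cvS n (p : R * 'cV[R]_n) i : cons_cv p (lift ord0 i) 0 = p.2 i 0.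
Proof. by rewrite mxE liftK. Qed.

Lemma cons_cvK n : cancel (@cons_cv n) (@uncons_cv n).
Proof.
move=> [a x]; rewrite /uncons_cv cons_cv0; congr pair.
by apply/colP => i; rewrite mxE cons_cvS.
Qed.

Lemma uncons_cvK n : cancel (@uncons_cv n) (@cons_cv n).
Proof.
move=> x; apply/colP => i; case: (unliftP ord0 i) => [j ->|->].
  by rewrite cons_cvS mxE.
by rewrite cons_cv0.
Qed.

Lemma measurable_cons_cv n : measurable_fun setT (@cons_cv n).
Proof.
apply: measurable_fun_matrix => i j; rewrite (ord1 j).
case: (unliftP ord0 i) => [k ->|->].
  under eq_fun do rewrite cons_cvS.
  exact: (measurableT_comp (@measurable_coord R n 1 k 0) measurable_snd).
under eq_fun do rewrite cons_cv0.
exact: measurable_fst.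
Qed.

Lemma measurable_uncons_cv n : measurable_fun setT (@uncons_cv n).
Proof.
apply/measurable_fun_pairP; split => /=; first exact: measurable_coord.
apply: measurable_fun_matrix => i j.
rewrite (_ : (fun _ => _) = fun x : 'cV[R]_n.+1 => x (lift ord0 i) 0).
  exact: measurable_coord.
by apply/funext => x /=; rewrite mxE.
Qed.

Section Step.
Variables (n : nat) (mu : {sigma_finite_measure set 'cV[R]_n -> \bar R}).

Definition lebesgue_cvS : set 'cV[R]_n.+1 -> \bar R :=
  pushforward (lebesgue_measure \x mu)%E (@cons_cv n).

Lemma lebesgue_cvS0 : lebesgue_cvS set0 = 0%E.
Proof. by rewrite /lebesgue_cvS /pushforward preimage_set0 measure0. Qed.

Lemma lebesgue_cvS_ge0 A : (0 <= lebesgue_cvS A)%E.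
Proof. rewrite /lebesgue_cvS /pushforward; exact: measure_ge0. Qed.

Lemma lebesgue_cvS_sigma_additive : semi_sigma_additive lebesgue_cvS.
Proof.
have mp A : measurable A -> measurable (@cons_cv n @^-1` A).
  by move=> mA; rewrite -[X in measurable X]setTI; exact: measurable_cons_cv.
move=> F mF tF mUF; rewrite /lebesgue_cvS /pushforward preimage_bigcup.
apply: measure_semi_sigma_additive.
- by move=> k; exact: mp.
- apply/trivIsetP => /= i j _ _ ij; rewrite -preimage_setI.
  by move/trivIsetP : tF => /(_ _ _ _ _ ij) ->//; rewrite preimage_set0.
- by rewrite -preimage_bigcup; exact: mp.
Qed.

HB.instance Definition _ := isMeasure.Build _ _ _ lebesgue_cvS
  lebesgue_cvS0 lebesgue_cvS_ge0 lebesgue_cvS_sigma_additive.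

Lemma lebesgue_cvS_sigma_finite : sigma_finite setT lebesgue_cvS.
Proof.
have /sigma_finiteP[F [TF ndF Foo]] := sigma_finiteT (@lebesgue_measure R).
have /sigma_finiteP[G [TG ndG Goo]] := sigma_finiteT mu.
have mFG k : measurable (F k `*` G k).
  by apply: measurableX; [exact: (Foo k).1|exact: (Goo k).1].
exists (fun k => @uncons_cv n @^-1` (F k `*` G k)).
  rewrite -preimage_bigcup (_ : \bigcup_k _ = setT) ?preimage_setT //.
  rewrite -setXTT TF TG predeqE => -[x y]; split.
    by move=> [k _ []/= ? ?]; split; exists k.
  move=> [/= [k _ Fkx] [l _ Gly]]; exists (maxn k l) => //; split.
  - by move: x Fkx; exact/subsetPset/ndF/leq_maxl.
  - by move: y Gly; exact/subsetPset/ndG/leq_maxr.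
move=> k; split.
  by rewrite -[X in measurable X]setTI; apply: measurable_uncons_cv (mFG k).
rewrite /lebesgue_cvS /pushforward -comp_preimage.
have -> : @uncons_cv n \o @cons_cv n = id by exact/funext/cons_cvK.
rewrite preimage_id; have [[mF Fk] [mG Gk]] := (Foo k, Goo k).
by rewrite product_measure1E // lte_mul_pinfty // ge0_fin_numE.
Qed.

HB.instance Definition _ :=
  Measure_isSigmaFinite.Build _ _ _ lebesgue_cvS lebesgue_cvS_sigma_finite.

End Step.

(* Lebesgue measure on R^n: the image of lebesgue_measure \x lebesgue_cv (n-1)
   under (a, x) |-> (a, x_0, ..., x_(n-2)). *)
Fixpoint lebesgue_cv n : {sigma_finite_measure set 'cV[R]_n -> \bar R} :=
  if n is n'.+1 then lebesgue_cvS (lebesgue_cv n') else dirac (0 : 'cV[R]_0).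

Definition box n (a b : 'cV[R]_n) : set 'cV[R]_n :=
  [set x | forall i, x i 0 \in `[a i 0, b i 0]].

Lemma measurable_box n (a b : 'cV[R]_n) : measurable (box a b).
Proof.
rewrite (_ : box a b =
    \bigcap_(i in [set: 'I_n]) (fun x : 'cV[R]_n => x i 0) @^-1` `[a i 0, b i 0]).
  apply: fin_bigcap_measurable => // i _.
  by rewrite -[X in measurable X]setTI; apply: measurable_coord.
by apply/seteqP; split => x h i /=; [move=> _; exact: h|exact: (h i I)].
Qed.

Lemma lebesgue_cv_box n (a b : 'cV[R]_n) : (forall i, a i 0 <= b i 0) ->
  lebesgue_cv n (box a b) = (\prod_i (b i 0 - a i 0))%:E.
Proof.
elim: n a b => [|n IHn] a b ab.
  by rewrite big_ord0 /= diracE mem_set //= => -[].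
rewrite big_ord_recl /= /lebesgue_cvS /pushforward.
pose a' : 'cV[R]_n := \col_i a (lift ord0 i) 0.
pose b' : 'cV[R]_n := \col_i b (lift ord0 i) 0.
have -> : @cons_cv n @^-1` box a b =
    `[a ord0 0, b ord0 0]%classic `*` box a' b'.
  apply/seteqP; split => [[t x] /= h|[t x] /= [h0 hS] i].
    split; first by have := h ord0; rewrite cons_cv0.
    by move=> i; have := h (lift ord0 i); rewrite cons_cvS !mxE.
  case: (unliftP ord0 i) => [k ->|->]; rewrite ?cons_cvS ?cons_cv0 //.
  by have := hS k; rewrite !mxE.
rewrite product_measure1E //; last exact: measurable_box.
rewrite [X in (X * _)%E]lebesgue_measure_itv /= lte_fin.
rewrite IHn; last by move=> i; rewrite !mxE.
under eq_bigr do rewrite !mxE.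
have := ab ord0; rewrite le_eqVlt => /predU1P[->|->]; last by rewrite -EFinD -EFinM.
by rewrite ltxx subrr mul0r mul0e.
Qed.

End LebesgueMeasure.
Arguments lebesgue_cv {R} n.

Definition so_pred (R : realType) n : pred 'M[R]_n :=
  fun r => (r *m r^T == 1%:M) && (\det r == 1).

Definition SO (R : realType) n : Type := {r : 'M[R]_n | so_pred r}.

Definition so_display : measure_display. Proof. exact. Qed.

Section SpecialOrthogonal.
Variables (R : realType) (n : nat).
Implicit Types r s : SO R n.

HB.instance Definition _ := Choice.on (SO R n).

Lemma so1_subproof : so_pred (1%:M : 'M[R]_n).
Proof. by rewrite /so_pred trmx1 mulmx1 det1 !eqxx. Qed.

Lemma soM_subproof r s : so_pred (val r *m val s).
Proof.
case: r s => [r /= /andP[/eqP rr /eqP dr]] [s /= /andP[/eqP ss /eqP ds]].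
rewrite /so_pred trmx_mul mulmxA -(mulmxA r) ss mulmx1 rr eqxx /=.
by rewrite det_mulmx dr ds mulr1.
Qed.

Lemma soV_subproof r : so_pred (val r)^T.
Proof.
case: r => [r /= /andP[/eqP /mulmx1C rr /eqP dr]].
by rewrite /so_pred trmxK rr det_tr dr !eqxx.
Qed.

Definition so_one : SO R n := exist (fun q : 'M[R]_n => so_pred q) _ so1_subproof.
Definition so_mul r s : SO R n := exist (fun q : 'M[R]_n => so_pred q) _ (soM_subproof r s).
Definition so_inv r : SO R n := exist (fun q : 'M[R]_n => so_pred q) _ (soV_subproof r).

Lemma so_mulA : associative so_mul.
Proof. by move=> r s t; apply/val_inj; rewrite /= mulmxA. Qed.

Lemma so_mul1l : left_id so_one so_mul.
Proof. by move=> r; apply/val_inj; rewrite /= mul1mx. Qed.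

Lemma so_mul1r : right_id so_one so_mul.
Proof. by move=> r; apply/val_inj; rewrite /= mulmx1. Qed.

Lemma so_mulV : right_inverse so_one so_inv so_mul.
Proof. by move=> r; apply/val_inj; case: r => r /= /andP[/eqP]. Qed.

Lemma so_mulVl : left_inverse so_one so_inv so_mul.
Proof.
by move=> r; apply/val_inj; case: r => r /= /andP[/eqP /mulmx1C].
Qed.

HB.instance Definition _ := isGroup.Build (SO R n)
  so_mulA so_mul1l so_mul1r so_mulVl so_mulV.

HB.instance Definition _ := isPointed.Build (SO R n) so_one.

Definition so_salgebra : set (set (SO R n)) :=
  preimage_set_system setT (val : SO R n -> 'M[R]_n) measurable.

Lemma so_sigma_algebra : sigma_algebra setT so_salgebra.
Proof. exact/sigma_algebra_preimage/sigma_algebra_measurable. Qed.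

Lemma so_salgebra0 : so_salgebra set0.
Proof. by have [] := so_sigma_algebra. Qed.

Lemma so_salgebraC E : so_salgebra E -> so_salgebra (~` E).
Proof. by move=> mE; have [_ h _] := so_sigma_algebra; rewrite -setTD; exact: h. Qed.

Lemma so_salgebra_bigcup (E : (set (SO R n))^nat) :
  (forall i, so_salgebra (E i)) -> so_salgebra (\bigcup_i E i).
Proof. by have [_ _ +] := so_sigma_algebra; apply. Qed.

HB.instance Definition _ := @isMeasurable.Build so_display (SO R n)
  so_salgebra so_salgebra0 so_salgebraC so_salgebra_bigcup.

Lemma measurable_so_val : measurable_fun setT (val : SO R n -> 'M[R]_n).
Proof. by move=> _ E mE; exists E. Qed.

(* A Haar measure on the compact group SO(n) is normalized by taking it to be a
   probability measure. *)
Definition is_haar (haar : probability (SO R n) R) : Prop :=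
  forall r (E : set (SO R n)), measurable E ->
    haar [set s | E (r * s)%g] = haar E.

End SpecialOrthogonal.

Section CliffordWavelets.
Variables (R : realType) (n : nat).
Implicit Types (f g psi : 'cV[R]_n -> clifford R n) (w x b : 'cV[R]_n).

Definition L1 f : Prop :=
  cl_measurable f /\ cl_integrable (lebesgue_cv n) setT f.

Definition L2 f : Prop :=
  cl_measurable f /\
  (\int[lebesgue_cv n]_x (cl_sqrnorm (f x))%:E < +oo)%E.

Definition inner f g : clifford R n :=
  cl_integral (lebesgue_cv n) setT (fun x => f x * reverse (g x)).

Definition dot w x : R := \sum_i w i 0 * x i 0.

Definition cft f w : clifford R n :=
  cl_integral (lebesgue_cv n) setT
    (fun x => f x * cl_exp (- (dot w x *: pseudoscalar R n))).

(* fh is (a representative of) the Fourier transform of f in L^2, i.e., the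
   value at f of the continuous extension of cft from L^1 /\ L^2 to L^2. *)
Definition is_cft_L2 f fh : Prop :=
  L2 f /\ L2 fh /\
  exists u : nat -> 'cV[R]_n -> clifford R n,
    [/\ forall k, L1 (u k) /\ L2 (u k),
        (\int[lebesgue_cv n]_x (cl_sqrnorm (u k x - f x))%:E)%E
          @[k --> \oo] --> 0%E
      & (\int[lebesgue_cv n]_w (cl_sqrnorm (cft (u k) w - fh w))%:E)%E
          @[k --> \oo] --> 0%E].

Definition daughter psi (a : R) (r : SO R n) b : 'cV[R]_n -> clifford R n :=
  fun x => a `^ (- n%:R / 2) *: psi (val (r^-1)%g *m (a^-1 *: (x - b))).

Definition cwt psi f (a : R) (r : SO R n) b : clifford R n :=
  cl_integral (lebesgue_cv n) setT
    (fun x => f x * reverse (daughter psi a r b x)).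

Lemma cwtE psi f a r b : cwt psi f a r b = inner f (daughter psi a r b).
Proof. by []. Qed.

Variable haar : probability (SO R n) R.

Definition mu_domain : set (R * SO R n) := `]0, +oo[ `*` setT.

(* Integration of F(a, r) against dmu = a^-(n+1) da dtheta. *)
Definition mu_integrable (F : R -> SO R n -> clifford R n) : Prop :=
  cl_integrable (lebesgue_measure \x haar)%E mu_domain
    (fun p => p.1 ^- n.+1 *: F p.1 p.2).

Definition mu_integral (F : R -> SO R n -> clifford R n) : clifford R n :=
  cl_integral (lebesgue_measure \x haar)%E mu_domain
    (fun p => p.1 ^- n.+1 *: F p.1 p.2).

(* Integration of F(a, r, b) against the left Haar measure dmu d^n b of the
   similitude group. *)
Definition sim_integrable (F : R -> SO R n -> 'cV[R]_n -> clifford R n) : Prop :=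
  cl_integrable ((lebesgue_measure \x haar) \x lebesgue_cv n)%E
    (mu_domain `*` setT)
    (fun p => p.1.1 ^- n.+1 *: F p.1.1 p.1.2 p.2).

Definition sim_integral (F : R -> SO R n -> 'cV[R]_n -> clifford R n) :
    clifford R n :=
  cl_integral ((lebesgue_measure \x haar) \x lebesgue_cv n)%E
    (mu_domain `*` setT)
    (fun p => p.1.1 ^- n.+1 *: F p.1.1 p.1.2 p.2).

Definition admissibility_integrand (psih : 'cV[R]_n -> clifford R n) w
    (a : R) (r : SO R n) : clifford R n :=
  let M := psih (a *: (val (r^-1)%g *m w)) in a ^+ n *: (reverse M * M).

(* psi is an admissible mother wavelet with admissibility constant C. The
   condition does not depend on the representative psih. *)
Definition admissible psi (C : clifford R n) : Prop :=
  [/\ L2 psi,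
      (n %% 4 = 2)%N ->
        {ae lebesgue_cv n, forall x, is_even (psi x)} \/
        {ae lebesgue_cv n, forall x, is_odd (psi x)},
      C \is a GRing.unit
    & exists2 psih, is_cft_L2 psi psih &
        {ae lebesgue_cv n, forall w,
           mu_integrable (admissibility_integrand psih w) /\
           mu_integral (admissibility_integrand psih w) = C}].

End CliffordWavelets.

(* Main.v *)
(* For fixed (a, r), T_psi f(a, r, .) is the correlation of f with the daughter
   wavelet. The parity condition on psi (n = 2 mod 4), or the centrality of I
   (n = 3 mod 4), gives psi(x) I = s I psi(x) with s = 1 or s = -1, so that the
   Fourier transform of the correlation is the product of the transforms up to
   the reflection w |-> s w. Plancherel then gives, for f in L^1 and L^2,
     (2 pi)^n int_G |T_psi f|^2 = int_w <f^(w) C_psi f^(w)~>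
                                = (2 pi)^n int_x <f C_psi f~>
   because int_(a, r) of the admissibility integrand is C_psi and C_psi commutes
   with I. All integrands are nonnegative, so only Tonelli is needed here. The
   identity extends to L^2 by truncation, and polarizing it with f and
   e_A g rev(C_psi^-1) gives the A-component of the reconstruction formula.
   Plancherel itself comes from the scalar case: Abel summation with the kernel
   prod_i exp (- e |w_i|) turns the mean of |f^|^2 into a Poisson mean of the
   autocorrelation of f, which is continuous at 0 along segments. *)
Require Import Defs.
From HB Require Import structures.
From mathcomp Require Import all_boot all_order all_algebra.
From mathcomp Require Import ring lra.
From mathcomp Require Import all_classical all_reals all_analysis.
From mathcomp Require Import measurable_realfun measurable_fun_approximation.
Set Implicit Arguments.
Unset Strict Implicit.
Unset Printing Implicit Defensive.
Import Order.TTheory GRing.Theory Num.Theory.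
Import numFieldNormedType.Exports.
Local Open Scope classical_set_scope.
Local Open Scope ring_scope.

(** * Changes of variables for Lebesgue measure *)

(** The L^2 transform of psi is given only through arbitrary approximants in L^1 and L^2, which need
    not inherit the parity of psi. The projection [twist s] repairs this: it is linear, does not
    increase norms and commutes with right multiplication by phases, hence with the Fourier
    integral. It also shows that psi^ is twisted almost everywhere, and this is where the
    commutation of C_psi with I comes from. The noncommutative product is kept out of the analysis:
    estimates and identities concern real quantities, and the multivector formula is read off
    coordinate by coordinate, because the A-coordinate of M rev(N) is the Euclidean product of M and
    e_A N. Polarization needs the form (M, N) |-> (M C_psi, N) to be symmetric, that is, C_psi =
    rev(C_psi), which is visible on the integrand rev(P) P. Translations are studied only along z /
    (k + 1): the Abel parameter runs through 1 / (k + 1), and the Poisson kernel of parameter e is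
    rescaled to parameter 1, so that each autocorrelation is evaluated at e u with u fixed. *)

Section ScaledIntegral.
Context d (T : measurableType d) (R : realType).
Variable mu : {measure set T -> \bar R}.

(** Change of variables with constant Jacobian, tested on nonnegative functions only. Tonelli then
    suffices to establish it, and the signed and Clifford-valued versions follow from it once for
    all maps. *)
Definition scales_integral (phi : T -> T) (c : R) :=
  measurable_fun setT phi /\
  forall F : T -> \bar R, measurable_fun setT F -> (forall x, 0 <= F x)%E ->
    (\int[mu]_x F (phi x) = c%:E * \int[mu]_x F x)%E.
End ScaledIntegral.

Lemma tonelli d1 d2 (T1 : measurableType d1) (T2 : measurableType d2) (R : realType)
    (m1 : {sigma_finite_measure set T1 -> \bar R}) (m2 : {sigma_finite_measure set T2 -> \bar R})
    (f : T1 -> T2 -> \bar R) :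
  measurable_fun setT (fun p : T1 * T2 => f p.1 p.2) -> (forall x y, 0 <= f x y)%E ->
  (\int[m1]_x \int[m2]_y f x y = \int[m2]_y \int[m1]_x f x y)%E.
Proof. by move=> mf f0; exact: (fubini_tonelli (fun p => f p.1 p.2)). Qed.
Arguments tonelli {d1 d2 T1 T2 R m1 m2} f.

(** Uniqueness of Lebesgue measure: [|a|] times its image under the affine map agrees with it on
    half-open intervals. *)
Lemma scales_affine1 (R : realType) (a b : R) : a != 0 ->
  scales_integral (@lebesgue_measure R) (fun t : R => a * t + b) `|a|^-1.
Proof.
move=> a0; set phi := fun t : R => _.
have mphi : measurable_fun setT (phi : measurableTypeR R -> measurableTypeR R).
  by apply: measurable_funD => //; exact: measurable_funM.
split=> // F mF F0.
have na0 : 0 <= `|a| by [].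
pose m' : {measure set (measurableTypeR R) -> \bar R} := mscale (NngNum na0)
  (measure_function_pushforward__canonical__measure_function_Measure lebesgue_measure mphi).
have E : forall A, measurable A -> lebesgue_measure A = m' A.
  apply: lebesgue_measure_unique => _ [[u v]] _ <-.
  transitivity (`|a|%:E * lebesgue_measure (phi @^-1` `]u, v]))%E; last by [].
  case: (ltrP 0 a) => [ap|]; last rewrite le_eqVlt (negbTE a0) /= => an.
    have -> : phi @^-1` `]u, v] = `](u - b) / a, (v - b) / a]%classic.
      apply/seteqP; split=> t /=; rewrite !in_itv /= /phi ltr_pdivrMr // ler_pdivlMr //; rewrite (mulrC t) ltrBlDr lerBrDr //.
    rewrite !lebesgue_measure_itv /= !lte_fin ltr_pM2r ?invr_gt0 // ltrD2r gtr0_norm //.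
    case: ifP; rewrite ?mule0 // => _; rewrite -!EFinD -EFinM; congr EFin; by field.
  (* A negative slope moves the closed end of the interval to the left; the length is the same. *)
  have -> : phi @^-1` `]u, v] = `[(v - b) / a, (u - b) / a[%classic.
    apply/seteqP; split=> t /=; rewrite !in_itv /= /phi ltr_ndivlMr // ler_ndivrMr // (mulrC t) ltrBlDr lerBrDr andbC //.
  rewrite !lebesgue_measure_itv /= !lte_fin ltr_nM2r ?invr_lt0 // ltrD2r ltr0_norm //.
  case: ifP; rewrite ?mule0 // => _; rewrite -!EFinD -EFinM; congr EFin; by field; rewrite ?lt_eqF.
rewrite [in RHS](eq_measure_integral m'); last by move=> A mA _; exact: E.
rewrite ge0_integral_mscale // ge0_integral_pushforward //.
by rewrite /= preimage_setT muleA -EFinM mulVf ?normr_eq0 // mul1e.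
Qed.

Lemma integral_lebesgue_cvS (R : realType) n (F : 'cV[R]_n.+1 -> \bar R) :
  measurable_fun setT F -> (forall x, 0 <= F x)%E ->
  (\int[lebesgue_cv n.+1]_x F x =
   \int[lebesgue_measure]_t \int[lebesgue_cv n]_x F (cons_cv (t, x)))%E.
Proof.
move=> mF F0.
have mc := @measurable_cons_cv R n.
transitivity (\int[lebesgue_measure \x lebesgue_cv n]_p F (cons_cv p))%E.
  rewrite (eq_measure_integral (measure_function_pushforward__canonical__measure_function_Measure (lebesgue_measure \x lebesgue_cv n)%E mc)) //.
  by rewrite ge0_integral_pushforward // preimage_setT.
rewrite fubini_tonelli1 //; exact: measurableT_comp.
Qed.

Lemma measurable_mx_scale (R : realType) m n (a : R) :
  measurable_fun setT (fun x : 'M[R]_(m, n) => a *: x).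
Proof.
apply: measurable_fun_matrix => i j.
rewrite (_ : (fun _ => _) = fun x : 'M[R]_(m, n) => a * x i j); last by apply/funext => x; rewrite mxE.
apply: measurable_funM => //; exact: measurable_coord.
Qed.

Lemma measurable_mx_addr (R : realType) m n (b : 'M[R]_(m, n)) :
  measurable_fun setT (fun x : 'M[R]_(m, n) => x + b).
Proof.
apply: measurable_fun_matrix => i j.
rewrite (_ : (fun _ => _) = fun x : 'M[R]_(m, n) => x i j + b i j); last by apply/funext => x; rewrite mxE.
apply: measurable_funD => //; exact: measurable_coord.
Qed.

(** Induction on the dimension: splitting off one coordinate contributes one factor [|a|^-1] by the
    one-dimensional case. *)
Lemma scales_affine (R : realType) n (a : R) (b : 'cV[R]_n) : a != 0 ->
  scales_integral (lebesgue_cv n) (fun x => a *: x + b) (`|a|^-1 ^+ n).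
Proof.
move=> a0; split.
  exact: (measurableT_comp (measurable_mx_addr b) (measurable_mx_scale a)).
elim: n b => [|n IHn] b F mF F0.
  rewrite expr0 mul1e; apply: eq_integral => x _; congr F.
  by apply/matrixP => -[].
have mA : measurable_fun setT (fun x : 'cV[R]_n.+1 => a *: x + b).
  exact: (measurableT_comp (measurable_mx_addr b) (measurable_mx_scale a)).
rewrite integral_lebesgue_cvS //; last exact: measurableT_comp.
set b' := (uncons_cv b).2; set b0 := (uncons_cv b).1.
have E t x : a *: cons_cv (t, x) + b = cons_cv (a * t + b0, a *: x + b').
  apply/colP => i; rewrite !mxE; case: (unliftP ord0 i) => [j ->|->] /=; rewrite ?mxE //.
transitivity (\int[lebesgue_measure]_t ((`|a|^-1 ^+ n)%:E * \int[lebesgue_cv n]_x F (cons_cv ((a * t + b0)%R, x))))%E.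
  apply: eq_integral => t _; under eq_integral do rewrite E.
  apply: (IHn b' (fun x => F (cons_cv ((a * t + b0)%R, x)))) => //.
  apply: measurableT_comp => //.
  exact: (measurableT_comp (@measurable_cons_cv R n) (pair1_measurable _)).
have mG : measurable_fun setT (fun t : R => \int[lebesgue_cv n]_x F (cons_cv (t, x)))%E.
  apply: (measurable_fun_fubini_tonelli_F (fun p => F (cons_cv p))) => //.
  apply: measurableT_comp => //; exact: measurable_cons_cv.
have G0 (t : R) : (0 <= \int[lebesgue_cv n]_x F (cons_cv (t, x)))%E by exact: integral_ge0.
have [mL scL] := scales_affine1 b0 a0.
rewrite ge0_integralZl //; last exact: (measurableT_comp mG mL).
rewrite (scL (fun t => \int[lebesgue_cv n]_x F (cons_cv (t, x)))%E) // -integral_lebesgue_cvS //.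
by rewrite muleA -EFinM -exprSr.
Qed.

Lemma integral_translate (R : realType) n (b : 'cV[R]_n) (F : 'cV[R]_n -> \bar R) :
  measurable_fun setT F -> (forall x, 0 <= F x)%E ->
  (\int[lebesgue_cv n]_x F (x + b)%R = \int[lebesgue_cv n]_x F x)%E.
Proof.
move=> mF F0; have [_ /(_ F mF F0)] := scales_affine b (oner_neq0 R).
rewrite normr1 invr1 expr1n mul1e => <-; apply: eq_integral => x _; by rewrite scale1r.
Qed.

Lemma integral_reflect (R : realType) n (b : 'cV[R]_n) (F : 'cV[R]_n -> \bar R) :
  measurable_fun setT F -> (forall x, 0 <= F x)%E ->
  (\int[lebesgue_cv n]_x F (b - x)%R = \int[lebesgue_cv n]_x F x)%E.
Proof.
move=> mF F0; have [|_ /(_ F mF F0)] := @scales_affine R n (-1) b; first by rewrite oppr_eq0 oner_eq0.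
rewrite normrN1 invr1 expr1n mul1e => <-; apply: eq_integral => x _; by rewrite scaleN1r addrC.
Qed.

Lemma measurable_mulmx (R : realType) m n p :
  measurable_fun setT (fun A : 'M[R]_(m, n) * 'M[R]_(n, p) => A.1 *m A.2).
Proof.
apply: measurable_fun_matrix => i j.
rewrite (_ : (fun _ => _) = fun A : 'M[R]_(m, n) * 'M[R]_(n, p) => \sum_k A.1 i k * A.2 k j); last by apply/funext => x; rewrite mxE.
apply: measurable_sum => k; apply: measurable_funM.
  exact: (measurableT_comp (measurable_coord i k) measurable_fst).
exact: (measurableT_comp (measurable_coord k j) measurable_snd).
Qed.

Lemma measurable_mulmxl (R : realType) m n p (A : 'M[R]_(m, n)) :
  measurable_fun setT (fun B : 'M[R]_(n, p) => A *m B).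
Proof. exact: (measurableT_comp (@measurable_mulmx R m n p) (pair1_measurable A)). Qed.

Lemma measurable_mx_add (R : realType) m n :
  measurable_fun setT (fun p : 'M[R]_(m, n) * 'M[R]_(m, n) => p.1 + p.2).
Proof.
apply: measurable_fun_matrix => i j.
rewrite (_ : (fun _ => _) = fun p : 'M[R]_(m, n) * 'M[R]_(m, n) => p.1 i j + p.2 i j); last by apply/funext => x; rewrite mxE.
apply: measurable_funD.
  exact: (measurableT_comp (measurable_coord i j) measurable_fst).
exact: (measurableT_comp (measurable_coord i j) measurable_snd).
Qed.

Lemma measurable_mx_scale2 (R : realType) m n :
  measurable_fun setT (fun p : R * 'M[R]_(m, n) => p.1 *: p.2).
Proof.
apply: measurable_fun_matrix => i j.
rewrite (_ : (fun _ => _) = fun p : R * 'M[R]_(m, n) => p.1 * p.2 i j); last by apply/funext => x; rewrite mxE.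
apply: measurable_funM => //.
exact: (measurableT_comp (measurable_coord i j) measurable_snd).
Qed.

Definition cv_ball (R : realType) n : set 'cV[R]_n := [set x | dot x x <= 1].

Arguments cv_ball : clear implicits.

Lemma dotE (R : realType) n (x y : 'cV[R]_n) : dot x y = (x^T *m y) 0 0.
Proof. by rewrite mxE; apply: eq_bigr => i _; rewrite mxE. Qed.

Lemma measurable_dot (R : realType) n :
  measurable_fun setT (fun p : 'cV[R]_n * 'cV[R]_n => dot p.1 p.2).
Proof.
apply: measurable_sum => k; apply: measurable_funM.
  exact: (measurableT_comp (measurable_coord k 0) measurable_fst).
exact: (measurableT_comp (measurable_coord k 0) measurable_snd).
Qed.

Lemma measurable_cv_ball (R : realType) n : measurable (cv_ball R n).
Proof.
rewrite (_ : cv_ball R n = (fun x : 'cV[R]_n => dot x x) @^-1` `]-oo, 1]%classic); last first.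
  by apply/seteqP; split => x; rewrite /cv_ball /= in_itv.
rewrite -[X in measurable X]setTI.
have : measurable_fun setT (fun x : 'cV[R]_n => dot x x).
  exact: (measurableT_comp (@measurable_dot R n) (measurable_fun_pair (@measurable_id _ _ setT) (@measurable_id _ _ setT))).
apply => //; exact: measurable_itv.
Qed.

Lemma cv_ball_gt0 (R : realType) n : (0 < lebesgue_cv n (cv_ball R n))%E.
Proof.
(* A cube of this side lies in the ball: each squared coordinate is at most [e], so the n of them
   sum to at most n / (n + 1). The successor also covers n = 0. *)
pose e : R := n.+1%:R^-1.
have e0 : 0 < e by rewrite invr_gt0.
have e1 : e <= 1 by rewrite invf_le1 // ler1n.
have le0 i : (const_mx 0 : 'cV[R]_n) i 0 <= (const_mx e : 'cV[R]_n) i 0 by rewrite !mxE ltW.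
apply: (@lt_le_trans _ _ (lebesgue_cv n (box (const_mx 0) (const_mx e)))).
  rewrite lebesgue_cv_box // lte_fin prodr_gt0 // => i _; by rewrite !mxE subr0.
apply: le_measure; rewrite ?inE; [exact: measurable_box|exact: measurable_cv_ball|].
move=> x xb; rewrite /cv_ball /= /dot.
apply: (@le_trans _ _ (\sum_(i < n) e)).
  apply: ler_sum => i _; have := xb i; rewrite !mxE in_itv /= => /andP[x0 xe].
  by rewrite -[leRHS]mulr1 ler_pM // (le_trans xe).
rewrite sumr_const card_ord -mulr_natl /e ler_pdivrMr // mul1r ler_nat //.
Qed.

Lemma cv_ball_lty (R : realType) n : (lebesgue_cv n (cv_ball R n) < +oo)%E.
Proof.
have le0 i : (const_mx (- 1) : 'cV[R]_n) i 0 <= (const_mx 1 : 'cV[R]_n) i 0 by rewrite !mxE; apply: (@le_trans _ _ 0); rewrite ?lerN10 ?ler01.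
apply: (@le_lt_trans _ _ (lebesgue_cv n (box (const_mx (-1)) (const_mx 1)))); last first.
  by rewrite lebesgue_cv_box // ltry.
apply: le_measure; rewrite ?inE; [exact: measurable_cv_ball|exact: measurable_box|].
move=> x xb i; rewrite !mxE in_itv /= -ler_norml -(@expr_le1 _ 2) // real_normK ?num_real //.
apply: le_trans xb; rewrite /dot (bigD1 i) //= -expr2 lerDl.
by apply: sumr_ge0 => j _; rewrite -expr2 sqr_ge0.
Qed.

(* [int F(A x) * int 1_B = int F * int 1_B] for the unit ball [B], by Tonelli and
   translation invariance, since [B] is invariant under [A]. *)
Lemma scales_orthogonal (R : realType) n (A : 'M[R]_n) : A *m A^T = 1%:M ->
  scales_integral (lebesgue_cv n) (fun x => A *m x) 1.
Proof.
move=> AA; have mA := @measurable_mulmxl R n n 1 A.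
split=> // F mF F0; rewrite mul1e.
pose G (x : 'cV[R]_n) : \bar R := (\1_(cv_ball R n) x)%:E.
have G0 x : (0 <= G x)%E by rewrite lee_fin.
have mG : measurable_fun setT G.
  by apply/measurable_EFinP; apply: measurable_indic; exact: measurable_cv_ball.
have GA x : G (A *m x) = G x.
  have E : cv_ball R n (A *m x) = cv_ball R n x.
    by rewrite /cv_ball /= !dotE trmx_mul mulmxA -(mulmxA x^T) (mulmx1C AA) mulmx1.
  by congr EFin; rewrite !indicE; congr (nat_of_bool _)%:R; apply/idP/idP; rewrite !inE E.
have [k k0 KE] : exists2 k, 0 < k & (\int[lebesgue_cv n]_x G x = k%:E)%E.
  exists (fine (lebesgue_cv n (cv_ball R n))).
    by rewrite fine_gt0 // cv_ball_gt0 cv_ball_lty.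
  rewrite fineK ?ge0_fin_numE ?cv_ball_lty //.
  by rewrite integral_indic ?setIT //; exact: measurable_cv_ball.
have mp1 (H : 'cV[R]_n -> \bar R) (g : 'cV[R]_n * 'cV[R]_n -> 'cV[R]_n) : measurable_fun setT H ->
   measurable_fun setT g -> measurable_fun setT (H \o g) by move=> mH mg; exact: measurableT_comp.
have msub : measurable_fun setT (fun p : 'cV[R]_n * 'cV[R]_n => p.2 - A *m p.1).
  rewrite (_ : (fun _ => _) = (fun p : 'cV[R]_n * 'cV[R]_n => p.1 + p.2) \o (fun p => (p.2, (-1) *: (A *m p.1)))); last first.
    by apply/funext => p /=; rewrite scaleN1r.
  apply: measurableT_comp; first exact: measurable_mx_add.
  apply: measurable_fun_pair => //=.
  apply: (measurableT_comp (measurable_mx_scale (-1))); exact: (measurableT_comp mA measurable_fst).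
have mA1 : measurable_fun setT (fun p : 'cV[R]_n * 'cV[R]_n => A *m p.1) by exact: (measurableT_comp mA measurable_fst).
have H1 : (k%:E * \int[lebesgue_cv n]_x F (A *m x) = \int[lebesgue_cv n]_x \int[lebesgue_cv n]_y (F (A *m x) * G (y - A *m x)%R))%E.
  rewrite -ge0_integralZl //; [|exact: (measurableT_comp mF mA)|by rewrite lee_fin ltW].
  apply: eq_integral => x _; rewrite ge0_integralZl //; last first.
    apply: (measurableT_comp mG); exact: measurable_mx_addr.
  by rewrite (integral_translate (- (A *m x))) // KE muleC.
have H2 : (k%:E * \int[lebesgue_cv n]_x F x = \int[lebesgue_cv n]_x \int[lebesgue_cv n]_y (F (y - A *m x)%R * G (A *m x)))%E.
  have I0 : (0 <= \int[lebesgue_cv n]_x F x)%E by exact: integral_ge0.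
  transitivity (\int[lebesgue_cv n]_x (G x * \int[lebesgue_cv n]_x F x))%E.
    by rewrite (ge0_integralZr (lebesgue_cv n) measurableT mG (fun x _ => G0 x) I0) KE.
  apply: eq_integral => x _; rewrite ge0_integralZr //; last first.
    apply: (measurableT_comp mF); exact: measurable_mx_addr.
  by rewrite (integral_translate (- (A *m x))) // GA muleC.
have : (k%:E * \int[lebesgue_cv n]_x F (A *m x) = k%:E * \int[lebesgue_cv n]_x F x)%E.
  rewrite H1 H2.
  rewrite (tonelli (fun x y : 'cV[R]_n => F (A *m x) * G (y - A *m x)%R)%E); last first.
    by move=> x y; rewrite mule_ge0.
    by apply: emeasurable_funM; exact: mp1.
  rewrite (tonelli (fun x y : 'cV[R]_n => F (y - A *m x)%R * G (A *m x))%E); last first.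
    by move=> x y; rewrite mule_ge0.
    by apply: emeasurable_funM; exact: mp1.
  apply: eq_integral => y _ /=.
  (* For fixed [y] the substitution of A^T y - x for x exchanges A x and y - A x, hence the
     arguments of [F] and [G]. *)
  rewrite -(integral_reflect (A^T *m y)); last first.
    by move=> x; rewrite mule_ge0.
    apply: emeasurable_funM; apply: measurableT_comp => //.
    exact: (measurableT_comp msub (pair2_measurable y)).
  apply: eq_integral => x _.
  by rewrite mulmxBr mulmxA AA mul1mx opprB subrKC.
by move=> /(congr1 (mule k^-1%:E)); rewrite !muleA -EFinM mulVf ?gt_eqF // !mul1e.
Qed.

Section ScalesSigned.
Context d (T : measurableType d) (R : realType) (mu : {measure set T -> \bar R}).
Variables (phi : T -> T) (c : R).
Hypotheses (c0 : 0 <= c) (hphi : scales_integral mu phi c).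

Lemma scales_integrable (f : T -> \bar R) : mu.-integrable setT f ->
  mu.-integrable setT (fun x => f (phi x)).
Proof.
case: hphi => mphi hF /integrableP[mf fi]; apply/integrableP; split.
  exact: (measurableT_comp mf mphi).
rewrite (hF (fun x => `|f x|)%E) //; last exact: (measurableT_comp (@abse_measurable R setT) mf).
by rewrite lte_mul_pinfty.
Qed.

Lemma scales_Rintegral (f : T -> R) : mu.-integrable setT (EFin \o f) ->
  \int[mu]_x f (phi x) = c * \int[mu]_x f x.
Proof.
move=> fi; have [mphi hF] := hphi; have /integrableP[mf _] := fi.
have fp := integrable_pos_fin_num measurableT fi.
have fn := integrable_neg_fin_num measurableT fi.
rewrite /Rintegral (integralE _ _ (fun x => (f (phi x))%:E)).
rewrite (_ : (fun x => (f (phi x))%:E)^\+%E = fun x => (EFin \o f)^\+%E (phi x)); last by apply/funext => x; rewrite !funeposE.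
rewrite (_ : (fun x => (f (phi x))%:E)^\-%E = fun x => (EFin \o f)^\-%E (phi x)); last by apply/funext => x; rewrite !funenegE.
rewrite !hF //; [|exact: measurable_funeneg|exact: measurable_funepos].
by rewrite (integralE _ _ (fun x => (f x)%:E)) -muleBr ?fin_num_adde_defr ?fineM // fin_numB fp fn.
Qed.
End ScalesSigned.

(** * Limits and integrals of nonnegative quantities *)

Section NonnegLimits.
Variable R : realType.
Implicit Types u v : nat -> \bar R.

Lemma cvge0P u : (forall k, 0 <= u k)%E ->
  (u @ \oo --> 0%E) <-> (forall e : R, 0 < e -> \forall k \near \oo, (u k <= e%:E)%E).
Proof.
move=> u0; split=> [ucvg e e0|h].
  have /fine_cvgP[ufin /cvgrPdist_le/(_ _ e0) uc] := ucvg.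
  near=> k; have fk : u k \is a fin_num by near: k.
  rewrite -(fineK fk) lee_fin.
  have : `|0 - (fine \o u) k| <= e by near: k.
  by rewrite /= sub0r normrN; apply: le_trans; exact: ler_norm.
have hfin : \forall k \near \oo, u k \is a fin_num.
  near=> k; rewrite ge0_fin_numE //; apply: (@le_lt_trans _ _ 1%:E); last exact: ltry.
  by near: k; exact: h.
apply/fine_cvgP; split=> //; apply/cvgrPdist_le => e e0.
near=> k; rewrite sub0r normrN /= ger0_norm ?fine_ge0 //.
have fk : u k \is a fin_num by near: k.
by rewrite -lee_fin fineK //; near: k; exact: h.
Unshelve. all: by end_near. Qed.

Lemma squeeze0 u v : (forall k, 0 <= u k <= v k)%E -> v @ \oo --> 0%E -> u @ \oo --> 0%E.
Proof.
move=> uv; apply: (squeeze_cvge _ (cvg_cst 0%E)); exact: nearW.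
Qed.

Lemma cvge0Zl u (c : R) : u @ \oo --> 0%E -> (c%:E * u k)%E @[k --> \oo] --> 0%E.
Proof. by move=> /(cvgeZl (isT : c%:E \is a fin_num)); rewrite mule0. Qed.

(** The density argument: [j] is fixed first so that [a j] is small, and only then does [k] tend to
    infinity. *)
Lemma cvge0_approx u (a : nat -> \bar R) (b : nat -> nat -> \bar R) :
  (forall k, 0 <= u k)%E -> (forall j k, u k <= a j + b j k)%E ->
  (forall j, 0 <= a j)%E -> (forall j k, 0 <= b j k)%E ->
  a @ \oo --> 0%E -> (forall j, b j @ \oo --> 0%E) -> u @ \oo --> 0%E.
Proof.
move=> u0 uab a0 b0 /(cvge0P a0) ac bc; apply/cvge0P => // e e0.
have e20 : 0 < e / 2 by rewrite divr_gt0.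
have [j _ /(_ j (leqnn j)) /= aj] := ac _ e20.
have /(cvge0P (b0 j))/(_ _ e20) bj := bc j.
near=> k; apply: (le_trans (uab j k)); rewrite [e]splitr EFinD leeD //.
by near: k.
Unshelve. all: by end_near. Qed.

(* The bounds are those given by [|u + v|^2 <= (1 + t) |u|^2 + (1 + 1/t) |v|^2]. *)
Lemma cvge_quasi (P : \bar R) (p dk : nat -> \bar R) :
  (0 <= P)%E -> (P < +oo)%E -> (forall k, 0 <= p k)%E -> (forall k, 0 <= dk k)%E ->
  (forall (t : R) k, (0 < t)%R -> p k <= (1 + t)%:E * P + (1 + t^-1)%:E * dk k)%E ->
  (forall (t : R) k, (0 < t)%R -> P <= (1 + t)%:E * p k + (1 + t^-1)%:E * dk k)%E ->
  dk @ \oo --> 0%E -> p @ \oo --> P.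
Proof.
case: P => [P||] // P0 _ p0 d0 up lo /(cvge0P d0) dc.
rewrite lee_fin in P0.
have main (e : R) : 0 < e -> \forall k \near \oo, p k \is a fin_num /\ `|P - fine (p k)| <= e.
  (* This [t] gives 2 t P <= e / 2, the summand 4 keeping the denominator positive when P = 0. The
     bound t <= 1 lets a factor [t] be dropped when the upper estimate for [q] is inserted into the
     lower one. *)
  move=> e0; pose t := Num.min 1 (e / (4 * P + 4)).
  have P4 : 0 < 4 * P + 4 by lra.
  have t0 : 0 < t by rewrite lt_min ltr01 divr_gt0.
  have t1 : t <= 1 by rewrite ge_min lexx.
  have tP : 2 * t * P <= e / 2.
    have : t <= e / (4 * P + 4) by rewrite ge_min lexx orbT.
    rewrite ler_pdivlMr //; nra.
  set c := 1 + t^-1; have c0 : 0 < c by rewrite addr_gt0 // invr_gt0.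
  have dE : 0 < e / (4 * c) by rewrite divr_gt0 // mulr_gt0.
  near=> k.
  have dk1 : (dk k <= (e / (4 * c))%:E)%E by near: k; exact: dc.
  have dfin : dk k \is a fin_num by rewrite ge0_fin_numE // (le_lt_trans dk1) // ltry.
  have := up t k t0; have := lo t k t0.
  rewrite -/c; move: dk1 (d0 k); rewrite -(fineK dfin); set D := fine _ => dk1 D0.
  rewrite -!EFinM -EFinD => lo1 up1.
  have pfin : p k \is a fin_num by rewrite ge0_fin_numE // (le_lt_trans up1) // ltry.
  split=> //; move: lo1 up1 (p0 k); rewrite -(fineK pfin); set q := fine _.
  rewrite -!EFinM -!EFinD !lee_fin => lo1 up1 q0.
  rewrite !lee_fin in dk1 D0.
  have cD : c * D <= e / 4.
    by move: dk1; rewrite ler_pdivlMr ?mulr_gt0 //; nra.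
  have tq : t * q <= 2 * (t * P) + c * D.
    have h1 : t * q <= t * ((1 + t) * P + c * D) by rewrite ler_pM2l.
    have h2 : t * (t * P) <= t * P by rewrite ler_piMl // mulr_ge0 // ltW.
    have h3 : t * (c * D) <= c * D by rewrite ler_piMl // mulr_ge0 // ltW.
    by apply: (le_trans h1); lra.
  have tP0 : 0 <= t * P by rewrite mulr_ge0 // ltW.
  rewrite /= ler_norml; apply/andP; split; lra.
apply/fine_cvgP; split.
  by have [N _ h] := main 1 ltr01; exists N => // k /h[].
apply/cvgrPdist_le => e /main; apply: filterS => k [] //.
Unshelve. all: by end_near. Qed.

End NonnegLimits.

Section NonnegIntegrals.
Context d (T : measurableType d) (R : realType) (mu : {measure set T -> \bar R}).

Lemma integral_le_lin2 (D : set T) (f g h : T -> R) (a b : R) : measurable D ->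
  measurable_fun D f -> measurable_fun D g -> measurable_fun D h ->
  0 <= a -> 0 <= b -> (forall x, 0 <= f x) -> (forall x, 0 <= g x) -> (forall x, 0 <= h x) ->
  (forall x, h x <= a * f x + b * g x) ->
  (\int[mu]_(x in D) (h x)%:E <= a%:E * \int[mu]_(x in D) (f x)%:E + b%:E * \int[mu]_(x in D) (g x)%:E)%E.
Proof.
move=> mD mf mg mh a0 b0 f0 g0 h0 le.
rewrite -!ge0_integralZl_EFin //; do ?[by move=> x _; rewrite lee_fin]; do ?[exact/measurable_EFinP].
have mE (k : R) (u : T -> R) : measurable_fun D u -> measurable_fun D (fun x => k%:E * (u x)%:E)%E.
  by move=> mu_; apply: emeasurable_funM; [exact: measurable_cst|exact/measurable_EFinP].
rewrite -ge0_integralD //; do ?[exact: mE]; do ?[by move=> x _; rewrite -EFinM lee_fin mulr_ge0].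
apply: ge0_le_integral => //.
- by move=> x _; rewrite lee_fin.
- exact/measurable_EFinP.
- by apply: emeasurable_funD; exact: mE.
- by move=> x _; rewrite -!EFinM -EFinD lee_fin.
Qed.

Lemma dominated_cvg0 (D : set T) (u : nat -> T -> R) (g : T -> R) : measurable D ->
  (forall k, measurable_fun D (u k)) -> mu.-integrable D (EFin \o g) ->
  (forall k x, D x -> 0 <= u k x <= g x) -> (forall x, D x -> u k x @[k --> \oo] --> 0) ->
  (\int[mu]_(x in D) (u k x)%:E)%E @[k --> \oo] --> 0%E.
Proof.
move=> mD mu_ ig ug uc.
rewrite (_ : 0%E = \int[mu]_(x in D) cst 0%E x)%E; last by rewrite integral0.
apply: (dominated_cvg mD (f_ := fun k x => (u k x)%:E) (g := EFin \o g)) => //.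
- by move=> k; exact/measurable_EFinP.
- by move=> x Dx; apply/fine_cvgP; split; [exact: nearW|exact: uc].
- by move=> k x Dx /=; have /andP[u0 ul] := ug k x Dx; rewrite lee_fin ger0_norm.
Qed.

Lemma integrable_sqr (D : set T) (f : T -> R) : measurable D -> measurable_fun D f ->
  (\int[mu]_(x in D) ((f x) ^+ 2)%:E < +oo)%E -> mu.-integrable D (fun x => ((f x) ^+ 2)%:E).
Proof.
move=> mD mf h; apply/integrableP; split; first by apply/measurable_EFinP; exact: measurable_funX.
by under eq_integral do rewrite abse_EFin ger0_norm ?sqr_ge0 //.
Qed.

End NonnegIntegrals.

Lemma integrable_indic_finite d (T : measurableType d) (R : realType) (mu : {measure set T -> \bar R}) (U : set T) :
  measurable U -> (mu U < +oo)%E -> mu.-integrable setT (EFin \o (\1_U : T -> R)).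
Proof.
move=> mU Uoo; apply/integrableP; split; first by apply/measurable_EFinP; exact: measurable_indic.
under eq_integral do rewrite /= ger0_norm //.
by rewrite integral_indic // setIT.
Qed.

(** * Continuity of translations in L2 *)

Section TranslationContinuity.
Variables (R : realType) (n : nat).
Local Notation V := 'cV[R]_n.
Local Notation dx := (lebesgue_cv n).
Implicit Types (f g : V -> R) (z : V).

(** Squared L2 distance between [f] and its translate. Only the translations z / (k + 1) are tested,
    matching the values taken by the Abel parameter. *)
Definition shift_dist2 f z (k : nat) : \bar R :=
  (\int[dx]_x ((f (x + k.+1%:R^-1 *: z)%R - f x) ^+ 2)%:E)%E.

Definition shift_continuous f := forall z, shift_dist2 f z @ \oo --> 0%E.

Lemma measurable_shift f z : measurable_fun setT f -> measurable_fun setT (fun x : V => f (x + z)).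
Proof. by move=> mf; apply: (measurableT_comp mf); exact: measurable_mx_addr. Qed.

Lemma shift_dist2_ge0 f z k : (0 <= shift_dist2 f z k)%E.
Proof. by apply: integral_ge0 => x _; rewrite lee_fin sqr_ge0. Qed.

Lemma integral_shift2 f z : measurable_fun setT f ->
  (\int[dx]_x ((f (x + z)%R) ^+ 2)%:E = \int[dx]_x ((f x) ^+ 2)%:E)%E.
Proof.
move=> mf; apply: (integral_translate z (F := fun x => ((f x) ^+ 2)%:E)).
  by apply/measurable_EFinP; exact: measurable_funX.
by move=> x; rewrite lee_fin sqr_ge0.
Qed.

(** From (a + b + c)^2 <= 4 a^2 + 4 b^2 + 2 c^2, where [a] and [b] are f - g at the two points and
    [c] is the increment of [g]. By translation invariance the first two terms have the same
    integral, whence 8. *)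
Lemma shift_dist2_le f g z k : measurable_fun setT f -> measurable_fun setT g ->
  (shift_dist2 f z k <= 8%:E * \int[dx]_x ((f x - g x) ^+ 2)%:E + 2%:E * shift_dist2 g z k)%E.
Proof.
move=> mf mg; set h := k.+1%:R^-1 *: z.
have mfg : measurable_fun setT (fun x => f x - g x) by exact: measurable_funB.
have mB (u : V -> R) : measurable_fun setT u -> measurable_fun setT (fun x : V => (u (x + h) - u x) ^+ 2).
  by move=> mu; apply: measurable_funX; apply: measurable_funB => //; exact: measurable_shift.
have -> : (8%:E * \int[dx]_x ((f x - g x) ^+ 2)%:E =
    4%:E * \int[dx]_x (((f (x + h)%R - g (x + h)%R)) ^+ 2)%:E + 4%:E * \int[dx]_x ((f x - g x) ^+ 2)%:E)%E.
  rewrite (integral_shift2 h mfg) -ge0_muleDl ?lee_fin // -EFinD; congr (_%:E * _)%E; lra.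
rewrite -addeA.
pose w x := (f x - g x) ^+ 2; pose w' x := (f (x + h) - g (x + h)) ^+ 2.
pose v x := 2 * w x + 1 * (g (x + h) - g x) ^+ 2.
have mw : measurable_fun setT w by exact: measurable_funX.
have mw' : measurable_fun setT w' by apply: measurable_funX; exact: (measurable_shift h mfg).
have mg2 := mB g mg.
have mv : measurable_fun setT v.
  by apply: measurable_funD; apply: measurable_funM.
have w0 x : 0 <= w x by exact: sqr_ge0.
have w'0 x : 0 <= w' x by exact: sqr_ge0.
have v0 x : 0 <= v x by rewrite addr_ge0 // mulr_ge0 // ?sqr_ge0.
apply: (@le_trans _ _ (4%:E * \int[dx]_x (w' x)%:E + 2%:E * \int[dx]_x (v x)%:E)%E).
  apply: integral_le_lin2 => //; first exact: mB.
    by move=> x; exact: sqr_ge0.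
  move=> x; rewrite /v /w /w' -/h; move: (f (x + h)) (f x) (g (x + h)) (g x) => p q p' q'.
  have := sqr_ge0 ((p - p') - (q - q') - (p' - q')); have := sqr_ge0 ((p - p') + (q - q')); lra.
rewrite leeD2l //; last first.
apply: (@le_trans _ _ (2%:E * (2%:E * \int[dx]_x (w x)%:E + 1%:E * \int[dx]_x ((g (x + h)%R - g x) ^+ 2)%:E))%E).
  apply: lee_wpmul2l; first by rewrite lee_fin.
  by apply: integral_le_lin2 => //; move=> x; exact: sqr_ge0.
rewrite ge0_muleDr; last 2 first.
- by rewrite mule_ge0 ?lee_fin // integral_ge0 // => x _; rewrite lee_fin.
- by rewrite mule_ge0 ?lee_fin // integral_ge0 // => x _; rewrite lee_fin sqr_ge0.
rewrite mul1e muleA -EFinM; apply: leeD => //.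
by rewrite (_ : 2 * 2 = 4 :> R) //; lra.
Qed.

Lemma shift_continuous_closed f (g : nat -> V -> R) : measurable_fun setT f ->
  (forall j, measurable_fun setT (g j)) -> (forall j, shift_continuous (g j)) ->
  (\int[dx]_x ((f x - g j x) ^+ 2)%:E)%E @[j --> \oo] --> 0%E -> shift_continuous f.
Proof.
move=> mf mg cg fg z.
apply: (cvge0_approx (a := fun j => (8%:E * \int[dx]_x ((f x - g j x) ^+ 2)%:E)%E)
  (b := fun j k => (2%:E * shift_dist2 (g j) z k)%E)).
- by move=> k; exact: shift_dist2_ge0.
- by move=> j k; exact: shift_dist2_le.
- by move=> j; rewrite mule_ge0 ?lee_fin // integral_ge0 // => x _; rewrite lee_fin sqr_ge0.
- by move=> j k; rewrite mule_ge0 ?lee_fin // shift_dist2_ge0.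
- exact: cvge0Zl.
- by move=> j; apply: cvge0Zl; exact: cg.
Qed.

Lemma shift_continuous_lin a f g : measurable_fun setT f -> measurable_fun setT g ->
  shift_continuous f -> shift_continuous g -> shift_continuous (fun x => f x + a * g x).
Proof.
move=> mf mg cf cg z.
apply: (@squeeze0 _ _ (fun k => 2%:E * shift_dist2 f z k + (2 * a ^+ 2)%:E * shift_dist2 g z k)%E).
  move=> k; rewrite shift_dist2_ge0 /=; apply: integral_le_lin2 => //.
  - by apply: measurable_funX; apply: measurable_funB => //; exact: measurable_shift.
  - by apply: measurable_funX; apply: measurable_funB => //; exact: measurable_shift.
  - apply: measurable_funX; apply: measurable_funB => //; last by apply: measurable_funD => //; exact: measurable_funM.
    apply: (measurable_shift (f := fun x : V => f x + a * g x)); by apply: measurable_funD => //; exact: measurable_funM.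
  - by rewrite mulr_ge0 // sqr_ge0.
  - by move=> x; exact: sqr_ge0.
  - by move=> x; exact: sqr_ge0.
  - by move=> x; exact: sqr_ge0.
  - move=> x; set u := f _; set v := f _; set u' := g _; set v' := g _.
    by have := sqr_ge0 ((u - v) - a * (u' - v')); lra.
rewrite -(adde0 0%E); apply: cvgeD => //; exact: cvge0Zl.
Qed.


(** A weak form of openness, exactly what pointwise convergence of the translated indicators
    requires. It is stable under intersection and holds for coordinate half-spaces, so it suffices
    for a pi-system of generators. *)
Definition directionally_open (U : set V) := forall x z, U x ->
  \forall k \near \oo, U (x + k.+1%:R^-1 *: z).

Lemma directionally_openI U W : directionally_open U -> directionally_open W ->
  directionally_open (U `&` W).
Proof. by move=> oU oW x z [Ux Wx]; near=> k; split; near: k; [exact: oU|exact: oW].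
Unshelve. all: by end_near. Qed.

(** A point of [U] stays in [U] for all large k, so the integrand is eventually 0 at each point; the
    indicator of [U], of finite integral, dominates. *)
Lemma shift_leave_cvg0 (U : set V) z : measurable U -> directionally_open U -> (dx U < +oo)%E ->
  (\int[dx]_x (\1_U x * (1 - \1_U (x + k.+1%:R^-1 *: z)%R))%:E)%E @[k --> \oo] --> 0%E.
Proof.
move=> mU oU Uoo.
have mI : measurable_fun setT (\1_U : V -> R) by exact: measurable_indic.
apply: (dominated_cvg0 (u := fun k x => \1_U x * (1 - \1_U (x + k.+1%:R^-1 *: z))) (g := \1_U : V -> R)) => //.
- move=> k; apply: measurable_funM => //; apply: measurable_funB => //; exact: (measurable_shift (f := \1_U : V -> R)).
- apply: integrable_indic_finite => //.
- move=> k x _; rewrite !indicE; do 2!case: (_ \in _) => /=; rewrite ?mul1r ?mul0r ?subr0 ?subrr ?lexx ?ler01 //.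
- move=> x _; apply: cvg_near_cst; case: (pselect (U x)) => Ux; last first.
    by apply: nearW => k; rewrite indicE memNset // mul0r.
  have := oU x z Ux; apply: filterS => k Uk; by rewrite [X in 1 - X]indicE mem_set // subrr mulr0.
Qed.

(** The squared increment of an indicator counts the points leaving [U] and those entering it.
    Entering under [h] is, after a translation of the variable, leaving under - h. *)
Lemma shift_continuous_indic_open (U : set V) : measurable U -> directionally_open U -> (dx U < +oo)%E ->
  shift_continuous (\1_U).
Proof.
move=> mU oU Uoo z.
have mI : measurable_fun setT (\1_U : V -> R) by exact: measurable_indic.
have L1 := shift_leave_cvg0 z mU oU Uoo.
have L2 := shift_leave_cvg0 (- z) mU oU Uoo.
have mS (w : V) : measurable_fun setT (fun x : V => \1_U x * (1 - \1_U (x + w)) : R).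
  apply: measurable_funM => //; apply: measurable_funB => //; exact: (measurable_shift (f := \1_U : V -> R)).
have mS' (w : V) : measurable_fun setT (fun x : V => \1_U (x + w) * (1 - \1_U x) : R).
  apply: measurable_funM => //; [exact: (measurable_shift (f := \1_U : V -> R))|exact: measurable_funB].
have I01 (x : V) : 0 <= \1_U x :> R /\ 0 <= 1 - \1_U x :> R.
  by rewrite indicE; case: (_ \in _); rewrite ?subrr ?subr0 ?lexx ?ler01.
apply: (@squeeze0 _ _ (fun k => 1%:E * (\int[dx]_x (\1_U x * (1 - \1_U (x + k.+1%:R^-1 *: z)%R))%:E) +
   1%:E * (\int[dx]_x (\1_U x * (1 - \1_U (x + k.+1%:R^-1 *: - z)%R))%:E))%E); last first.
  by rewrite -(adde0 0%E); apply: cvgeD => //; exact: cvge0Zl.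
move=> k; rewrite shift_dist2_ge0 /=; set h := k.+1%:R^-1 *: z.
have -> : (\int[dx]_x (\1_U x * (1 - \1_U (x + k.+1%:R^-1 *: - z)%R))%:E =
   \int[dx]_x (\1_U (x + h)%R * (1 - \1_U x))%:E)%E.
  rewrite -(integral_translate (- h) (F := fun x => (\1_U (x + h)%R * (1 - \1_U x))%:E)).
  - by apply: eq_integral => x _; rewrite subrK scalerN.
  - by apply/measurable_EFinP; exact: mS'.
  - by move=> x; rewrite lee_fin mulr_ge0 //; exact: (I01 _).2.
apply: integral_le_lin2 => //.
- apply: measurable_funX; apply: measurable_funB => //; exact: (measurable_shift (f := \1_U : V -> R)).
- by move=> x; exact: sqr_ge0.
- move=> x; rewrite -/h !indicE; do 2!case: (_ \in _) => /=; lra.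
Qed.

Definition open_cube (m : nat) : set V := [set x | forall i, x i 0 \in `]- m%:R, m%:R[].

Lemma measurable_coord_preimage (B : set R) i : measurable B -> measurable [set x : V | B (x i 0)].
Proof.
move=> mB; rewrite -[X in measurable X]setTI.
exact: (measurable_coord i 0 measurableT mB).
Qed.

Lemma measurable_open_cube m : measurable (open_cube m).
Proof.
rewrite (_ : open_cube m = \bigcap_(i in [set: 'I_n]) [set x : V | `]- m%:R, m%:R[%classic (x i 0)]).
  apply: fin_bigcap_measurable => // i _.
  by apply: (@measurable_coord_preimage `]- m%:R, m%:R[%classic); exact: measurable_itv.
by apply/seteqP; split=> x h i /=; [move=> _; exact: h|exact: (h i I)].
Qed.

Lemma open_cube_lty m : (dx (open_cube m) < +oo)%E.
Proof.
have le0 i : (const_mx (- m%:R) : V) i 0 <= (const_mx m%:R : V) i 0.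
  by rewrite !mxE (@le_trans _ _ 0) // oppr_le0.
apply: (@le_lt_trans _ _ (dx (box (const_mx (- m%:R)) (const_mx m%:R)))); last first.
  by rewrite lebesgue_cv_box // ltry.
apply: le_measure; rewrite ?inE; [exact: measurable_open_cube|exact: measurable_box|].
by move=> x xb i; have := xb i; rewrite !mxE !in_itv /= => /andP[/ltW-> /ltW->].
Qed.

Lemma harmonic_scale_lt (a b z : R) : a < b -> \forall k \near \oo, a + k.+1%:R^-1 * z < b.
Proof.
move=> ab; have ba0 : 0 < b - a by rewrite subr_gt0.
have zc : k.+1%:R^-1 * z @[k --> \oo] --> (0 : R).
  rewrite -(mul0r z); apply: cvgM; last exact: cvg_cst.
  exact: cvg_harmonic.
have /cvgrPdist_lt/(_ _ ba0) := zc; apply: filterS => k.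
rewrite sub0r normrN => h; rewrite -ltrBrDl; apply: le_lt_trans h; exact: ler_norm.
Qed.

Lemma directionally_open_coord i (a : R) : directionally_open [set x : V | x i 0 < a].
Proof.
move=> x z /= xa; have := harmonic_scale_lt (z i 0) xa; apply: filterS => k.
by rewrite !mxE.
Qed.

Lemma directionally_open_cube m : directionally_open (open_cube m).
Proof.
move=> x z xQ.
have h i : \forall k \near \oo, (x + k.+1%:R^-1 *: z) i 0 \in `]- (m%:R : R), m%:R[.
  have := xQ i; rewrite in_itv /= => /andP[x1 x2].
  near=> k; rewrite !mxE in_itv /=; apply/andP; split.
    rewrite ltrNl opprD -mulrN; near: k; apply: harmonic_scale_lt; by rewrite ltrNl.
  by near: k; exact: harmonic_scale_lt.
exact: filter_forall.
Unshelve. all: by end_near. Qed.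


Definition dopen_system : set (set V) := [set U | measurable U /\ directionally_open U].

(** Preimages of open rays under coordinates are directionally open, and such rays generate the
    Borel sets of the line. *)
Lemma measurable_dopen : @measurable _ V = <<s dopen_system >>.
Proof.
apply/seteqP; split; last first.
  apply: smallest_sub; first exact: sigma_algebra_measurable.
  by move=> U [].
apply: smallest_sub; first exact: smallest_sigma_algebra.
move=> _ [i [j [B [mB ->]]]]; rewrite (ord1 j).
pose S : measurableType _ := g_sigma_algebraType dopen_system.
suff mf : measurable_fun [set: S] (fun x : S => (x : V) i 0 : measurableTypeR R).
  by have := mf measurableT B mB; rewrite setTI.
apply: (@measurability _ _ S (measurableTypeR R) setT _ (@RGenInftyO.G R) (RGenInftyO.measurableE R)) => _ [_ [a ->] <-].
rewrite setTI; apply: sub_sigma_algebra; split.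
  apply: (@measurable_coord_preimage `]-oo, a[%classic); exact: measurable_itv.
rewrite (_ : _ @^-1` _ = [set x : V | x i 0 < a]); first exact: directionally_open_coord.
by apply/seteqP; split => x; rewrite /= in_itv.
Qed.

(** Dynkin's pi-lambda argument. Intersecting with a cube keeps every measure finite, so that
    complements become differences inside the cube and disjoint unions become L2 limits dominated by
    the indicator of the cube. *)
Lemma shift_continuous_indic m (E : set V) : measurable E ->
  shift_continuous (\1_(E `&` open_cube m)).
Proof.
have mQ := @measurable_open_cube m.
have Qoo := @open_cube_lty m.
have mI (A : set V) : measurable A -> measurable_fun setT (\1_(A `&` open_cube m) : V -> R).
  by move=> mA; apply: measurable_indic; exact: measurableI.
move=> mE; have : <<s dopen_system >> E by rewrite -measurable_dopen.
apply: (dynkin_induction (P := fun E => shift_continuous (\1_(E `&` open_cube m)))) => //.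
- exact: measurable_dopen.
- by move=> A B [mA oA] [mB oB]; split; [exact: measurableI|exact: directionally_openI].
- rewrite setTI; apply: shift_continuous_indic_open => //; exact: directionally_open_cube.
- move=> U [mU oU]; apply: shift_continuous_indic_open; first exact: measurableI.
    by apply: directionally_openI => //; exact: directionally_open_cube.
  by apply: le_lt_trans Qoo; apply: le_measure; rewrite ?inE //; exact: measurableI.
- move=> S mS cS.
  have -> : \1_(~` S `&` open_cube m) = (fun x : V => \1_(setT `&` open_cube m) x + (-1) * \1_(S `&` open_cube m) x) :> (V -> R).
    apply/funext => x; rewrite !indicE !in_setI in_setC in_setT; do 2!case: (_ \in _) => /=; lra.
  apply: shift_continuous_lin => //; do ?[exact: mI].
  rewrite setTI; apply: shift_continuous_indic_open => //; exact: directionally_open_cube.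
- move=> F mF tF cF.
  (* By disjointness these partial sums are again indicators, of the finite unions; the convergence
     below is then eventual equality at each point. *)
  pose g (j : nat) (x : V) : R := \sum_(i < j) \1_(F i `&` open_cube m) x.
  have mg j : measurable_fun setT (g j) by apply: measurable_sum => i; exact: mI.
  have mU : measurable (\bigcup_k F k) by exact: bigcup_measurable.
  have gE j x : g j x = \1_((\bigcup_(k in `I_j) F k) `&` open_cube m) x.
    rewrite /g; elim: j => [|j IHj].
      by rewrite big_ord0 indicE in_setI memNset // => -[].
    rewrite big_ord_recr /= IHj !indicE !in_setI.
    rewrite (_ : \bigcup_(k in `I_j.+1) F k = (\bigcup_(k in `I_j) F k) `|` F j); last first.
      apply/seteqP; split=> y.
        move=> [i /=]; rewrite ltnS leq_eqVlt => /predU1P[->|ij] Fy; [by right|by left; exists i].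
      by move=> [[i /= ij] Fy|Fy]; [exists i => //=; exact: ltnW|exists j => /=].
    rewrite in_setU; case: (boolP (x \in F j)) => xj; last by rewrite orbF /= addr0.
    rewrite [X in X && _]memNset ?add0r ?orbT //= => -[i /= ij xi].
    have /trivIsetP/(_ i j Logic.I Logic.I) := tF; rewrite (ltn_eqF ij) => /(_ isT).
    by move=> FF; have : (F i `&` F j) x; [split=> //; rewrite inE in xj|rewrite FF].
  apply: (@shift_continuous_closed _ g) => //; first exact: mI.
    elim=> [|j IHj].
      (* The empty sum is written as u - u, so that the zero function falls under the closure by
         linear combinations. *)
      rewrite (_ : g 0%N = (fun x => \1_(F 0%N `&` open_cube m) x + (-1) * \1_(F 0%N `&` open_cube m) x)).
        apply: shift_continuous_lin => //; exact: mI.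
      by apply/funext => x; rewrite /g big_ord0 mulN1r subrr.
    rewrite (_ : g j.+1 = (fun x => g j x + 1 * \1_(F j `&` open_cube m) x)).
      apply: shift_continuous_lin => //; exact: mI.
    by apply/funext => x; rewrite /g big_ord_recr /= mul1r.
  apply: (dominated_cvg0 (g := \1_(open_cube m) : V -> R)) => //.
  + by move=> j; apply: measurable_funX; apply: measurable_funB => //; exact: mI.
  + exact: integrable_indic_finite.
  + move=> j x _; rewrite sqr_ge0 /= gE !indicE !in_setI; do 3!case: (_ \in _) => /=; lra.
  + move=> x _; apply: cvg_near_cst.
    case: (pselect ((\bigcup_k F k) x)) => [[i _ Fi]|nU]; last first.
      apply: nearW => j; rewrite gE !indicE !in_setI memNset //= memNset ?subr0 ?expr0n //.
      by move=> [i _ Fi]; apply: nU; exists i.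
    near=> j; rewrite gE !indicE !in_setI mem_set; last by exists i.
    have ij : (i < j)%N by near: j; exact: nbhs_infty_gt.
    have -> : (x \in \bigcup_(k in `I_j) F k) = true by apply: mem_set; exists i.
    by rewrite subrr expr0n.
Unshelve. all: by end_near. Qed.


Lemma shift_continuous_sum (I : Type) (s : seq I) (a : I -> R) (E : I -> set V) m :
  (forall i, measurable (E i)) ->
  shift_continuous (fun x => \sum_(i <- s) a i * \1_(E i `&` open_cube m) x).
Proof.
move=> mE; have mI (A : set V) : measurable A -> measurable_fun setT (\1_(A `&` open_cube m) : V -> R).
  by move=> mA; apply: measurable_indic; apply: measurableI => //; exact: measurable_open_cube.
elim: s => [|i s IHs].
  rewrite (_ : (fun x : V => _) = (fun x => \1_(set0 `&` open_cube m) x + (-1) * \1_(set0 `&` open_cube m) x)).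
    apply: shift_continuous_lin => //; do ?[exact: mI]; exact: shift_continuous_indic.
  by apply/funext => x; rewrite big_nil mulN1r subrr.
rewrite (_ : (fun x : V => _) = (fun x => (\sum_(i <- s) a i * \1_(E i `&` open_cube m) x) + a i * \1_(E i `&` open_cube m) x)).
  apply: shift_continuous_lin => //; [|exact: mI|exact: shift_continuous_indic].
  apply: measurable_sum => k; apply: measurable_funM => //; exact: mI.
by apply/funext => x; rewrite big_cons addrC.
Qed.

Lemma near_open_cube (x : V) : \forall m \near \oo, open_cube m x.
Proof.
rewrite /open_cube /=; apply: filter_forall => i.
have := nbhs_infty_gtr `|x i 0|; apply: filterS => m hm.
by rewrite in_itv /= -ltr_norml.
Qed.

Import HBNNSimple.

(** Simple functions increasing to [f] are cut off by cubes growing with the same index. They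
    converge pointwise and stay between 0 and [f], so the squared errors are dominated by f^2. *)
Lemma shift_continuous_ge0 f : measurable_fun setT f -> (forall x, 0 <= f x) ->
  (\int[dx]_x ((f x) ^+ 2)%:E < +oo)%E -> shift_continuous f.
Proof.
move=> mf f0 foo.
have mf' : measurable_fun setT (EFin \o f) by exact/measurable_EFinP.
pose s := nnsfun_approx measurableT mf'.
have f'0 (x : V) : setT x -> (0 <= (EFin \o f) x)%E by rewrite lee_fin.
pose g j x := s j x * \1_(open_cube j) x : R.
have mQ j : measurable_fun setT (\1_(open_cube j) : V -> R).
  by apply: measurable_indic; exact: measurable_open_cube.
have sf j x : s j x <= f x.
  by rewrite -lee_fin /s nnsfun_approxE; exact: (@le_approx _ _ _ _ (EFin \o f)).
have gf j x : 0 <= g j x <= f x.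
  have := sf j x; have : 0 <= s j x by []; rewrite /g indicE.
  by case: (_ \in _) => /=; rewrite ?mulr1 ?mulr0 => h1 h2; rewrite ?lexx ?f0 ?h1 ?h2.
have mg j : measurable_fun setT (g j) by exact: measurable_funM.
apply: (@shift_continuous_closed _ g) => //.
- move=> j; rewrite (_ : g j = (fun x => \sum_(y <- finmap.enum_fset (fset_set (range (s j)))) y * \1_((s j @^-1` [set y]) `&` open_cube j) x)).
    by apply: shift_continuous_sum.
  apply/funext => x; rewrite /g {1}fimfunE fsbig_finite //= mulr_suml; apply: eq_bigr => y _.
  by rewrite -mulrA; congr (_ * _); rewrite !indicE in_setI; do 2!case: (_ \in _); rewrite ?mulr1 ?mulr0.
- apply: (dominated_cvg0 (g := fun x => f x ^+ 2)) => //.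
  + by move=> j; apply: measurable_funX; exact: measurable_funB.
  + exact: integrable_sqr.
  + move=> j x _; rewrite sqr_ge0 /=; have /andP[g0 gl] := gf j x.
    by rewrite ler_sqr ?nnegrE ?subr_ge0 // gerBl.
  + move=> x _; have sc : s j x @[j --> \oo] --> f x.
      have := @cvg_nnsfun_approx _ _ _ _ measurableT _ mf' f'0 x Logic.I.
      by move=> /fine_cvgP[].
    have gc : g j x @[j --> \oo] --> f x.
      apply: cvg_trans sc; apply: near_eq_cvg.
      have := near_open_cube x; apply: filterS => j Qx.
      by rewrite /g indicE mem_set // mulr1.
    have dc : (f x - g j x) @[j --> \oo] --> (0 : R).
      by rewrite -(subrr (f x)); apply: cvgB => //; exact: cvg_cst.
    by rewrite -(mulr0 0); under eq_fun do rewrite expr2; apply: cvgM.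
Qed.

Lemma shift_continuous_L2 f : measurable_fun setT f ->
  (\int[dx]_x ((f x) ^+ 2)%:E < +oo)%E -> shift_continuous f.
Proof.
move=> mf foo.
have sq (h : V -> R) : measurable_fun setT h -> (forall x, h x ^+ 2 <= f x ^+ 2) -> (\int[dx]_x ((h x) ^+ 2)%:E < +oo)%E.
  move=> mh hf; apply: le_lt_trans foo; apply: ge0_le_integral => //.
  - by move=> x _; rewrite lee_fin sqr_ge0.
  - by apply/measurable_EFinP; exact: measurable_funX.
  - by apply/measurable_EFinP; exact: measurable_funX.
  - by move=> x _; rewrite lee_fin.
pose p x := Num.max (f x) 0; pose q x := Num.max (- f x) 0.
have mp : measurable_fun setT p by exact: measurable_maxr.
have mq : measurable_fun setT q by apply: measurable_maxr => //; exact: measurableT_comp.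
rewrite (_ : f = (fun x => p x + (-1) * q x)).
  apply: shift_continuous_lin => //; apply: shift_continuous_ge0 => //.
  - by move=> x; rewrite le_max lexx orbT.
  - apply: sq => // x; rewrite /p; case: (leP (f x) 0) => _ //; by rewrite expr0n sqr_ge0.
  - by move=> x; rewrite le_max lexx orbT.
  - apply: sq => // x; rewrite /q; case: (leP (- f x) 0) => _ //; by rewrite ?sqrrN // expr0n sqr_ge0.
apply/funext => x; rewrite /p /q; case: (leP (f x) 0); case: (leP (- f x) 0); lra.
Qed.
End TranslationContinuity.

(** * Fubini's theorem for real-valued integrals *)

Section RealFubini.
Context d1 d2 (T1 : measurableType d1) (T2 : measurableType d2) (R : realType).
Variables (m1 : {sigma_finite_measure set T1 -> \bar R}) (m2 : {sigma_finite_measure set T2 -> \bar R}).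
Implicit Types f : T1 -> T2 -> R.

Let uncurried f := fun p : T1 * T2 => (f p.1 p.2)%:E.

(** The real integral is [fine] of the difference of the integrals of the positive and negative
    parts, and each of these is measurable by Tonelli. *)
Lemma measurable_Rintegral2 f : measurable_fun setT (fun p : T1 * T2 => f p.1 p.2) ->
  measurable_fun setT (fun x => \int[m2]_y f x y).
Proof.
move=> mf; have mF : measurable_fun setT (uncurried f) by exact/measurable_EFinP.
rewrite (_ : (fun x => _) = fine \o (fun x => \int[m2]_y (uncurried f)^\+%E (x, y) - \int[m2]_y (uncurried f)^\-%E (x, y))%E).
  apply: measurableT_comp => //; apply: emeasurable_funB.
    apply: (measurable_fun_fubini_tonelli_F (uncurried f)^\+%E) => //; exact: measurable_funepos.
  apply: (measurable_fun_fubini_tonelli_F (uncurried f)^\-%E) => //; exact: measurable_funeneg.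
apply/funext => x; rewrite /Rintegral /= integralE.
by congr (fine (_ - _)); apply: eq_integral => y _; rewrite ?funeposE ?funenegE.
Qed.

Lemma integrable_prod12 f : measurable_fun setT (fun p : T1 * T2 => f p.1 p.2) ->
  (\int[m1]_x \int[m2]_y `|f x y|%:E < +oo)%E ->
  (m1 \x m2)%E.-integrable setT (fun p => (f p.1 p.2)%:E).
Proof.
by move=> mf foo; apply/integrable12ltyP; [exact/measurable_EFinP|].
Qed.

Lemma integrable_prod21 f : measurable_fun setT (fun p : T1 * T2 => f p.1 p.2) ->
  (\int[m2]_y \int[m1]_x `|f x y|%:E < +oo)%E ->
  (m1 \x m2)%E.-integrable setT (fun p => (f p.1 p.2)%:E).
Proof.
by move=> mf foo; apply/integrable21ltyP; [exact/measurable_EFinP|].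
Qed.

Section Integrable.
Variable f : T1 -> T2 -> R.
Hypothesis fi : (m1 \x m2)%E.-integrable setT (fun p => (f p.1 p.2)%:E).

Let mf : measurable_fun setT (fun p : T1 * T2 => f p.1 p.2).
Proof. by apply/measurable_EFinP; have /integrableP[] := fi. Qed.

(** [fine] sends infinite values to 0, so the real and the extended inner integrals are compared
    only at the points where the section is integrable. *)
Let ae1 : {ae m1, forall x, setT x -> (\int[m2]_y f x y)%:E = fubini_F m2 (uncurried f) x}.
Proof.
have := ae_integrable1 fi; apply: filterS => x ix _.
by rewrite /Rintegral fineK //; exact: integrable_fin_num.
Qed.

Let ae2 : {ae m2, forall y, setT y -> (\int[m1]_x f x y)%:E = fubini_G m1 (uncurried f) y}.
Proof.
have := ae_integrable2 fi; apply: filterS => x ix _.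
by rewrite /Rintegral fineK //; exact: integrable_fin_num.
Qed.

Lemma integrable_Rintegral2 : m1.-integrable setT (fun x => (\int[m2]_y f x y)%:E).
Proof.
have /integrableP[mF Foo] := integrable_fubini_F fi.
have mI : measurable_fun setT (fun x => (\int[m2]_y f x y)%:E).
  by apply/measurable_EFinP; exact: measurable_Rintegral2.
apply/integrableP; split=> //; apply: le_lt_trans Foo.
rewrite le_eqVlt; apply/orP; left; apply/eqP; apply: ae_eq_integral => //.
- exact: measurableT_comp.
- exact: measurableT_comp.
- by have := ae1; apply: filterS => x h Tx; rewrite h.
Qed.

Lemma Rintegral_prod12 : \int[m1]_x \int[m2]_y f x y = \int[(m1 \x m2)%E]_p f p.1 p.2.
Proof.
rewrite /Rintegral -integral12_prod_meas1 //; congr fine; apply: ae_eq_integral => //.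
- by apply/measurable_EFinP; exact: measurable_Rintegral2.
- by have /integrableP[] := integrable_fubini_F fi.
Qed.

Lemma Rintegral_prod21 : \int[m2]_y \int[m1]_x f x y = \int[(m1 \x m2)%E]_p f p.1 p.2.
Proof.
rewrite /Rintegral -integral21_prod_meas1 //; congr fine.
have mG := measurable_fubini_G fi.
apply: ae_eq_integral => //.
rewrite (_ : (fun x => _) = (fun y => (fine (fubini_G m1 (uncurried f) y))%:E)) //.
by apply/measurable_EFinP; exact: measurableT_comp.
Qed.

Lemma Rintegral_swap : \int[m1]_x \int[m2]_y f x y = \int[m2]_y \int[m1]_x f x y.
Proof. by rewrite Rintegral_prod12 Rintegral_prod21. Qed.

End Integrable.

Lemma integrable_mul_prod (g : T1 -> R) (h : T2 -> R) :
  m1.-integrable setT (EFin \o g) -> m2.-integrable setT (EFin \o h) ->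
  (m1 \x m2)%E.-integrable setT (fun p => (g p.1 * h p.2)%:E).
Proof.
move=> /integrableP[/measurable_EFinP mg goo] /integrableP[/measurable_EFinP mh hoo].
apply: (integrable_prod12 (f := fun x y => g x * h y)).
  by apply: measurable_funM; apply: measurableT_comp.
under eq_integral => x _.
  under eq_integral => y _ do rewrite normrM EFinM.
  rewrite ge0_integralZl_EFin //; last by apply/measurable_EFinP; exact: measurableT_comp.
  over.
rewrite /= ge0_integralZr //.
- apply: lte_mul_pinfty => //; first exact: integral_ge0.
  by rewrite ge0_fin_numE //; exact: integral_ge0.
- by apply/measurable_EFinP; exact: measurableT_comp.
- exact: integral_ge0.
Qed.

Lemma Rintegral_mul_prod (g : T1 -> R) (h : T2 -> R) :
  m1.-integrable setT (EFin \o g) -> m2.-integrable setT (EFin \o h) ->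
  \int[(m1 \x m2)%E]_p (g p.1 * h p.2) = (\int[m1]_x g x) * (\int[m2]_y h y).
Proof.
move=> gi hi; rewrite -(Rintegral_prod12 (f := fun x y => g x * h y)); last exact: integrable_mul_prod.
rewrite -RintegralZr //; apply: eq_Rintegral => x _; by rewrite RintegralZl.
Qed.

End RealFubini.

Section LebesgueCvS.
Variables (R : realType) (n : nat).

(* Same as [measurable_cons_cv], for the copy of [R] that carries [lebesgue_measure]. *)
Lemma measurable_cons_cvR :
  measurable_fun [set: (measurableTypeR R * 'cV[R]_n)%type] (@cons_cv R n).
Proof. exact: measurable_cons_cv. Qed.

Lemma Rintegral_lebesgue_cvS (F : 'cV[R]_n.+1 -> R) : measurable_fun setT F ->
  (lebesgue_measure \x lebesgue_cv n)%E.-integrable setT (fun p => (F (cons_cv p))%:E) ->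
  \int[lebesgue_cv n.+1]_x F x = \int[(lebesgue_measure \x lebesgue_cv n)%E]_p F (cons_cv p).
Proof.
move=> mF iF; have mc := measurable_cons_cvR.
have mEF : measurable_fun setT (EFin \o F) by exact/measurable_EFinP.
rewrite /Rintegral (eq_measure_integral (measure_function_pushforward__canonical__measure_function_Measure (lebesgue_measure \x lebesgue_cv n)%E mc)) //.
have iF' : (lebesgue_measure \x lebesgue_cv n)%E.-integrable (@cons_cv R n @^-1` setT) ((EFin \o F) \o @cons_cv R n) by rewrite preimage_setT.
have := integral_pushforward mc mEF iF' measurableT.
by rewrite preimage_setT => E; congr fine; exact: E.
Qed.

End LebesgueCvS.

(** * Abel and Poisson kernels *)

Section AbelKernel1.
Variable R : realType.
Implicit Types e t w : R.
Local Notation RT := (measurableTypeR R).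

Definition abel1 e w : R := expR (- (e * `|w|)).
(** The Fourier transform of [abel1 e], left unnormalized: its mass 2 pi is the origin of the factor
    (2 pi)^n in Plancherel. *)
Definition poisson1 e t : R := 2 * e / (e ^+ 2 + t ^+ 2).

Lemma abel1_gt0 e w : 0 < abel1 e w. Proof. exact: expR_gt0. Qed.

Lemma poisson1_ge0 e t : 0 <= e -> 0 <= poisson1 e t.
Proof. by move=> e0; rewrite divr_ge0 ?mulr_ge0 // addr_ge0 ?sqr_ge0. Qed.

Lemma continuous_abel1 e : continuous (abel1 e).
Proof.
move=> w; apply: (@continuous_comp _ _ _ (fun w => - (e * `|w|)) expR); last exact: continuous_expR.
by apply: cvgN; apply: cvgM; [exact: cvg_cst|exact: norm_continuous].
Qed.

Lemma continuous_cos_scale t : continuous (fun w : R => cos (t * w)).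
Proof.
move=> w; apply: (@continuous_comp _ _ _ (fun w => t * w) cos); last exact: continuous_cos.
by apply: cvgM; [exact: cvg_cst|exact: cvg_id].
Qed.

Lemma continuous_poisson1 e : 0 < e -> continuous (poisson1 e).
Proof.
move=> e0 t; apply: cvgM; first exact: cvg_cst.
apply: cvgV; first by rewrite gt_eqF // ltr_wpDr ?sqr_ge0 // exprn_gt0.
by apply: cvgD; [exact: cvg_cst|exact: exprn_continuous].
Qed.

Lemma integral_even_FTC (f F : R -> R) (l : R) : (forall x, 0 <= f x) -> continuous f ->
  f =1 f \o -%R -> F x @[x --> +oo] --> l -> (forall x : R, 0 < x -> derivable F x 1 /\ 'D_1 F x = f x) ->
  F x @[x --> 0^'+] --> F 0 ->
  (\int[lebesgue_measure]_x (f x)%:E = (2 * (l - F 0))%:E)%E.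
Proof.
move=> f0 cf ev Fl dF F0; rewrite ge0_symfun_integralT //.
rewrite (_ : [set x | 0 <= x] = `[0, +oo[%classic); last first.
  by apply/seteqP; split=> x /=; rewrite in_itv /= andbT.
rewrite (@ge0_continuous_FTC2y R f F 0 l) //.
- by apply: continuous_subspaceT => x; exact: cf.
- by move=> x x0; have [] := dF x x0.
- move=> x; rewrite in_itv /= andbT => x0; by rewrite derive1E; have [] := dF x x0.
Qed.

Lemma integral_poisson1 : (\int[lebesgue_measure]_t (poisson1 1 t)%:E = (2 * pi)%:E :> \bar R)%E.
Proof.
rewrite (@integral_even_FTC (poisson1 1) (fun t => 2 * atan t) pi).
- by rewrite atan0 mulr0 subr0.
- by move=> t; exact: poisson1_ge0.
- exact: continuous_poisson1.
- by move=> t; rewrite /poisson1 /= sqrrN.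
- rewrite (_ : pi = 2 * (pi / 2)); last by rewrite mulrCA divff ?mulr1.
  by apply: cvgM; [exact: cvg_cst|exact: cvgy_atan].
- move=> t _; rewrite /poisson1 expr1n mulr1.
  have h := is_deriveZ 2 (is_derive1_atan t).
  split; first exact: ex_derive.
  exact: derive_val.
- apply: cvgM; first exact: cvg_cst.
  apply: cvg_at_right_filter; exact: continuous_atan.
Qed.

Lemma cvgy_abel e : 0 < e -> expR (- (e * w)) @[w --> +oo] --> (0 : R).
Proof.
move=> e0.
apply: (@cvg_comp _ _ _ (fun w => e * w) (fun u => expR (- u)) _ +oo); last exact: cvgr_expR.
by apply: gt0_cvgMry.
Qed.

(** Adding 1 to the cosine makes the integrand nonnegative, as the fundamental theorem on a
    half-line requires here. The case t = 0 gives the integral of the kernel alone, and subtracting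
    it leaves the cosine integral. *)
Lemma integral_abel1_1cos e t : 0 < e ->
  (\int[lebesgue_measure]_w (abel1 e w * (1 + cos (t * w)))%:E = (2 / e + poisson1 e t)%:E)%E.
Proof.
move=> e0; set D := e ^+ 2 + t ^+ 2.
have D0 : 0 < D by rewrite ltr_wpDr ?sqr_ge0 // exprn_gt0.
(* An antiderivative for w > 0, where the absolute value disappears; the bracket with [D] comes from
   the real part of exp ((- e + i t) w) / (- e + i t). *)
pose F (w : R) := expR (- (e * w)) * (- e^-1 + D^-1 * (t * sin (t * w) - e * cos (t * w))).
have F0 : F 0 = - e^-1 - e / D.
  rewrite /F !mulr0 oppr0 expR0 sin0 cos0; field; by rewrite !gt_eqF.
have dF (w : R) : is_derive w 1 F (expR (- (e * w)) * (1 + cos (t * w))).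
  have dl c : is_derive w 1 (fun w : R => c * w) c.
    apply: (is_derive_eq (is_deriveZ c (is_derive_id w (1 : R)))); exact: mulr1.
  have dE : is_derive w 1 (fun w => expR (- (e * w))) (expR (- (e * w)) * - e).
    exact: (is_derive1_comp (f := expR) (g := fun w => - (e * w)) (is_derive_expR _) (is_deriveN (dl e))).
  have dS : is_derive w 1 (fun w => sin (t * w)) (cos (t * w) * t).
    exact: (is_derive1_comp (f := sin) (g := fun w => t * w) (is_derive_sin _) (dl t)).
  have dC : is_derive w 1 (fun w => cos (t * w)) (- sin (t * w) * t).
    exact: (is_derive1_comp (f := cos) (g := fun w => t * w) (is_derive_cos _) (dl t)).
  have dG := is_deriveD (is_derive_cst (- e^-1 : R) w (1 : R)) (is_deriveZ D^-1 (is_deriveB (is_deriveZ t dS) (is_deriveZ e dC))).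
  apply: (is_derive_eq (is_deriveM dE dG)).
  change (expR (- (e * w)) * (0 + D^-1 * (t * (cos (t * w) * t) - e * (- sin (t * w) * t))) +
    (- e^-1 + D^-1 * (t * sin (t * w) - e * cos (t * w))) * (expR (- (e * w)) * - e) = expR (- (e * w)) * (1 + cos (t * w))).
  move: (expR _) (cos _) (sin _) => u v y.
  rewrite /D in D0 *; field; by rewrite !gt_eqF.
rewrite (@integral_even_FTC (fun w => abel1 e w * (1 + cos (t * w))) F 0).
- rewrite F0 /poisson1 -/D; congr EFin; field; by rewrite !gt_eqF.
- move=> w; apply: mulr_ge0; [exact/ltW/abel1_gt0|have := cos_geN1 (t * w); lra].
- move=> w; apply: cvgM; first exact: continuous_abel1.
  by apply: cvgD; [exact: cvg_cst|exact: continuous_cos_scale].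
- by move=> w; rewrite /= /abel1 normrN mulrN cosN.
- pose B := e^-1 + D^-1 * (`|t| + e).
  have FB w : `|F w| <= expR (- (e * w)) * B.
    rewrite /F normrM ger0_norm ?expR_ge0 // ler_wpM2l ?expR_ge0 //.
    apply: (le_trans (ler_normD _ _)); rewrite normrN gtr0_norm ?invr_gt0 // lerD2l normrM gtr0_norm ?invr_gt0 //.
    apply: ler_wpM2l; first by rewrite invr_ge0 ltW.
    apply: (le_trans (ler_normB _ _)); rewrite !normrM (gtr0_norm e0) lerD //.
      by rewrite ler_piMr // ler_norml sin_geN1 sin_le1.
    by rewrite ler_piMr // ?ler_norml ?cos_geN1 ?cos_le1 // ltW.
  have Bc : expR (- (e * w)) * B @[w --> +oo] --> (0 : R).
    by rewrite -(mul0r B); apply: cvgM; [exact: cvgy_abel|exact: cvg_cst].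
  apply: (@squeeze_cvgr _ _ _ _ (fun w => - (expR (- (e * w)) * B)) (fun w => expR (- (e * w)) * B)) => //.
    by apply: nearW => w; rewrite -ler_norml.
  by rewrite -oppr0; exact: cvgN.
- move=> w w0; have h := dF w; rewrite /abel1 gtr0_norm //.
  split; [exact: ex_derive|exact: derive_val].
- apply: cvg_at_right_filter; apply: differentiable_continuous; apply/derivable1_diffP.
  by have [] := dF 0.
Qed.


Lemma integral_abel1 e : 0 < e -> (\int[lebesgue_measure]_w (abel1 e w)%:E = (2 / e)%:E :> \bar R)%E.
Proof.
move=> e0; have := integral_abel1_1cos 0 e0.
under eq_integral do rewrite mul0r cos0 (_ : 1 + 1 = 2 :> R) // mulrC EFinM.
rewrite ge0_integralZl_EFin //; last 2 first.
- by move=> w _; rewrite lee_fin ltW // abel1_gt0.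
- by apply/measurable_EFinP; apply: continuous_measurable_fun; exact: continuous_abel1.
move=> /(congr1 (mule 2^-1%:E)); rewrite muleA -!EFinM mulVf // mul1e => ->; congr EFin.
by rewrite /poisson1 expr0n addr0; field; rewrite gt_eqF.
Qed.

Lemma measurable_abel1 e : measurable_fun [set: RT] (abel1 e : RT -> RT).
Proof. by apply: continuous_measurable_fun; exact: continuous_abel1. Qed.

Lemma integrable_abel1 e : 0 < e ->
  (@lebesgue_measure R).-integrable setT (EFin \o (abel1 e : RT -> R)).
Proof.
move=> e0; apply/integrableP; split; first by apply/measurable_EFinP; exact: measurable_abel1.
under eq_integral do rewrite /= ger0_norm ?ltW ?abel1_gt0 //.
by rewrite integral_abel1 // ltry.
Qed.

Lemma le_normr_integrable d (T : measurableType d) (mu : {measure set T -> \bar R}) (g f : T -> R) :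
  measurable_fun setT f -> mu.-integrable setT (EFin \o g) -> (forall x, `|f x| <= `|g x|) ->
  mu.-integrable setT (EFin \o f).
Proof.
move=> mf ig fg; apply: (le_integrable measurableT _ _ ig); first exact/measurable_EFinP.
by move=> x _ /=; rewrite lee_fin.
Qed.

Lemma integrable_abel1_trig (h : R -> R) e t : continuous h -> (forall x, `|h x| <= 1) -> 0 < e ->
  (@lebesgue_measure R).-integrable setT (fun w : RT => (abel1 e w * h (t * w))%:E).
Proof.
move=> ch h1 e0; apply: (le_normr_integrable (g := abel1 e : RT -> R)); last 2 first.
- exact: integrable_abel1.
- by move=> x; rewrite normrM ler_piMr.
apply: measurable_funM; first exact: measurable_abel1.
apply: continuous_measurable_fun => w; apply: (@continuous_comp _ _ _ (fun w => t * w) h); last exact: ch.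
by apply: cvgM; [exact: cvg_cst|exact: cvg_id].
Qed.

Lemma Rintegral_abel1_cos e t : 0 < e ->
  \int[lebesgue_measure]_(w in [set: RT]) (abel1 e w * cos (t * w)) = poisson1 e t.
Proof.
move=> e0; have ic := integrable_abel1_trig t (@continuous_cos R) (fun x => _) e0.
have := integral_abel1_1cos t e0.
under eq_integral do rewrite mulrDr mulr1 EFinD.
rewrite integralD //; last 2 first.
- exact: integrable_abel1.
- by apply: ic => x; rewrite ler_norml cos_geN1 cos_le1.
rewrite integral_abel1 // => /(congr1 fine); rewrite /Rintegral fineD //.
  by rewrite EFinD /= => /addrI.
apply: integrable_fin_num => //.
by apply: ic => x; rewrite ler_norml cos_geN1 cos_le1.
Qed.

Lemma Rintegral_abel1_sin e t : 0 < e ->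
  \int[lebesgue_measure]_(w in [set: RT]) (abel1 e w * sin (t * w)) = 0.
Proof.
move=> e0.
have is' := integrable_abel1_trig t (@continuous_sin R) (fun x => _) e0.
have s1 (x : R) : `|sin x| <= 1 by rewrite ler_norml sin_geN1 sin_le1.
have N1 : -1 != 0 :> R by rewrite oppr_eq0 oner_eq0.
(* The integrand is odd: reflection shows that the integral equals its own opposite. *)
have := scales_Rintegral (scales_affine1 0 N1) (is' s1).
rewrite normrN1 invr1 mul1r.
under eq_Rintegral do rewrite addr0 mulN1r /abel1 normrN mulrN sinN mulrN -/(abel1 _ _) -mulN1r.
rewrite RintegralZl //; last exact: is'.
by move: (\int[_]_(_ in _) _) => I; lra.
Qed.
End AbelKernel1.

Section AbelKernel.
Variable R : realType.
Local Notation RT := (measurableTypeR R).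
Local Notation dx n := (lebesgue_cv (R := R) n).

Definition abel n (e : R) (w : 'cV[R]_n) : R := \prod_i abel1 e (w i 0).
Definition poisson n (e : R) (z : 'cV[R]_n) : R := \prod_i poisson1 e (z i 0).

Lemma abel_ge0 n e (w : 'cV[R]_n) : 0 <= abel e w.
Proof. by apply: prodr_ge0 => i _; exact/ltW/abel1_gt0. Qed.

Lemma poisson_ge0 n e (w : 'cV[R]_n) : 0 <= e -> 0 <= poisson e w.
Proof. by move=> e0; apply: prodr_ge0 => i _; exact: poisson1_ge0. Qed.

Lemma abel_cons n e (p : R * 'cV[R]_n) : abel e (cons_cv p) = abel1 e p.1 * abel e p.2.
Proof.
rewrite /abel big_ord_recl cons_cv0; congr (_ * _).
by apply: eq_bigr => i _; rewrite cons_cvS.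
Qed.

Lemma poisson_cons n e (p : R * 'cV[R]_n) : poisson e (cons_cv p) = poisson1 e p.1 * poisson e p.2.
Proof.
rewrite /poisson big_ord_recl cons_cv0; congr (_ * _).
by apply: eq_bigr => i _; rewrite cons_cvS.
Qed.

Lemma dot_cons n (p : R * 'cV[R]_n) z :
  dot (cons_cv p) z = z ord0 0 * p.1 + dot p.2 (uncons_cv z).2.
Proof.
rewrite /dot big_ord_recl cons_cv0 mulrC; congr (_ + _).
by apply: eq_bigr => i _; rewrite cons_cvS mxE.
Qed.

Lemma measurable_abel n e : measurable_fun setT (@abel n e).
Proof.
apply: measurable_prod => i _.
exact: (measurableT_comp (@measurable_abel1 R e) (measurable_coord i 0)).
Qed.

Lemma measurable_poisson n e : 0 < e -> measurable_fun setT (@poisson n e).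
Proof.
move=> e0; apply: measurable_prod => i _.
have m : measurable_fun [set: RT] (poisson1 e : RT -> RT).
  by apply: continuous_measurable_fun; exact: continuous_poisson1.
exact: (measurableT_comp m (measurable_coord i 0)).
Qed.

Lemma lebesgue_cv0T : dx 0 setT = 1%E.
Proof.
rewrite (_ : setT = box (0 : 'cV[R]_0) 0); last by apply/seteqP; split=> // x _ [].
by rewrite lebesgue_cv_box ?big_ord0 // => -[].
Qed.

Lemma integral_lebesgue_cv0 (F : 'cV[R]_0 -> \bar R) : (\int[dx 0]_x F x = F 0%R)%E.
Proof.
rewrite (eq_integral (cst (F 0))); last by move=> x _; congr F; apply/matrixP => -[].
by rewrite integral_cst // -[X in (_ * X)%E]/(dx 0 setT) lebesgue_cv0T mule1.
Qed.

Lemma integral_abel n e : 0 < e -> (\int[dx n]_w (abel e w)%:E = ((2 / e) ^+ n)%:E)%E.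
Proof.
move=> e0; elim: n => [|n IHn]; first by rewrite integral_lebesgue_cv0 /abel big_ord0 expr0.
have mE : measurable_fun setT (EFin \o @abel n e) by apply/measurable_EFinP; exact: measurable_abel.
rewrite integral_lebesgue_cvS //; last 2 first.
- by apply/measurable_EFinP; exact: measurable_abel.
- by move=> x; rewrite lee_fin abel_ge0.
under eq_integral => t _.
  under eq_integral => x _ do rewrite abel_cons EFinM /=.
  rewrite ge0_integralZl_EFin //; [|by move=> x _; rewrite lee_fin abel_ge0|exact/ltW/abel1_gt0].
  rewrite IHn; over.
rewrite /= ge0_integralZr //; last 3 first.
- by apply/measurable_EFinP; exact: measurable_abel1.
- by move=> t _; rewrite lee_fin ltW // abel1_gt0.
- by rewrite lee_fin exprn_ge0 // divr_ge0 // ltW.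
by rewrite integral_abel1 // -EFinM exprS.
Qed.

Lemma integral_poisson n : (\int[dx n]_z (poisson 1 z)%:E = ((2 * pi) ^+ n)%:E)%E.
Proof.
elim: n => [|n IHn]; first by rewrite integral_lebesgue_cv0 /poisson big_ord0 expr0.
have mE : measurable_fun setT (EFin \o @poisson n 1) by apply/measurable_EFinP; exact: measurable_poisson.
rewrite integral_lebesgue_cvS //; last 2 first.
- by apply/measurable_EFinP; exact: measurable_poisson.
- by move=> x; rewrite lee_fin poisson_ge0.
under eq_integral => t _.
  under eq_integral => x _ do rewrite poisson_cons EFinM /=.
  rewrite ge0_integralZl_EFin //; [|by move=> x _; rewrite lee_fin poisson_ge0|exact: poisson1_ge0].
  rewrite IHn; over.
rewrite /= ge0_integralZr //; last 3 first.
- apply/measurable_EFinP; apply: (continuous_measurable_fun (f := poisson1 1)); exact: continuous_poisson1.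
- by move=> t _; rewrite lee_fin poisson1_ge0.
- by rewrite lee_fin exprn_ge0 // mulr_ge0 // pi_ge0.
by rewrite integral_poisson1 // -EFinM exprS.
Qed.

Lemma integrable_abel n e : 0 < e -> (dx n).-integrable setT (EFin \o @abel n e).
Proof.
move=> e0; apply/integrableP; split; first by apply/measurable_EFinP; exact: measurable_abel.
under eq_integral do rewrite /= ger0_norm ?abel_ge0 //.
by rewrite integral_abel // ltry.
Qed.

Lemma measurable_dotr n (z : 'cV[R]_n) : measurable_fun setT (fun w => dot w z).
Proof. exact: (measurableT_comp (@measurable_dot R n) (pair2_measurable z)). Qed.

Lemma measurable_cosR : measurable_fun [set: RT] (cos : RT -> RT).
Proof. by apply: continuous_measurable_fun; exact: continuous_cos. Qed.

Lemma measurable_sinR : measurable_fun [set: RT] (sin : RT -> RT).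
Proof. by apply: continuous_measurable_fun; exact: continuous_sin. Qed.

Lemma norm_cos_le1 (x : R) : `|cos x| <= 1.
Proof. by rewrite ler_norml cos_geN1 cos_le1. Qed.

Lemma norm_sin_le1 (x : R) : `|sin x| <= 1.
Proof. by rewrite ler_norml sin_geN1 sin_le1. Qed.

Lemma integrable_abel_cos n e (z : 'cV[R]_n) : 0 < e ->
  (dx n).-integrable setT (fun w => (abel e w * cos (dot w z))%:E).
Proof.
move=> e0; apply: (le_normr_integrable (g := @abel n e)); last 2 first.
- exact: integrable_abel.
- by move=> x; rewrite normrM ler_piMr // norm_cos_le1.
apply: measurable_funM; first exact: measurable_abel.
exact: (measurableT_comp measurable_cosR (measurable_dotr z)).
Qed.

Lemma integrable_abel_sin n e (z : 'cV[R]_n) : 0 < e ->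
  (dx n).-integrable setT (fun w => (abel e w * sin (dot w z))%:E).
Proof.
move=> e0; apply: (le_normr_integrable (g := @abel n e)); last 2 first.
- exact: integrable_abel.
- by move=> x; rewrite normrM ler_piMr // norm_sin_le1.
apply: measurable_funM; first exact: measurable_abel.
exact: (measurableT_comp measurable_sinR (measurable_dotr z)).
Qed.

(** The two integrals are treated together because the addition formulas for one more coordinate mix
    cosines and sines; every term with a sine factor vanishes. *)
Lemma Rintegral_abel_trig n e (z : 'cV[R]_n) : 0 < e ->
  \int[dx n]_w (abel e w * cos (dot w z)) = poisson e z /\
  \int[dx n]_w (abel e w * sin (dot w z)) = 0.
Proof.
move=> e0; elim: n z => [|n IHn] z.
  rewrite /Rintegral !integral_lebesgue_cv0 /= /abel /poisson /dot !big_ord0 cos0 sin0.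
  by rewrite mulr1 mulr0.
set z' := (uncons_cv z).2; set t := z ord0 0.
have [IHc IHs] := IHn z'.
have ic1 := integrable_abel1_trig t (@continuous_cos R) norm_cos_le1 e0.
have is1 := integrable_abel1_trig t (@continuous_sin R) norm_sin_le1 e0.
have icn := integrable_abel_cos z' e0; have isn := integrable_abel_sin z' e0.
have Ec p : abel e (cons_cv p) * cos (dot (cons_cv p) z) =
   (abel1 e p.1 * cos (t * p.1)) * (abel e p.2 * cos (dot p.2 z')) -
   (abel1 e p.1 * sin (t * p.1)) * (abel e p.2 * sin (dot p.2 z')).
  by rewrite abel_cons dot_cons cosD; ring.
have Es p : abel e (cons_cv p) * sin (dot (cons_cv p) z) =
   (abel1 e p.1 * sin (t * p.1)) * (abel e p.2 * cos (dot p.2 z')) +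
   (abel1 e p.1 * cos (t * p.1)) * (abel e p.2 * sin (dot p.2 z')).
  by rewrite abel_cons dot_cons sinD; ring.
have cc := integrable_mul_prod ic1 icn; have ss := integrable_mul_prod is1 isn.
have sc := integrable_mul_prod is1 icn; have cs := integrable_mul_prod ic1 isn.
have /integrableP[/measurable_EFinP mc _] := integrable_abel_cos z e0.
have /integrableP[/measurable_EFinP ms _] := integrable_abel_sin z e0.
split.
- rewrite Rintegral_lebesgue_cvS //; last first.
    under eq_fun do rewrite Ec EFinB; exact: integrableB.
  under eq_Rintegral do rewrite Ec.
  rewrite RintegralB //; transitivity (poisson1 e t * poisson e z' - 0 * 0).
    congr (_ - _); [rewrite -IHc -(Rintegral_abel1_cos t e0)|rewrite -{1}(Rintegral_abel1_sin t e0) -IHs].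
      exact: (Rintegral_mul_prod ic1 icn).
    exact: (Rintegral_mul_prod is1 isn).
  by rewrite mul0r subr0 -[in RHS](uncons_cvK z) poisson_cons.
- rewrite Rintegral_lebesgue_cvS //; last first.
    under eq_fun do rewrite Es EFinD; exact: integrableD.
  under eq_Rintegral do rewrite Es.
  rewrite RintegralD //; transitivity (0 * poisson e z' + poisson1 e t * 0).
    congr (_ + _); [rewrite -IHc -(Rintegral_abel1_sin t e0)|rewrite -IHs -(Rintegral_abel1_cos t e0)].
      exact: (Rintegral_mul_prod is1 icn).
    exact: (Rintegral_mul_prod ic1 isn).
  by rewrite mul0r mulr0 addr0.
Qed.
End AbelKernel.

(** * Products of sigma-finite measures and combinations of integrable functions *)

Section SigmaFiniteProduct.
Context d1 d2 (T1 : measurableType d1) (T2 : measurableType d2) (R : realType).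
Variables (m1 : {sigma_finite_measure set T1 -> \bar R}) (m2 : {sigma_finite_measure set T2 -> \bar R}).

Lemma sigma_finite_product : sigma_finite setT (m1 \x m2)%E.
Proof.
have /sigma_finiteP[F [TF ndF Foo]] := sigma_finiteT m1.
have /sigma_finiteP[G [TG ndG Goo]] := sigma_finiteT m2.
exists (fun k => F k `*` G k) => [|k].
  rewrite -setXTT TF TG predeqE => -[x y]; split; last by move=> [k _ []/= ? ?]; split; exists k.
  move=> [/= [k _ Fk] [l _ Gl]]; exists (maxn k l) => //; split.
    by move: x Fk; exact/subsetPset/ndF/leq_maxl.
  by move: y Gl; exact/subsetPset/ndG/leq_maxr.
have [[mF Fk] [mG Gk]] := (Foo k, Goo k); split; first exact: measurableX.
by rewrite product_measure1E // lte_mul_pinfty // ge0_fin_numE.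
Qed.

(* The library only declares [m1 \x m2] sigma-finite when [m1] and [m2] are subprobabilities. *)
Definition sigma_finite_prod : {sigma_finite_measure set (T1 * T2)%type -> \bar R} :=
  HB.pack_for {sigma_finite_measure set (T1 * T2)%type -> \bar R} (product_measure1 m1 m2)
    (Measure_isSigmaFinite.Build _ _ _ (m1 \x m2)%E sigma_finite_product).

End SigmaFiniteProduct.
Arguments sigma_finite_prod {d1 d2 T1 T2 R} m1 m2.

Section RealIntegrable.
Context d (T : measurableType d) (R : realType) (mu : {measure set T -> \bar R}).
Variables (D : set T) (mD : measurable D).
Implicit Types f g : T -> R.

Lemma integrable_addR f g : mu.-integrable D (EFin \o f) -> mu.-integrable D (EFin \o g) ->
  mu.-integrable D (fun x => (f x + g x)%:E).
Proof. by move=> fi gi; have := integrableD mD fi gi. Qed.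

Lemma integrable_subR f g : mu.-integrable D (EFin \o f) -> mu.-integrable D (EFin \o g) ->
  mu.-integrable D (fun x => (f x - g x)%:E).
Proof. by move=> fi gi; have := integrableB mD fi gi. Qed.

Lemma integrable_scaleR (c : R) f : mu.-integrable D (EFin \o f) ->
  mu.-integrable D (fun x => (c * f x)%:E).
Proof. by move=> fi; have := integrableZl mD c fi. Qed.

End RealIntegrable.

(** * Plancherel for real-valued functions *)

Section ScalarPlancherel.
Variables (R : realType) (n : nat).
Local Notation V := 'cV[R]_n.
Local Notation dx := (lebesgue_cv (R := R) n).
Implicit Types (f : V -> R) (w x y z u : V).

Definition cos_transform f w : R := \int[dx]_x (f x * cos (dot w x)).
Definition sin_transform f w : R := \int[dx]_x (f x * sin (dot w x)).

Lemma measurable_dotl w : measurable_fun setT (fun x : V => dot w x).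
Proof. exact: (measurableT_comp (@measurable_dot R n) (pair1_measurable w)). Qed.

Lemma integrable_cos f w : dx.-integrable setT (EFin \o f) ->
  dx.-integrable setT (fun x => (f x * cos (dot w x))%:E).
Proof.
move=> fi; have /integrableP[/measurable_EFinP mf _] := fi.
apply: (le_normr_integrable (g := f)) => //; last first.
  by move=> x; rewrite normrM ler_piMr // norm_cos_le1.
apply: measurable_funM => //; exact: (measurableT_comp (@measurable_cosR R) (measurable_dotl w)).
Qed.

Lemma integrable_sin f w : dx.-integrable setT (EFin \o f) ->
  dx.-integrable setT (fun x => (f x * sin (dot w x))%:E).
Proof.
move=> fi; have /integrableP[/measurable_EFinP mf _] := fi.
apply: (le_normr_integrable (g := f)) => //; last first.
  by move=> x; rewrite normrM ler_piMr // norm_sin_le1.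
apply: measurable_funM => //; exact: (measurableT_comp (@measurable_sinR R) (measurable_dotl w)).
Qed.

Lemma dotBr w x y : dot w (x - y) = dot w x - dot w y.
Proof. by rewrite /dot -sumrB; apply: eq_bigr => i _; rewrite !mxE; ring. Qed.

(** The squared modulus of a Fourier integral becomes a double integral through cos (u - v) = cos u
    cos v + sin u sin v. This exposes the difference p.1 - p.2, on which the Poisson kernel will
    act. *)
Lemma trig_transform_sqr f w : dx.-integrable setT (EFin \o f) ->
  cos_transform f w ^+ 2 + sin_transform f w ^+ 2 =
  \int[(dx \x dx)%E]_p (f p.1 * f p.2 * cos (dot w (p.1 - p.2))).
Proof.
move=> fi; have ic := integrable_cos w fi; have is_ := integrable_sin w fi.
have E (p : V * V) : f p.1 * f p.2 * cos (dot w (p.1 - p.2)) =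
  f p.1 * cos (dot w p.1) * (f p.2 * cos (dot w p.2)) +
  f p.1 * sin (dot w p.1) * (f p.2 * sin (dot w p.2)).
  by rewrite dotBr cosB; ring.
under eq_Rintegral do rewrite E.
rewrite RintegralD //; [|exact: (integrable_mul_prod ic ic)|exact: (integrable_mul_prod is_ is_)].
by congr (_ + _); rewrite expr2; symmetry; [exact: (Rintegral_mul_prod ic ic)|exact: (Rintegral_mul_prod is_ is_)].
Qed.

Lemma abelE (e : R) w : abel e w = expR (- (e * \sum_i `|w i 0|)).
Proof. by rewrite mulr_sumr -sumrN expR_sum. Qed.

Lemma abel_cvg1 w : abel k.+1%:R^-1 w @[k --> \oo] --> (1 : R).
Proof.
rewrite (_ : (fun k => _) = (fun k : nat => expR (- (k.+1%:R^-1 * \sum_i `|w i 0|)))); last by apply/funext => k; rewrite abelE.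
set S := \sum_i `|w i 0|.
have c0 : - (k.+1%:R^-1 * S) @[k --> \oo] --> - (0 * S).
  by apply: cvgN; apply: cvgM; [exact: cvg_harmonic|exact: cvg_cst].
rewrite mul0r oppr0 in c0.
by have := cvg_comp _ _ c0 (@continuous_expR R 0); rewrite expR0.
Qed.

Lemma abel_le w (a b : R) : a <= b -> abel b w <= abel a w.
Proof.
move=> ab; rewrite !abelE ler_expR lerN2 ler_wpM2r //.
by apply: sumr_ge0 => i _.
Qed.

(** Each coordinate yields a factor 1 / e; their product will cancel the Jacobian of the dilation by
    [e]. *)
Lemma poisson_scale (e : R) u : 0 < e -> poisson e (e *: u) = e ^- n * poisson 1 u.
Proof.
move=> e0; have -> : e ^- n = \prod_(i < n) e^-1 by rewrite prodr_const card_ord exprVn.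
rewrite /poisson -big_split /=.
apply: eq_bigr => i _; rewrite !mxE /poisson1 expr1n mulr1; set t := u i 0.
have h : 0 < 1 + t ^+ 2 by rewrite ltr_wpDr ?sqr_ge0.
have h2 : 0 < e ^+ 2 + (e * t) ^+ 2 by rewrite ltr_wpDr ?sqr_ge0 // exprn_gt0.
field; by rewrite !gt_eqF.
Qed.

Lemma poisson_bound (e : R) z : 0 < e -> poisson e z <= (2 / e) ^+ n.
Proof.
move=> e0; rewrite -[X in _ <= _ ^+ X](card_ord n) -prodr_const; apply: ler_prod => i _.
apply/andP; split; first exact/poisson1_ge0/ltW.
rewrite /poisson1; set t := z i 0.
have h2 : 0 < e ^+ 2 + t ^+ 2 by rewrite ltr_wpDr ?sqr_ge0 // exprn_gt0.
rewrite ler_pdivrMr // mulrAC ler_pdivlMr //; have := sqr_ge0 t; nra.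
Qed.

Section Function.
Variable f : V -> R.
Hypotheses (fi : dx.-integrable setT (EFin \o f))
  (f2 : dx.-integrable setT (fun x => (f x ^+ 2)%:E)).

Let mf : measurable_fun setT f.
Proof. by have /integrableP[/measurable_EFinP] := fi. Qed.

Let msub : measurable_fun setT (fun p : V * V => p.1 - p.2).
Proof.
apply: measurable_fun_matrix => i j.
rewrite (_ : (fun _ => _) = fun p : V * V => p.1 i j - p.2 i j); last by apply/funext => x; rewrite !mxE.
apply: measurable_funB.
  exact: (measurableT_comp (measurable_coord i j) measurable_fst).
exact: (measurableT_comp (measurable_coord i j) measurable_snd).
Qed.

Let mff : measurable_fun setT (fun p : V * V => f p.1 * f p.2).
Proof. by apply: measurable_funM; exact: measurableT_comp. Qed.

(** The Abel weight makes the integral over x, y and w absolutely convergent, being dominated by the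
    product of |f x|, |f y| and [abel e w]. The variable w can then be integrated innermost, which
    produces the kernel. *)
Lemma abel_mean_poisson (e : R) : 0 < e ->
  \int[dx]_w (abel e w * (cos_transform f w ^+ 2 + sin_transform f w ^+ 2)) =
  \int[dx]_x \int[dx]_y (f x * f y * poisson e (x - y)).
Proof.
move=> e0.
have ffi := integrable_mul_prod fi fi.
have Hi : ((dx \x dx) \x dx)%E.-integrable setT
    (fun q => (f q.1.1 * f q.1.2 * (abel e q.2 * cos (dot q.2 (q.1.1 - q.1.2))))%:E).
  apply: (le_normr_integrable (g := fun q : (V * V) * V => (f q.1.1 * f q.1.2) * abel e q.2)); last 2 first.
  - have h := integrable_mul_prod (m1 := sigma_finite_prod dx dx) (g := fun p : V * V => f p.1 * f p.2) (h := @abel R n e) ffi (integrable_abel n e0).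
    exact: h.
  - by move=> q; rewrite [leLHS]normrM [leRHS]normrM ler_wpM2l // normrM ler_piMr // norm_cos_le1.
  apply: measurable_funM; first exact: (measurableT_comp mff measurable_fst).
  apply: measurable_funM; first exact: (measurableT_comp (@measurable_abel R n e) measurable_snd).
  apply: (measurableT_comp (@measurable_cosR R)).
  apply: (measurableT_comp (@measurable_dot R n) (g := fun q : (V * V) * V => (q.2, q.1.1 - q.1.2))).
  apply: measurable_fun_pair => //; exact: (measurableT_comp msub measurable_fst).
transitivity (\int[dx]_w \int[(dx \x dx)%E]_p (f p.1 * f p.2 * (abel e w * cos (dot w (p.1 - p.2))))).
  apply: eq_Rintegral => w _; rewrite trig_transform_sqr // -RintegralZl //.
    by apply: eq_Rintegral => p _; ring.
  apply: (le_normr_integrable (g := fun p : V * V => f p.1 * f p.2)) => //.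
    apply: measurable_funM => //; apply: (measurableT_comp (@measurable_cosR R)).
    exact: (measurableT_comp (measurable_dotl w) msub).
  by move=> p; rewrite [leLHS]normrM ler_piMr // norm_cos_le1.
rewrite -(Rintegral_swap (m1 := sigma_finite_prod dx dx) (f := fun p w => f p.1 * f p.2 * (abel e w * cos (dot w (p.1 - p.2)))) Hi).
have Hi1 := integrable_Rintegral2 (m1 := sigma_finite_prod dx dx) (f := fun p w => f p.1 * f p.2 * (abel e w * cos (dot w (p.1 - p.2)))) Hi.
have E (p : V * V) : \int[dx]_w (f p.1 * f p.2 * (abel e w * cos (dot w (p.1 - p.2)))) =
    f p.1 * f p.2 * poisson e (p.1 - p.2).
  rewrite RintegralZl //; last exact: integrable_abel_cos.
  by rewrite (Rintegral_abel_trig (p.1 - p.2) e0).1.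
under eq_Rintegral do rewrite E.
symmetry; apply: (Rintegral_prod12 (f := fun x y => f x * f y * poisson e (x - y))).
by move: Hi1; under eq_fun do rewrite E.
Qed.

Definition autocorrelation z : R := \int[dx]_x (f x * f (x - z)).

Let N2 : R := \int[dx]_x (f x ^+ 2).

Let f2s z : dx.-integrable setT (fun x => (f (x - z) ^+ 2)%:E).
Proof.
have := scales_integrable _ (scales_affine (- z) (oner_neq0 R)) f2.
rewrite normr1 invr1 expr1n ler01 => /(_ isT).
by under eq_fun do rewrite scale1r.
Qed.

Let N2s z : \int[dx]_x (f (x - z) ^+ 2) = N2.
Proof.
have := scales_Rintegral (scales_affine (- z) (oner_neq0 R)) f2.
rewrite normr1 invr1 expr1n mul1r.
by under eq_Rintegral do rewrite scale1r.
Qed.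

Lemma integrable_autocorrelation z : dx.-integrable setT (fun x => (f x * f (x - z))%:E).
Proof.
apply: (le_normr_integrable (g := fun x : V => f x ^+ 2 + f (x - z) ^+ 2)).
- by apply: measurable_funM => //; exact: (measurable_shift (f := f)).
- exact: (integrable_addR measurableT f2 (f2s z)).
- move=> x; rewrite [leRHS]ger0_norm ?addr_ge0 ?sqr_ge0 //.
  have := sqr_ge0 (f x - f (x - z)); have := sqr_ge0 (f x + f (x - z)).
  rewrite ler_norml; move: (f x) (f (x - z)) => a b h1 h2; apply/andP; split; nra.
Qed.

Lemma autocorrelation_norm_le z : `|autocorrelation z| <= N2.
Proof.
apply: (le_trans (le_normr_Rintegral _ _)) => //; first exact: integrable_autocorrelation.
have i2 : dx.-integrable setT (fun x => (2^-1 * (f x ^+ 2 + f (x - z) ^+ 2))%:E).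
  exact: (integrable_scaleR measurableT _ (integrable_addR measurableT f2 (f2s z))).
apply: (@le_trans _ _ (\int[dx]_x (2^-1 * (f x ^+ 2 + f (x - z) ^+ 2)))).
  apply: le_Rintegral => //; first exact/integrable_norm/integrable_autocorrelation.
  move=> x _; rewrite ler_norml; move: (f x) (f (x - z)) => a b.
  have := sqr_ge0 (a - b); have := sqr_ge0 (a + b); move=> h1 h2; apply/andP; split; nra.
rewrite RintegralZl //; last exact: (integrable_addR measurableT f2 (f2s z)).
by rewrite (RintegralD measurableT f2 (f2s z)) N2s -/N2; lra.
Qed.

(** Twice f(x) f(x - h) is the sum of the two squares minus the squared increment, and both squares
    integrate to [N2]. Continuity of the autocorrelation at 0 thus reduces to continuity of
    translations. *)
Lemma autocorrelation_shift z (k : nat) :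
  autocorrelation (k.+1%:R^-1 *: z) = N2 - fine (shift_dist2 f (- z) k) / 2.
Proof.
set h := _ *: z.
have -> : fine (shift_dist2 f (- z) k) = \int[dx]_x ((f (x - h) - f x) ^+ 2).
  by rewrite /shift_dist2 /Rintegral; congr fine; apply: eq_integral => x _; rewrite scalerN.
have ia := integrable_autocorrelation h.
have E x : (f (x - h) - f x) ^+ 2 = (f (x - h) ^+ 2 + f x ^+ 2) - 2 * (f x * f (x - h)) by ring.
under eq_Rintegral do rewrite E.
rewrite RintegralB //; last 2 first.
- exact: (integrable_addR measurableT (f2s h) f2).
- exact: (integrable_scaleR measurableT _ ia).
by rewrite (RintegralD measurableT (f2s h) f2) (RintegralZl _ measurableT ia) N2s -/(autocorrelation h) -/N2; lra.
Qed.

Let f2oo : (\int[dx]_x (f x ^+ 2)%:E < +oo)%E.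
Proof.
have /integrableP[_] := f2.
by under eq_integral do rewrite abse_EFin ger0_norm ?sqr_ge0 //.
Qed.

Lemma autocorrelation_cvg z : autocorrelation (k.+1%:R^-1 *: z) @[k --> \oo] --> N2.
Proof.
under eq_fun do rewrite autocorrelation_shift.
have c0 : fine (shift_dist2 f (- z) k) / 2 @[k --> \oo] --> (0 : R).
  rewrite -(mul0r 2^-1); apply: cvgM; last exact: cvg_cst.
  by have /fine_cvgP[] := shift_continuous_L2 mf f2oo (- z).
have : N2 - fine (shift_dist2 f (- z) k) / 2 @[k --> \oo] --> N2 - 0 by apply: cvgB => //; exact: cvg_cst.
by rewrite subr0.
Qed.

(** The substitution y = x - e u: its Jacobian e^n cancels the e^-n of the rescaled kernel.
    Afterwards [e] occurs only inside the autocorrelation, so the limit can be taken under a fixed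
    kernel. *)
Lemma poisson_mean_autocorrelation (e : R) : 0 < e ->
  \int[dx]_x \int[dx]_y (f x * f y * poisson e (x - y)) =
  \int[dx]_u (poisson 1 u * autocorrelation (e *: u)).
Proof.
move=> e0; have ne0 : - e != 0 by rewrite oppr_eq0 gt_eqF.
have E x : \int[dx]_y (f x * f y * poisson e (x - y)) = \int[dx]_u (f x * f (x - e *: u) * poisson 1 u).
  have iF : dx.-integrable setT (EFin \o (fun y => f x * f y * poisson e (x - y))).
    apply: (le_normr_integrable (g := fun y : V => (f x * (2 / e) ^+ n) * f y)).
    - apply: measurable_funM; first exact: measurable_funM.
      have h := measurableT_comp (@measurable_poisson R n e e0) (measurableT_comp msub (pair1_measurable x)).
      exact: h.
    - exact: (integrable_scaleR measurableT _ fi).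
    - move=> y; rewrite !normrM mulrAC ler_wpM2r // ler_wpM2l //.
      have p0 : 0 <= poisson e (x - y) by exact/poisson_ge0/ltW.
      have b := poisson_bound (x - y) e0.
      by rewrite !ger0_norm // (le_trans p0).
  have := scales_Rintegral (scales_affine x ne0) iF.
  rewrite normrN gtr0_norm // => h.
  apply: (mulfI (x := e^-1 ^+ n)); first by rewrite expf_eq0 invr_eq0 gt_eqF // andbF.
  rewrite -h -RintegralZl //.
    apply: eq_Rintegral => u _; rewrite scaleNr (addrC _ x) opprD addrA subrr sub0r opprK.
    by rewrite poisson_scale // exprVn; ring.
  apply: (le_normr_integrable (g := fun u : V => e ^+ n * (f x * f (- e *: u + x) * poisson e (x - (- e *: u + x))))).
  - apply: measurable_funM; last exact: measurable_poisson.
    apply: measurable_funM => //.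
    exact: (measurableT_comp mf (measurableT_comp msub (measurableT_comp (pair1_measurable x) (measurable_mx_scale e)))).
  - apply: integrable_scaleR => //.
    apply: (scales_integrable _ (scales_affine x ne0) iF); by rewrite exprn_ge0.
  - move=> u; rewrite scaleNr (addrC _ x) opprD addrA subrr sub0r opprK poisson_scale //.
    by rewrite mulrCA [e ^+ n * _]mulrA divff ?mul1r // expf_neq0 // gt_eqF.
under eq_Rintegral do rewrite E.
rewrite Rintegral_swap.
  apply: eq_Rintegral => u _; rewrite -RintegralZl //; last exact: integrable_autocorrelation.
  by apply: eq_Rintegral => x _; rewrite mulrC.
have mg : measurable_fun setT (fun p : V * V => f p.1 * f (p.1 - e *: p.2) * poisson 1 p.2).
  apply: measurable_funM; last exact: (measurableT_comp (measurable_poisson ltr01) measurable_snd).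
  apply: measurable_funM; apply: measurableT_comp => //.
  apply: (measurableT_comp msub (g := fun p : V * V => (p.1, e *: p.2))).
  apply: measurable_fun_pair => //; exact: (measurableT_comp (measurable_mx_scale e) measurable_snd).
apply: (integrable_prod21 (f := fun x u => f x * f (x - e *: u) * poisson 1 u)) => //.
(* Absolute convergence for the exchange: for each [u] the integral of |f(x) f(x - e u)| is at most
   [N2], by 2 |a b| <= a^2 + b^2 and translation invariance, and the kernel has finite mass. *)
apply: (@le_lt_trans _ _ (\int[dx]_u (N2%:E * (poisson 1 u)%:E))%E).
  apply: ge0_le_integral => //.
  - by move=> u _; apply: integral_ge0 => x _; rewrite lee_fin.
  - apply: (measurable_fun_fubini_tonelli_G (fun p : V * V => `|f p.1 * f (p.1 - e *: p.2) * poisson 1 p.2|%:E)) => //.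
    by apply/measurable_EFinP; exact: measurableT_comp.
  - by apply: emeasurable_funM => //; apply/measurable_EFinP; exact: measurable_poisson.
  move=> u _; under eq_integral do rewrite normrM EFinM.
  rewrite ge0_integralZr //; last first.
    apply/measurable_EFinP; apply: measurableT_comp => //.
    by have /integrableP[/measurable_EFinP] := integrable_autocorrelation (e *: u).
  rewrite ger0_norm ?poisson_ge0 // lee_wpmul2r ?lee_fin ?poisson_ge0 //.
  have ia := integrable_autocorrelation (e *: u).
  have ian := integrable_norm ia.
  have fN := integrable_fin_num measurableT ian.
  rewrite -(fineK fN) lee_fin.
  have i2 : dx.-integrable setT (fun x => (2^-1 * (f x ^+ 2 + f (x - e *: u) ^+ 2))%:E).
    exact: (integrable_scaleR measurableT _ (integrable_addR measurableT f2 (f2s (e *: u)))).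
  apply: (@le_trans _ _ (\int[dx]_x (2^-1 * (f x ^+ 2 + f (x - e *: u) ^+ 2)))).
    apply: le_Rintegral => //.
    move=> x _; rewrite ler_norml; move: (f x) (f (x - _)) => a b.
    have := sqr_ge0 (a - b); have := sqr_ge0 (a + b); move=> h1 h2; apply/andP; split; nra.
  rewrite RintegralZl //; last exact: (integrable_addR measurableT f2 (f2s (e *: u))).
  by rewrite (RintegralD measurableT f2 (f2s (e *: u))) N2s -/N2; lra.
have N20 : 0 <= N2 by apply: Rintegral_ge0 => x _; exact: sqr_ge0.
rewrite ge0_integralZl_EFin //.
- by rewrite integral_poisson -EFinM ltry.
- by move=> u _; rewrite lee_fin poisson_ge0.
- by apply/measurable_EFinP; exact: measurable_poisson.
Qed.


Lemma trig_transform_ge0 w : 0 <= cos_transform f w ^+ 2 + sin_transform f w ^+ 2.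
Proof. by rewrite addr_ge0 ?sqr_ge0. Qed.

Lemma measurable_trig_transform :
  measurable_fun setT (fun w => cos_transform f w ^+ 2 + sin_transform f w ^+ 2).
Proof.
apply: measurable_funD; apply: measurable_funX; apply: measurable_Rintegral2.
  apply: measurable_funM; first exact: (measurableT_comp mf measurable_snd).
  exact: (measurableT_comp (@measurable_cosR R) (@measurable_dot R n)).
apply: measurable_funM; first exact: (measurableT_comp mf measurable_snd).
exact: (measurableT_comp (@measurable_sinR R) (@measurable_dot R n)).
Qed.

Lemma trig_transform_bound w :
  cos_transform f w ^+ 2 + sin_transform f w ^+ 2 <= 2 * (\int[dx]_x `|f x|) ^+ 2.
Proof.
have b (h : V -> R) : dx.-integrable setT (EFin \o h) -> (forall x, `|h x| <= `|f x|) ->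
    (\int[dx]_x h x) ^+ 2 <= (\int[dx]_x `|f x|) ^+ 2.
  move=> ih hf; rewrite -(real_normK (num_real (\int[dx]_x h x))) ler_sqr ?nnegrE //; last first.
    by apply: Rintegral_ge0 => x _.
  apply: (le_trans (le_normr_Rintegral _ ih)) => //.
  by apply: le_Rintegral => //; [exact: (integrable_norm ih)|exact: (integrable_norm fi)].
have := b _ (integrable_cos w fi) (fun x => _).
have := b _ (integrable_sin w fi) (fun x => _).
rewrite /= -/(cos_transform f w) -/(sin_transform f w) => h1 h2.
rewrite mulr_natl mulr2n lerD //; [apply: h2 => x|apply: h1 => x].
  by rewrite normrM ler_piMr // norm_cos_le1.
by rewrite normrM ler_piMr // norm_sin_le1.
Qed.

(** One sequence of Abel means has two limits. On the frequency side the weights increase to 1, and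
    monotone convergence allows an a priori infinite limit; on the other side the kernel times [N2]
    dominates. *)
Theorem scalar_plancherel :
  (\int[dx]_w (cos_transform f w ^+ 2 + sin_transform f w ^+ 2)%:E =
   ((2 * pi) ^+ n)%:E * \int[dx]_x (f x ^+ 2)%:E)%E.
Proof.
pose g w := cos_transform f w ^+ 2 + sin_transform f w ^+ 2.
have mg : measurable_fun setT g by exact: measurable_trig_transform.
have g0 w : 0 <= g w by exact: trig_transform_ge0.
have J0 : 0 <= \int[dx]_x `|f x| by apply: Rintegral_ge0.
pose ep (k : nat) : R := k.+1%:R^-1.
have ep0 k : 0 < ep k by rewrite invr_gt0.
have mag k : measurable_fun setT (fun w => abel (ep k) w * g w).
  by apply: measurable_funM => //; exact: measurable_abel.
have iag k : dx.-integrable setT (fun w => (abel (ep k) w * g w)%:E).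
  apply: (le_normr_integrable (g := fun w => (2 * (\int[dx]_x `|f x|) ^+ 2) * abel (ep k) w)) => //.
    exact: (integrable_scaleR measurableT _ (integrable_abel n (ep0 k))).
  move=> w; have b := trig_transform_bound w; rewrite mulrC !ger0_norm ?mulr_ge0 ?abel_ge0 ?exprn_ge0 //.
  by rewrite ler_wpM2r // abel_ge0.
have L1 : (\int[dx]_w (abel (ep k) w * g w)%:E)%E @[k --> \oo] --> (\int[dx]_w (g w)%:E)%E.
  rewrite (_ : (\int[dx]_w (g w)%:E)%E = (\int[dx]_w limn (fun k => (abel (ep k) w * g w)%:E))%E); last first.
    apply: eq_integral => w _; apply/esym/cvg_lim => //.
    apply/fine_cvgP; split; first exact: nearW.
    rewrite -[X in _ --> X]mul1r; apply: cvgM; [exact: abel_cvg1|exact: cvg_cst].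
  apply: cvg_monotone_convergence => //.
  - by move=> k; apply/measurable_EFinP.
  - by move=> k w _; rewrite lee_fin mulr_ge0 // abel_ge0.
  - move=> w _ k l kl; rewrite lee_fin ler_wpM2r // abel_le // /ep.
    by rewrite lef_pV2 ?posrE // ler_nat.
have N2fin : (\int[dx]_x (f x ^+ 2)%:E)%E = N2%:E.
  by rewrite /N2 /Rintegral fineK //; exact: integrable_fin_num.
have mau k : measurable_fun setT (fun u => autocorrelation (ep k *: u)).
  apply: measurable_Rintegral2; apply: measurable_funM; first exact: (measurableT_comp mf measurable_snd).
  apply: (measurableT_comp mf).
  apply: (measurableT_comp msub (g := fun p : V * V => (p.2, ep k *: p.1))).
  apply: measurable_fun_pair => //; exact: (measurableT_comp (measurable_mx_scale (ep k)) measurable_fst).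
have mp := @measurable_poisson R n 1 ltr01.
have mpa k : measurable_fun setT (fun u => poisson 1 u * autocorrelation (ep k *: u)) by exact: measurable_funM.
have N20 : 0 <= N2 by apply: Rintegral_ge0 => x _; exact: sqr_ge0.
have ip : dx.-integrable setT (EFin \o @poisson R n 1).
  apply/integrableP; split; first exact/measurable_EFinP.
  by under eq_integral do rewrite /= ger0_norm ?poisson_ge0 //; rewrite integral_poisson ltry.
have L2 : (\int[dx]_w (abel (ep k) w * g w)%:E)%E @[k --> \oo] --> (((2 * pi) ^+ n)%:E * N2%:E)%E.
  rewrite (_ : (fun k => _) = (fun k => \int[dx]_u (poisson 1 u * autocorrelation (ep k *: u))%:E)%E); last first.
    apply/funext => k.
    have ipa : dx.-integrable setT (fun u => (poisson 1 u * autocorrelation (ep k *: u))%:E).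
      apply: (le_normr_integrable (g := fun u : V => N2 * poisson 1 u)) => //.
        exact: (integrable_scaleR measurableT _ ip).
      move=> u; rewrite mulrC !normrM ler_wpM2r // (ger0_norm N20); exact: autocorrelation_norm_le.
    rewrite -[LHS]fineK ?integrable_fin_num // -[RHS]fineK ?integrable_fin_num //; congr EFin.
    by rewrite -[LHS]/(\int[dx]_w (abel (ep k) w * g w)) abel_mean_poisson // poisson_mean_autocorrelation.
  rewrite (_ : (_ * _)%E = (\int[dx]_u (poisson 1 u * N2)%:E)%E); last first.
    under eq_integral do rewrite mulrC EFinM.
    rewrite ge0_integralZl_EFin //; last 2 first.
    - by move=> u _; rewrite lee_fin poisson_ge0.
    - exact/measurable_EFinP.
    by rewrite integral_poisson muleC.
  apply: (dominated_cvg measurableT (g := fun u => (N2 * poisson 1 u)%:E)).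
  - by move=> k; exact/measurable_EFinP.
  - move=> u _; apply/fine_cvgP; split; first exact: nearW.
    by apply: cvgM; [exact: cvg_cst|exact: autocorrelation_cvg].
  - by [].
  - exact: (integrable_scaleR measurableT _ ip).
  - move=> k u _; rewrite lee_fin normrM ger0_norm ?poisson_ge0 // mulrC ler_wpM2r ?poisson_ge0 //.
    exact: autocorrelation_norm_le.
by rewrite N2fin; apply: (cvg_unique _ L1 L2).
Qed.
End Function.
End ScalarPlancherel.

(** * Clifford algebra *)

Section CliffordNorms.
Variables (R : realType) (n : nat).
Local Notation cl := (clifford R n).
Implicit Types (M N P : cl) (A B C : {set 'I_n}).

Definition cl_dot M N : R := \sum_A M A * N A.
(** The l1 norm of the coordinates. It is submultiplicative with constant 1, whereas bounding a
    product in [cl_sqrnorm] costs powers of the dimension. *)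
Definition cl_norm1 M : R := \sum_A `|M A|.

Lemma cl_oppE M A : (- M) A = - M A. Proof. exact: ffunE. Qed.
Lemma cl0E A : (0 : cl) A = 0. Proof. exact: ffunE. Qed.

Lemma reverseD : {morph @reverse R n : M N / M + N}.
Proof. by move=> M N; apply/ffunP => A; rewrite cl_addE !reverse_sign cl_addE mulrDr. Qed.
Lemma reverseN : {morph @reverse R n : M / - M}.
Proof. by move=> M; apply/ffunP => A; rewrite cl_oppE !reverse_sign cl_oppE mulrN. Qed.
Lemma reverseB : {morph @reverse R n : M N / M - N}.
Proof. by move=> M N; rewrite reverseD reverseN. Qed.
Lemma reverseZ c : {morph @reverse R n : M / c *: M}.
Proof. by move=> M; apply/ffunP => A; rewrite cl_scaleE !reverse_sign cl_scaleE mulrCA. Qed.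
Lemma reverseK : involutive (@reverse R n).
Proof. by move=> M; apply/ffunP => A; rewrite !reverse_sign mulrA blade_signK mul1r. Qed.

Lemma scalar_mul_reverse M N : scalar_part (M * reverse N) = cl_dot M N.
Proof.
rewrite /scalar_part cl_mulrE; apply: eq_bigr => A _.
rewrite !(symdiffx0 A) reverse_sign -[RHS]mul1r -(blade_signK R A A); ring.
Qed.

Lemma cl_dotMr M N P : cl_dot (M * N) P = cl_dot M (P * reverse N).
Proof. by rewrite -!scalar_mul_reverse reverseM reverseK mulrA. Qed.

Lemma cl_dotC M N : cl_dot M N = cl_dot N M.
Proof. by apply: eq_bigr => A _; rewrite mulrC. Qed.

Lemma cl_dot_blade M A : cl_dot M (blade R A) = M A.
Proof.
rewrite /cl_dot (bigD1 A) //= ffunE eqxx mulr1 big1 ?addr0 // => B BA.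
by rewrite ffunE (negPf BA) mulr0.
Qed.

(** This makes each coordinate of a Clifford-valued inner product a real inner product, against a
    second argument multiplied on the left by a blade. It is how the final formula is obtained from
    a real polarized identity. *)
Lemma mul_reverseE M N A : (M * reverse N) A = cl_dot M (blade R A * N).
Proof. by rewrite -(cl_dot_blade (M * reverse N)) cl_dotMr reverseK. Qed.

Lemma cl_dotDl M N P : cl_dot (M + N) P = cl_dot M P + cl_dot N P.
Proof. by rewrite /cl_dot -big_split; apply: eq_bigr => A _; rewrite cl_addE mulrDl. Qed.
Lemma cl_dotDr M N P : cl_dot P (M + N) = cl_dot P M + cl_dot P N.
Proof. by rewrite !(cl_dotC P) cl_dotDl. Qed.
Lemma cl_dotZl c M P : cl_dot (c *: M) P = c * cl_dot M P.
Proof. by rewrite /cl_dot mulr_sumr; apply: eq_bigr => A _; rewrite cl_scaleE mulrA. Qed.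
Lemma cl_dotZr c M P : cl_dot P (c *: M) = c * cl_dot P M.
Proof. by rewrite !(cl_dotC P) cl_dotZl. Qed.
Lemma cl_dotNl M P : cl_dot (- M) P = - cl_dot M P.
Proof. by rewrite -scaleN1r cl_dotZl mulN1r. Qed.
Lemma cl_dotNr M P : cl_dot P (- M) = - cl_dot P M.
Proof. by rewrite !(cl_dotC P) cl_dotNl. Qed.

Lemma cl_dot_sqr M : cl_dot M M = cl_sqrnorm M.
Proof. by rewrite cl_sqrnormE; apply: eq_bigr => A _; rewrite expr2. Qed.

Lemma cl_sqrnorm_ge0 M : 0 <= cl_sqrnorm M.
Proof. by rewrite cl_sqrnormE; apply: sumr_ge0 => A _; exact: sqr_ge0. Qed.

Lemma cl_sqrnormD M N : cl_sqrnorm (M + N) = cl_sqrnorm M + 2 * cl_dot M N + cl_sqrnorm N.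
Proof. by rewrite -!cl_dot_sqr !cl_dotDl !cl_dotDr (cl_dotC N M); ring. Qed.
Lemma cl_sqrnormN M : cl_sqrnorm (- M) = cl_sqrnorm M.
Proof. by rewrite -!cl_dot_sqr cl_dotNl cl_dotNr opprK. Qed.
Lemma cl_sqrnormB M N : cl_sqrnorm (M - N) = cl_sqrnorm M - 2 * cl_dot M N + cl_sqrnorm N.
Proof. by rewrite cl_sqrnormD cl_dotNr cl_sqrnormN mulrN. Qed.
Lemma cl_sqrnormZ c M : cl_sqrnorm (c *: M) = c ^+ 2 * cl_sqrnorm M.
Proof. by rewrite -!cl_dot_sqr cl_dotZl cl_dotZr expr2 mulrA. Qed.
Lemma cl_sqrnorm_reverse M : cl_sqrnorm (reverse M) = cl_sqrnorm M.
Proof.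
rewrite !cl_sqrnormE; apply: eq_bigr => A _.
by rewrite reverse_sign exprMn expr2 blade_signK mul1r.
Qed.

Lemma cl_polar M N : cl_dot M N = (cl_sqrnorm (M + N) - cl_sqrnorm (M - N)) / 4.
Proof. by rewrite cl_sqrnormD cl_sqrnormB; lra. Qed.

Lemma cl_dot_norm_le M N : `|cl_dot M N| <= cl_sqrnorm M + cl_sqrnorm N.
Proof.
have := cl_sqrnorm_ge0 (M + N); have := cl_sqrnorm_ge0 (M - N).
rewrite cl_sqrnormB cl_sqrnormD => h1 h2.
have := cl_sqrnorm_ge0 M; have := cl_sqrnorm_ge0 N => h3 h4.
by rewrite ler_norml; apply/andP; split; lra.
Qed.

(* Young's inequality for the cross term in [|M|^2 = |N + (M - N)|^2]. *)
Lemma cl_sqrnorm_quasi (t : R) M N : 0 < t ->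
  cl_sqrnorm M <= (1 + t) * cl_sqrnorm N + (1 + t^-1) * cl_sqrnorm (M - N).
Proof.
move=> t0; set D := M - N; have -> : M = N + D by rewrite addrC subrK.
rewrite cl_sqrnormD; have := cl_sqrnorm_ge0 (t *: N - D).
rewrite cl_sqrnormB cl_sqrnormZ cl_dotZl => h.
have h2 : t^-1 * (t ^+ 2 * cl_sqrnorm N - 2 * (t * cl_dot N D) + cl_sqrnorm D) =
   t * cl_sqrnorm N - 2 * cl_dot N D + t^-1 * cl_sqrnorm D by field; rewrite gt_eqF.
have : 0 <= t^-1 * (t ^+ 2 * cl_sqrnorm N - 2 * (t * cl_dot N D) + cl_sqrnorm D).
  by rewrite mulr_ge0 // invr_ge0 ltW.
by rewrite h2; lra.
Qed.

Lemma sqr_sum_le (J : finType) (x : J -> R) :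
  (\sum_i x i) ^+ 2 <= #|J|%:R * \sum_i x i ^+ 2.
Proof.
have E : \sum_i \sum_j (x i ^+ 2 + x j ^+ 2) / 2 = #|J|%:R * \sum_i x i ^+ 2.
  under eq_bigr => i _ do rewrite -mulr_suml big_split /= sumr_const.
  by rewrite -mulr_suml big_split /= sumr_const sumrMnl -mulr_natl -(mulr_natl (\sum_i _)); field.
rewrite -E expr2 mulr_suml; apply: ler_sum => i _; rewrite mulr_sumr; apply: ler_sum => j _.
have := sqr_ge0 (x i - x j); lra.
Qed.

Definition cl_dim : R := #|{: {set 'I_n}}|%:R.

Lemma cl_dim_ge0 : 0 <= cl_dim. Proof. exact: ler0n. Qed.

Lemma norm_blade_sign A B : `|blade_sign R A B| = 1.
Proof.
have := blade_signK R A B; rewrite -expr2 => /eqP; rewrite sqrf_eq1 => /orP[/eqP->|/eqP->];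
by rewrite ?normrN normr1.
Qed.

Lemma symdiff_inj A : injective (symdiff A).
Proof. exact: can_inj (symdiffK A). Qed.

(** For a fixed blade A the map C |-> A + C permutes the blades, so the sum over C of the
    coefficients of [N] is the whole norm; the signs have absolute value 1. *)
Lemma cl_norm1M M N : cl_norm1 (M * N) <= cl_norm1 M * cl_norm1 N.
Proof.
rewrite /cl_norm1 mulr_suml.
apply: (@le_trans _ _ (\sum_C \sum_A `|M A| * `|N (symdiff A C)|)).
  apply: ler_sum => C _; rewrite cl_mulrE; apply: (le_trans (ler_norm_sum _ _ _)).
  by apply: ler_sum => A _; rewrite !normrM norm_blade_sign mul1r.
rewrite exchange_big /=; apply: ler_sum => A _; rewrite mulr_sumr.
by rewrite [leRHS](reindex_inj (symdiff_inj (A := A))).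
Qed.

Lemma cl_norm1_ge0 M : 0 <= cl_norm1 M.
Proof. by apply: sumr_ge0. Qed.

Lemma cl_norm1D M N : cl_norm1 (M + N) <= cl_norm1 M + cl_norm1 N.
Proof. by rewrite /cl_norm1 -big_split; apply: ler_sum => A _; rewrite cl_addE ler_normD. Qed.

Lemma cl_norm1Z c M : cl_norm1 (c *: M) = `|c| * cl_norm1 M.
Proof. by rewrite /cl_norm1 mulr_sumr; apply: eq_bigr => A _; rewrite cl_scaleE normrM. Qed.

Lemma cl_norm1_reverse M : cl_norm1 (reverse M) = cl_norm1 M.
Proof. by apply: eq_bigr => A _; rewrite reverse_sign normrM norm_blade_sign mul1r. Qed.

Lemma coef_le_norm1 M A : `|M A| <= cl_norm1 M.
Proof. by rewrite /cl_norm1 (bigD1 A) //= lerDl sumr_ge0. Qed.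

Lemma cl_norm1_sqr M : cl_norm1 M ^+ 2 <= cl_dim * cl_sqrnorm M.
Proof.
apply: (le_trans (sqr_sum_le _)); rewrite cl_sqrnormE /cl_dim.
by under eq_bigr do rewrite real_normK ?num_real //.
Qed.

Lemma sqrnorm_le_norm1 M : cl_sqrnorm M <= cl_norm1 M ^+ 2.
Proof.
rewrite cl_sqrnormE expr2 {2}/cl_norm1 mulr_sumr; apply: ler_sum => A _.
rewrite -(real_normK (num_real (M A))) expr2 ler_wpM2r // coef_le_norm1 //.
Qed.

Lemma cl_sqrnormM M N : cl_sqrnorm (M * N) <= cl_dim ^+ 2 * (cl_sqrnorm M * cl_sqrnorm N).
Proof.
apply: (le_trans (sqrnorm_le_norm1 _)).
apply: (@le_trans _ _ ((cl_norm1 M * cl_norm1 N) ^+ 2)).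
  by rewrite ler_sqr ?nnegrE ?mulr_ge0 ?cl_norm1_ge0 // cl_norm1M.
rewrite exprMn (_ : cl_dim ^+ 2 * _ = (cl_dim * cl_sqrnorm M) * (cl_dim * cl_sqrnorm N)); last by ring.
by apply: ler_pM; rewrite ?exprn_ge0 ?cl_norm1_ge0 ?cl_norm1_sqr.
Qed.

Lemma cl_norm1_prod_le M N : cl_norm1 M * cl_norm1 N <= cl_dim * (cl_sqrnorm M + cl_sqrnorm N).
Proof.
have := cl_norm1_sqr M; have := cl_norm1_sqr N; have := sqr_ge0 (cl_norm1 M - cl_norm1 N).
have := sqr_ge0 (cl_norm1 M); have := sqr_ge0 (cl_norm1 N); lra.
Qed.

Lemma sqr_coef_le M A : M A ^+ 2 <= cl_sqrnorm M.
Proof. by rewrite cl_sqrnormE (bigD1 A) //= lerDl sumr_ge0 // => B _; exact: sqr_ge0. Qed.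

End CliffordNorms.

(** * The pseudoscalar, its phases and twisted multivectors *)

Section Phase.
Variables (R : realType) (n : nat).
Hypothesis hn : (n %% 4 = 2 \/ n %% 4 = 3)%N.
Local Notation cl := (clifford R n).
Local Notation I := (pseudoscalar R n).
Implicit Types (M N : cl) (s t : R).

Let II : I * I = -1. Proof. exact: pseudoscalar_sqrN1. Qed.

(** The sign that reversal puts on the full blade is the sign of its square, here -1. *)
Lemma reverse_pseudoscalar : reverse I = - I.
Proof.
have h : blade_sign R [set: 'I_n]%SET [set: 'I_n]%SET = -1.
  have := II; rewrite pseudoscalarE bladeM symdiffxx => /ffunP/(_ finset.set0).
  by rewrite cl_scaleE cl_oppE -!blade0 !ffunE eqxx mulr1.
apply/ffunP => A; rewrite cl_oppE reverse_sign pseudoscalarE ffunE.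
by case: eqP => [->|_]; rewrite ?h ?mulN1r // mulr0 oppr0.
Qed.

Definition phase t : cl := (cos t)%:A + sin t *: I.

Lemma cl_exp_phase t : cl_exp (- (t *: I)) = phase (- t).
Proof. by rewrite -scaleNr cl_exp_sqrN1. Qed.

Lemma phase_comm t : GRing.comm (phase t) I.
Proof. by rewrite /GRing.comm mulrDl mulrDr -!scalerAl -!scalerAr mul1r mulr1. Qed.

Lemma phaseD s t : phase (s + t) = phase s * phase t.
Proof.
rewrite /phase cosD sinD mulrDl !mulrDr -!scalerAl -!scalerAr !mul1r mulr1 II.
by apply/ffunP => A; rewrite !(cl_addE, cl_scaleE, cl_oppE); ring.
Qed.

Lemma reverse1 : reverse (1 : cl) = 1.
Proof.
apply/ffunP => A; rewrite reverse_sign -blade0 ffunE.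
by case: eqP => [->|_]; rewrite ?blade_sign0l ?mul1r // mulr0.
Qed.

Lemma reverse_phase t : reverse (phase t) = phase (- t).
Proof.
by rewrite /phase reverseD !reverseZ reverse1 reverse_pseudoscalar cosN sinN scalerN scaleNr.
Qed.

Definition twisted s M := M * I = s *: (I * M).

Lemma twisted_phase s M t : (s = 1 \/ s = -1) -> twisted s M -> M * phase t = phase (s * t) * M.
Proof.
move=> hs; rewrite /twisted /phase mulrDl mulrDr -!scalerAr -!scalerAl mulr1 mul1r => ->.
by case: hs => ->; rewrite ?mul1r ?mulN1r ?cosN ?sinN ?scale1r ?scaleN1r ?scaleNr ?scalerN.
Qed.

Lemma twisted_reverse s M : (s = 1 \/ s = -1) -> twisted s M -> twisted s (reverse M).
Proof.
move=> hs; rewrite /twisted => h.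
have := congr1 (@reverse R n) h; rewrite reverseZ !reverseM reverse_pseudoscalar mulNr mulrN scalerN.
move=> /oppr_inj ->.
by case: hs => ->; rewrite scalerA ?mulrNN mulr1 scale1r.
Qed.

(* [twist s] projects onto the multivectors [M] such that [M * I = s *: (I * M)]. *)
Definition twist s M : cl := 2^-1 *: (M - s *: (I * M * I)).

Lemma twisted_twist s M : (s = 1 \/ s = -1) -> twisted s (twist s M).
Proof.
move=> hs; rewrite /twisted /twist -!scalerAl -!scalerAr !scalerA mulrC -scalerA; congr (_ *: _).
rewrite mulrBl mulrBr -scalerAl -scalerAr scalerBr scalerA.
rewrite -!mulrA II mulrN1 !mulrA II mulN1r mulNr !scalerN !opprK.
by apply/ffunP => A; rewrite mulrN !(cl_addE, cl_scaleE, cl_oppE); case: hs => ->; ring.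
Qed.

Lemma twist_id s M : (s = 1 \/ s = -1) -> twisted s M -> twist s M = M.
Proof.
move=> hs h; rewrite /twist -mulrA h -scalerAr mulrA II mulN1r scalerA scalerN opprK.
have -> : s * s = 1 by case: hs => ->; rewrite ?mulrNN mulr1.
by apply/ffunP => A; rewrite !(cl_scaleE, cl_addE); field.
Qed.

Lemma twistB s : {morph twist s : M N / M - N}.
Proof.
move=> M N; rewrite /twist -scalerBr; congr (_ *: _).
by rewrite mulrBr mulrBl scalerBr !opprB addrACA [in RHS]addrACA; congr (_ + _); rewrite addrC.
Qed.

Lemma cl_sqrnorm_mulI M : cl_sqrnorm (M * I) = cl_sqrnorm M.
Proof.
by rewrite -cl_dot_sqr cl_dotMr -mulrA reverse_pseudoscalar mulrN II opprK mulr1 cl_dot_sqr.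
Qed.

Lemma cl_sqrnorm_Imul M : cl_sqrnorm (I * M) = cl_sqrnorm M.
Proof. by rewrite -cl_sqrnorm_reverse reverseM reverse_pseudoscalar mulrN cl_sqrnormN cl_sqrnorm_mulI cl_sqrnorm_reverse. Qed.

Lemma cl_sqrnorm_twist s M : (s = 1 \/ s = -1) -> cl_sqrnorm (twist s M) <= cl_sqrnorm M.
Proof.
move=> hs; rewrite /twist cl_sqrnormZ; set N := s *: _.
have e : cl_sqrnorm N = cl_sqrnorm M.
  rewrite /N cl_sqrnormZ cl_sqrnorm_mulI cl_sqrnorm_Imul.
  by case: hs => ->; rewrite ?sqrrN expr1n mul1r.
have := cl_sqrnorm_ge0 (M + N); rewrite cl_sqrnormD cl_sqrnormB e => h.
have := cl_sqrnorm_ge0 M; lra.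
Qed.

(** Phases lie in the span of 1 and [I], so they commute with the right factor [I] in [twist]. This
    lets the projection pass through the Fourier integral. *)
Lemma twist_mulphase s M t : twist s (M * phase t) = twist s M * phase t.
Proof.
rewrite /twist -scalerAl mulrBl -scalerAl; congr (_ *: (_ - _ *: _)).
by rewrite -!mulrA (phase_comm t).
Qed.

(** Each vector of e_B anticommutes with the n - 1 other vectors of the full blade and commutes with
    itself; induction removes one vector at a time. *)
Lemma blade_sign_full (B : {set 'I_n}) :
  blade_sign R [set: 'I_n]%SET B * blade_sign R B [set: 'I_n]%SET = (-1) ^+ (#|B| * n.-1).
Proof.
move: {2}#|B| (erefl #|B|) => m; elim: m B => [|m IHm] B.
  by move=> /cards0_eq ->; rewrite blade_sign0l blade_sign0r cards0 mul1r.
move=> Bm; have [k kB] : exists k, k \in B by apply/set0Pn; rewrite -card_gt0 Bm.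
have kB' : k \notin (B :\ k)%SET by rewrite !inE eqxx.
have Bm' : #|(B :\ k)%SET| = m by move: Bm; rewrite (cardsD1 k) kB add1n => -[].
have sk : blade_sign R [set: 'I_n]%SET [set k]%SET * blade_sign R [set k]%SET [set: 'I_n]%SET = (-1) ^+ n.-1.
  have kT : k \notin ([set: 'I_n] :\ k)%SET by rewrite !inE eqxx.
  have cT : #|([set: 'I_n] :\ k)%SET| = n.-1.
    have h := cardsD1 k [set: 'I_n]%SET; rewrite finset.in_setT cardsT card_ord add1n in h.
    by apply: esym; exact: (congr1 predn h).
  rewrite -[in [set: 'I_n]%SET](finset.setD1K (finset.in_setT k)) -(symdiff1 kT).
  rewrite blade_sign_symdiffl blade_sign_symdiffr.
  have := blade_sign1C R kT; rewrite cT => h.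
  have hs := blade_signK R [set k]%SET [set k]%SET.
  transitivity ((blade_sign R [set k]%SET [set k]%SET * blade_sign R [set k]%SET [set k]%SET) *
    (blade_sign R [set k]%SET ([set: 'I_n] :\ k)%SET * blade_sign R ([set: 'I_n] :\ k)%SET [set k]%SET)); first by ring.
  by rewrite hs h mul1r.
rewrite -(finset.setD1K kB) -(symdiff1 kB') blade_sign_symdiffl blade_sign_symdiffr.
rewrite (symdiff1 kB') (finset.setD1K kB) Bm.
transitivity ((blade_sign R [set: 'I_n]%SET [set k]%SET * blade_sign R [set k]%SET [set: 'I_n]%SET) *
  (blade_sign R [set: 'I_n]%SET (B :\ k)%SET * blade_sign R (B :\ k)%SET [set: 'I_n]%SET)); first by ring.
by rewrite sk (IHm _ Bm') Bm' -exprD mulSn.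
Qed.

(** On both sides only the coefficient of the complementary blade contributes, and the sign is the
    cost of moving that blade across the full one. *)
Lemma mul_pseudoscalarC M A :
  (M * I) A = (-1) ^+ (#|symdiff [set: 'I_n]%SET A| * n.-1) * (I * M) A.
Proof.
have symTA B : symdiff (symdiff [set: 'I_n]%SET B) B = [set: 'I_n]%SET.
  by rewrite -symdiffA symdiffxx (symdiffx0 [set: 'I_n]%SET).
have E : (I * M) A = blade_sign R [set: 'I_n]%SET (symdiff [set: 'I_n]%SET A) * M (symdiff [set: 'I_n]%SET A).
  rewrite pseudoscalarE cl_mulrE (bigD1 [set: 'I_n]%SET) //= ffunE eqxx mulr1 big1 ?addr0 // => B BT.
  by rewrite ffunE (negPf BT) mulr0 mul0r.
have E' : (M * I) A = blade_sign R (symdiff [set: 'I_n]%SET A) [set: 'I_n]%SET * M (symdiff [set: 'I_n]%SET A).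
  rewrite pseudoscalarE cl_mulrE (bigD1 (symdiff [set: 'I_n]%SET A)) //= ffunE.
  rewrite symTA eqxx mulr1 big1 ?addr0 // => B BT.
  rewrite ffunE (_ : (_ == _) = false) ?mulr0 //; apply/negbTE; apply: contra BT => /eqP h.
  by apply/eqP; rewrite -h -symdiffA symdiffxx (symdiffx0 B).
rewrite E E' -blade_sign_full //; set u := blade_sign R _ _; set v := blade_sign R _ _.
have vv : v * v = 1 by exact: blade_signK.
by rewrite -[LHS]mul1r -vv; ring.
Qed.

Lemma mul_pseudoscalar0 M A : M (symdiff [set: 'I_n]%SET A) = 0 -> (I * M) A = 0.
Proof.
move=> h; rewrite pseudoscalarE cl_mulrE (bigD1 [set: 'I_n]%SET) //= h mulr0 big1 ?addr0 // => B BT.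
by rewrite ffunE (negPf BT) mulr0 mul0r.
Qed.

Lemma twisted_even M : (n %% 4 = 2)%N -> is_even M -> twisted 1 M.
Proof.
move=> n2 h; apply/ffunP => A; rewrite scale1r mul_pseudoscalarC.
case: (boolP (odd #|symdiff [set: 'I_n]%SET A|)) => o; first by rewrite mul_pseudoscalar0 ?mulr0 // h.
by rewrite -signr_odd oddM (negbTE o) expr0 mul1r.
Qed.

Lemma twisted_odd M : (n %% 4 = 2)%N -> is_odd M -> twisted (-1) M.
Proof.
move=> n2 h; have on : odd n.-1.
  by rewrite (divn_eq n 4) n2 addn2 /= oddM /= andbF.
apply/ffunP => A; rewrite scaleN1r mul_pseudoscalarC cl_oppE.
case: (boolP (odd #|symdiff [set: 'I_n]%SET A|)) => o; last by rewrite mul_pseudoscalar0 ?mulr0 ?oppr0 // h.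
by rewrite -signr_odd oddM o on expr1 mulN1r.
Qed.

Lemma twisted_central M : (n %% 4 = 3)%N -> twisted 1 M.
Proof.
move=> n3; have on : ~~ odd n.-1.
  by rewrite (divn_eq n 4) n3 addn3 /= oddM /= andbF.
apply/ffunP => A; rewrite scale1r mul_pseudoscalarC.
by rewrite -signr_odd oddM (negbTE on) andbF expr0 mul1r.
Qed.
End Phase.

(** * Clifford-valued integration *)

Section CliffordMeasurable.
Context d (T : measurableType d) (R : realType) (n : nat).
Local Notation cl := (clifford R n).
Implicit Types F G : T -> cl.

Lemma cl_measurableD F G : cl_measurable F -> cl_measurable G ->
  cl_measurable (fun x => F x + G x).
Proof.
by move=> mF mG A; under eq_fun do rewrite cl_addE; exact: measurable_funD.
Qed.

Lemma cl_measurableZ (c : T -> R) F : measurable_fun setT c -> cl_measurable F ->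
  cl_measurable (fun x => c x *: F x).
Proof.
by move=> mc mF A; under eq_fun do rewrite cl_scaleE; exact: measurable_funM.
Qed.

Lemma cl_measurableN F : cl_measurable F -> cl_measurable (fun x => - F x).
Proof.
move=> mF A; under eq_fun do rewrite cl_oppE -mulN1r.
exact: (measurable_funM (measurable_cst _)).
Qed.

Lemma cl_measurableB F G : cl_measurable F -> cl_measurable G ->
  cl_measurable (fun x => F x - G x).
Proof. by move=> mF mG; apply: cl_measurableD => //; exact: cl_measurableN. Qed.

Lemma cl_measurableM F G : cl_measurable F -> cl_measurable G ->
  cl_measurable (fun x => F x * G x).
Proof.
move=> mF mG A; under eq_fun do rewrite cl_mulrE.
apply: measurable_sum => B; apply: measurable_funM => //.
by apply: measurable_funM => //; exact: measurable_cst.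
Qed.

Lemma cl_measurable_cst (M : cl) : cl_measurable (fun _ : T => M).
Proof. by move=> A; exact: measurable_cst. Qed.

Lemma cl_measurable_reverse F : cl_measurable F -> cl_measurable (fun x => reverse (F x)).
Proof.
move=> mF A; under eq_fun do rewrite reverse_sign.
exact: (measurable_funM (measurable_cst _)).
Qed.

Lemma measurable_cl_dot F G : cl_measurable F -> cl_measurable G ->
  measurable_fun setT (fun x => cl_dot (F x) (G x)).
Proof.
move=> mF mG; rewrite /cl_dot; apply: measurable_sum => A.
exact: measurable_funM.
Qed.

Lemma measurable_cl_sqrnorm F : cl_measurable F ->
  measurable_fun setT (fun x => cl_sqrnorm (F x)).
Proof. by move=> mF; under eq_fun do rewrite -cl_dot_sqr; exact: measurable_cl_dot. Qed.

Lemma measurable_cl_norm1 F : cl_measurable F ->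
  measurable_fun setT (fun x => cl_norm1 (F x)).
Proof.
move=> mF; rewrite /cl_norm1; apply: measurable_sum => A.
exact: (measurableT_comp (@normr_measurable R setT)).
Qed.

Lemma cl_measurable_phase (t : T -> R) : measurable_fun setT t ->
  cl_measurable (fun x => phase n (t x)).
Proof.
move=> mt; apply: cl_measurableD; apply: cl_measurableZ (cl_measurable_cst _).
  exact: (measurableT_comp (@measurable_cosR R)).
exact: (measurableT_comp (@measurable_sinR R)).
Qed.

End CliffordMeasurable.

Lemma cl_measurable_comp d1 d2 (T1 : measurableType d1) (T2 : measurableType d2)
    (R : realType) n (F : T2 -> clifford R n) (phi : T1 -> T2) :
  measurable_fun setT phi -> cl_measurable F -> cl_measurable (fun x => F (phi x)).
Proof. by move=> mphi mF A; exact: (measurableT_comp (mF A)). Qed.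

Lemma sum_ge0_integrable d (T : measurableType d) (R : realType)
    (mu : {measure set T -> \bar R}) (D : set T) (J : finType) (h : J -> T -> R) : measurable D ->
  (forall i, mu.-integrable D (EFin \o h i)) ->
  mu.-integrable D (fun x => (\sum_i h i x)%:E) /\
  \int[mu]_(x in D) (\sum_i h i x) = \sum_i \int[mu]_(x in D) h i x.
Proof.
move=> mD hi; elim: (index_enum J) => [|j s [IH1 IH2]].
  split; first by under eq_fun do rewrite big_nil; exact: integrable0.
  by under eq_Rintegral do rewrite big_nil; rewrite big_nil /Rintegral integral0.
split; first by under eq_fun do rewrite big_cons; exact: integrable_addR.
by under eq_Rintegral do rewrite big_cons; rewrite big_cons RintegralD ?IH2.
Qed.

Definition cl_linear (R : comNzRingType) m n (L : clifford R m -> clifford R n) :=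
  (forall M N, L (M + N) = L M + L N) /\ (forall c M, L (c *: M) = c *: L M).

Section CliffordLinear.
Variables (R : comNzRingType) (n : nat).
Local Notation cl := (clifford R n).
Variable L : cl -> cl.
Hypothesis hL : cl_linear L.

Lemma cl_sum_blade (M : cl) : M = \sum_A M A *: blade R A.
Proof.
apply/ffunP => B; rewrite sum_ffunE (bigD1 B) //= cl_scaleE ffunE eqxx mulr1 big1 ?addr0 // => A AB.
by rewrite cl_scaleE ffunE eq_sym (negPf AB) mulr0.
Qed.

(** The matrix of [L] in the blade basis. Integrals being taken coordinatewise, this finite sum is
    what carries [L] across the integral sign. *)
Lemma cl_linear_coef M B : L M B = \sum_A L (blade R A) B * M A.
Proof.
have L0 : L 0 = 0 by rewrite -(scale0r (0 : cl)) hL.2 !scale0r.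
rewrite {1}(cl_sum_blade M) (big_morph L hL.1 L0) sum_ffunE.
by apply: eq_bigr => A _; rewrite hL.2 cl_scaleE mulrC.
Qed.
End CliffordLinear.

Section CliffordIntegral.
Context d (T : measurableType d) (R : realType) (n : nat).
Variables (mu : {measure set T -> \bar R}) (D : set T).
Hypothesis mD : measurable D.
Local Notation cl := (clifford R n).
Implicit Types (F G : T -> cl) (L : cl -> cl).

Lemma cl_integrable_linear L F : cl_linear L ->
  cl_integrable mu D F -> cl_integrable mu D (fun x => L (F x)).
Proof.
move=> hL Fi B; under eq_fun do rewrite cl_linear_coef //.
have h A : mu.-integrable D (EFin \o (fun x => L (blade R A) B * F x A)).
  exact: (integrable_scaleR mD _ (Fi A)).
by case: (sum_ge0_integrable mD h).
Qed.

Lemma cl_integral_linear L F : cl_linear L -> cl_integrable mu D F ->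
  cl_integral mu D (fun x => L (F x)) = L (cl_integral mu D F).
Proof.
move=> hL Fi; apply/ffunP => B; rewrite ffunE cl_linear_coef //.
under eq_Rintegral do rewrite cl_linear_coef //.
have h A : mu.-integrable D (EFin \o (fun x => L (blade R A) B * F x A)).
  exact: (integrable_scaleR mD _ (Fi A)).
case: (sum_ge0_integrable mD h) => _ ->; apply: eq_bigr => A _.
by rewrite ffunE RintegralZl //; exact: Fi.
Qed.

Lemma cl_integrableD F G : cl_integrable mu D F -> cl_integrable mu D G ->
  cl_integrable mu D (fun x => F x + G x).
Proof.
by move=> Fi Gi A; under eq_fun do rewrite cl_addE; exact: (integrable_addR mD (Fi A) (Gi A)).
Qed.

Lemma cl_integralD F G : cl_integrable mu D F -> cl_integrable mu D G ->
  cl_integral mu D (fun x => F x + G x) = cl_integral mu D F + cl_integral mu D G.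
Proof.
move=> Fi Gi; apply/ffunP => A; rewrite cl_addE !ffunE -RintegralD //; [|exact: Fi|exact: Gi].
by under eq_Rintegral do rewrite cl_addE.
Qed.

Lemma cl_integrable_bound F (h : T -> R) : cl_measurable F -> mu.-integrable D (EFin \o h) ->
  (forall x, cl_norm1 (F x) <= h x) -> cl_integrable mu D F.
Proof.
move=> mF hi Fh A; apply: (le_integrable mD _ _ hi).
  by apply/measurable_EFinP; apply: measurable_funTS; exact: mF.
move=> x _; rewrite /= lee_fin; apply: (le_trans (coef_le_norm1 _ _)).
exact: (le_trans (Fh x) (ler_norm _)).
Qed.

Lemma integrable_cl_norm1 F : cl_integrable mu D F ->
  mu.-integrable D (fun x => (cl_norm1 (F x))%:E).
Proof.
move=> Fi; rewrite /cl_norm1.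
have h A : mu.-integrable D (EFin \o (fun x => `|F x A|)) by have := integrable_norm (Fi A).
by case: (sum_ge0_integrable mD h).
Qed.

Lemma eq_cl_integral F G : (forall x, D x -> F x = G x) -> cl_integral mu D F = cl_integral mu D G.
Proof.
move=> FG; apply/ffunP => A; rewrite !ffunE; apply: eq_Rintegral => x; rewrite inE => /FG ->//.
Qed.

Lemma ae_eq_cl_integral F G : cl_measurable F -> cl_measurable G ->
  {ae mu, forall x, D x -> F x = G x} -> cl_integral mu D F = cl_integral mu D G.
Proof.
move=> mF mG FG; apply/ffunP => A; rewrite !ffunE /Rintegral; congr fine; apply: ae_eq_integral => //.
- by apply/measurable_EFinP; apply: measurable_funTS; exact: mF.
- by apply/measurable_EFinP; apply: measurable_funTS; exact: mG.
by apply: filterS FG => x h /h ->.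
Qed.

Lemma cl_integral_norm1 F : cl_integrable mu D F ->
  cl_norm1 (cl_integral mu D F) <= \int[mu]_(x in D) cl_norm1 (F x).
Proof.
move=> Fi; rewrite /cl_norm1.
have h A : mu.-integrable D (EFin \o (fun x => `|F x A|)) by have := integrable_norm (Fi A).
case: (sum_ge0_integrable mD h) => _ ->; apply: ler_sum => A _; rewrite ffunE.
apply: le_normr_Rintegral => //; exact: Fi.
Qed.

End CliffordIntegral.

Section CliffordLinearMaps.
Variables (R : realType) (n : nat).
Local Notation cl := (clifford R n).
Implicit Types (M N : cl).

Lemma cl_linear_mull M : cl_linear (fun N : cl => M * N).
Proof. by split=> *; rewrite ?mulrDr ?scalerAr. Qed.
Lemma cl_linear_mulr M : cl_linear (fun N : cl => N * M).
Proof. by split=> *; rewrite ?mulrDl ?scalerAl. Qed.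
Lemma cl_linear_reverse : cl_linear (@reverse R n).
Proof. by split=> *; rewrite ?reverseD ?reverseZ. Qed.
Lemma cl_linear_scale c : cl_linear (fun N : cl => c *: N).
Proof. by split=> *; rewrite ?scalerDr // !scalerA mulrC. Qed.
Lemma cl_linear_comp (L L' : cl -> cl) : cl_linear L -> cl_linear L' -> cl_linear (fun M => L (L' M)).
Proof. by move=> [a b] [c e]; split=> *; rewrite ?c ?e ?a ?b. Qed.
Lemma cl_linear_sub (L L' : cl -> cl) : cl_linear L -> cl_linear L' -> cl_linear (fun M => L M - L' M).
Proof.
move=> [a b] [c e]; split=> [M N|k M]; first by rewrite a c opprD addrACA.
by rewrite b e scalerBr.
Qed.
Lemma cl_linear_id : cl_linear (fun M : cl => M). Proof. by []. Qed.
Lemma cl_linear_twist s : cl_linear (@twist R n s).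
Proof.
apply: cl_linear_comp (cl_linear_scale _) (cl_linear_sub cl_linear_id _).
apply: cl_linear_comp (cl_linear_scale _) (cl_linear_comp (cl_linear_mulr _) (cl_linear_mull _)).
Qed.
End CliffordLinearMaps.

Section CliffordFubini.
Context d1 d2 (T1 : measurableType d1) (T2 : measurableType d2) (R : realType) (n : nat).
Variables (m1 : {sigma_finite_measure set T1 -> \bar R}) (m2 : {sigma_finite_measure set T2 -> \bar R}).
Implicit Types F : T1 -> T2 -> clifford R n.

Lemma cl_measurable_integral2 F : cl_measurable (fun p : T1 * T2 => F p.1 p.2) ->
  cl_measurable (fun x => cl_integral m2 setT (F x)).
Proof.
move=> mF A; under eq_fun do rewrite ffunE.
exact: (@measurable_Rintegral2 _ _ _ _ _ m2 (fun x y => F x y A)).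
Qed.

Lemma cl_integral_swap F :
  cl_integrable (m1 \x m2)%E setT (fun p : T1 * T2 => F p.1 p.2) ->
  cl_integral m1 setT (fun x => cl_integral m2 setT (F x)) =
  cl_integral m2 setT (fun y => cl_integral m1 setT (F^~ y)).
Proof.
move=> Fi; apply/ffunP => A; rewrite !ffunE.
under eq_Rintegral do rewrite ffunE.
under [RHS]eq_Rintegral do rewrite ffunE.
exact: (Rintegral_swap (Fi A)).
Qed.

Lemma cl_integrable_integral2 F :
  cl_integrable (m1 \x m2)%E setT (fun p : T1 * T2 => F p.1 p.2) ->
  cl_integrable m1 setT (fun x => cl_integral m2 setT (F x)).
Proof.
move=> Fi A; under eq_fun do rewrite ffunE.
exact: (integrable_Rintegral2 (Fi A)).
Qed.

End CliffordFubini.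

Section CliffordChange.
Context d (T : measurableType d) (R : realType) (n : nat) (mu : {measure set T -> \bar R}).
Variables (phi : T -> T) (c : R).
Hypotheses (c0 : 0 <= c) (hphi : scales_integral mu phi c).

Lemma scales_cl_integrable (F : T -> clifford R n) : cl_integrable mu setT F ->
  cl_integrable mu setT (fun x => F (phi x)).
Proof. by move=> Fi A; exact: (scales_integrable c0 hphi (Fi A)). Qed.

Lemma scales_cl_integral (F : T -> clifford R n) : cl_integrable mu setT F ->
  cl_integral mu setT (fun x => F (phi x)) = c *: cl_integral mu setT F.
Proof.
move=> Fi; apply/ffunP => A; rewrite cl_scaleE !ffunE.
exact: (scales_Rintegral hphi (Fi A)).
Qed.
End CliffordChange.

(** * Plancherel for Clifford-valued functions *)

Section CliffordPlancherel.
Variables (R : realType) (n : nat).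
Local Notation cl := (clifford R n).
Local Notation I := (pseudoscalar R n).
Local Notation V := 'cV[R]_n.
Local Notation dx := (lebesgue_cv (R := R) n).
Implicit Types (f g u : V -> cl) (w x : V).

Lemma cl_norm1_blade A : cl_norm1 (blade R A : cl) = 1.
Proof.
rewrite /cl_norm1 (bigD1 A) //= ffunE eqxx normr1 big1 ?addr0 // => B BA.
by rewrite ffunE (negPf BA) normr0.
Qed.

Lemma cl_norm1_phase (t : R) : cl_norm1 (phase n t) <= 2.
Proof.
apply: (le_trans (cl_norm1D _ _)); rewrite !cl_norm1Z -blade0 pseudoscalarE !cl_norm1_blade !mulr1.
by have := norm_cos_le1 t; have := norm_sin_le1 t; lra.
Qed.

Lemma cl_norm1_mul_phase (M : cl) (t : R) : cl_norm1 (M * phase n t) <= 2 * cl_norm1 M.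
Proof.
apply: (le_trans (cl_norm1M _ _)); rewrite mulrC ler_wpM2r ?cl_norm1_ge0 //.
exact: cl_norm1_phase.
Qed.

Lemma L1_norm1 f : L1 f -> dx.-integrable setT (fun x => (cl_norm1 (f x))%:E).
Proof. by move=> [_ fi]; exact: integrable_cl_norm1. Qed.

Lemma L2_integrable f : L2 f -> dx.-integrable setT (fun x => (cl_sqrnorm (f x))%:E).
Proof.
move=> [mf f2]; apply/integrableP; split.
  by apply/measurable_EFinP; exact: measurable_cl_sqrnorm.
by under eq_integral do rewrite /= ger0_norm ?cl_sqrnorm_ge0 //.
Qed.

Lemma L2_coef f A : L2 f -> dx.-integrable setT (fun x => (f x A ^+ 2)%:E).
Proof.
move=> f2; apply: (le_normr_integrable (g := fun x => cl_sqrnorm (f x))).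
- by apply: measurable_funX; exact: f2.1.
- exact: L2_integrable.
move=> x; rewrite !ger0_norm ?sqr_ge0 ?cl_sqrnorm_ge0 //; exact: sqr_coef_le.
Qed.

Lemma cl_integrable_phase f (t : V -> R) : measurable_fun setT t -> L1 f ->
  cl_integrable dx setT (fun x => f x * phase n (t x)).
Proof.
move=> mt f1; apply: (cl_integrable_bound measurableT (h := fun x => 2 * cl_norm1 (f x))).
- by apply: cl_measurableM; [exact: f1.1|exact: cl_measurable_phase].
- exact: (integrable_scaleR measurableT 2 (L1_norm1 f1)).
by move=> x; exact: cl_norm1_mul_phase.
Qed.

Lemma measurable_Ndot w : measurable_fun setT (fun x : V => - dot w x).
Proof. exact: (measurableT_comp (@oppr_measurable R setT) (measurable_dotl w)). Qed.

Hypothesis hn : (n %% 4 = 2 \/ n %% 4 = 3)%N.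

Lemma cftE f w : cft f w = cl_integral dx setT (fun x => f x * phase n (- dot w x)).
Proof. by apply: eq_cl_integral => x _; rewrite cl_exp_phase. Qed.

Definition cl_cos_transform f w : cl := [ffun A => cos_transform (f^~ A) w].
Definition cl_sin_transform f w : cl := [ffun A => sin_transform (f^~ A) w].

Lemma cft_trig f w : L1 f -> cft f w = cl_cos_transform f w - cl_sin_transform f w * I.
Proof.
move=> [mf fi]; rewrite cftE.
have ci : cl_integrable dx setT (fun x => cos (dot w x) *: f x).
  by move=> A; under eq_fun do rewrite cl_scaleE mulrC; exact: (integrable_cos w (fi A)).
have si : cl_integrable dx setT (fun x => sin (dot w x) *: f x).
  by move=> A; under eq_fun do rewrite cl_scaleE mulrC; exact: (integrable_sin w (fi A)).
have hI := cl_linear_mulr (- I).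
rewrite (eq_cl_integral dx (G := fun x => cos (dot w x) *: f x + (sin (dot w x) *: f x) * - I)); last first.
  move=> x _; rewrite /phase cosN sinN mulrDr -!scalerAr mulr1 scaleNr -scalerAl mulrN scalerN //.
rewrite cl_integralD //; last exact: (cl_integrable_linear measurableT hI si).
rewrite (cl_integral_linear measurableT hI si) mulrN; congr (_ - _ * I).
  apply/ffunP => A; rewrite !ffunE; apply: eq_Rintegral => x _; by rewrite cl_scaleE mulrC.
apply/ffunP => A; rewrite !ffunE; apply: eq_Rintegral => x _; by rewrite cl_scaleE mulrC.
Qed.

Lemma cft_trigN f w : L1 f -> cft f (- w) = cl_cos_transform f w + cl_sin_transform f w * I.
Proof.
move=> f1; rewrite cft_trig //.
have dN x : dot (- w) x = - dot w x.
  by rewrite /dot -sumrN; apply: eq_bigr => i _; rewrite mxE mulNr.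
have -> : cl_cos_transform f (- w) = cl_cos_transform f w.
  by apply/ffunP => A; rewrite !ffunE; apply: eq_Rintegral => x _; rewrite dN cosN.
have -> : cl_sin_transform f (- w) = - cl_sin_transform f w; last by rewrite mulNr opprK.
apply/ffunP => A; rewrite cl_oppE !ffunE -[RHS]mulN1r /sin_transform.
rewrite -RintegralZl //; last by exact: (integrable_sin w (f1.2 A)).
by apply: eq_Rintegral => x _; rewrite dN sinN mulrN mulN1r.
Qed.

Lemma cl_measurable_cft f : cl_measurable f -> cl_measurable (cft f).
Proof.
move=> mf; rewrite (_ : cft f = fun w => cl_integral dx setT (fun x => f x * phase n (- dot w x))).
  apply: (cl_measurable_integral2 dx (F := fun w x => f x * phase n (- dot w x))).
  apply: cl_measurableM; first exact: (cl_measurable_comp measurable_snd).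
  apply: cl_measurable_phase; exact: (measurableT_comp (@oppr_measurable R setT) (@measurable_dot R n)).
by apply/funext => w; exact: cftE.
Qed.

Lemma cl_sqrnorm_cft_le f w : L1 f ->
  cl_sqrnorm (cft f w) <= (2 * \int[dx]_x cl_norm1 (f x)) ^+ 2.
Proof.
move=> f1; apply: (le_trans (sqrnorm_le_norm1 _)).
have fi := cl_integrable_phase (measurable_Ndot w) f1.
have h : cl_norm1 (cft f w) <= 2 * \int[dx]_x cl_norm1 (f x).
  rewrite cftE; apply: (le_trans (cl_integral_norm1 measurableT fi)).
  rewrite -RintegralZl //; last exact: L1_norm1.
  apply: le_Rintegral => //; first exact: integrable_cl_norm1.
    exact: (integrable_scaleR measurableT 2 (L1_norm1 f1)).
  by move=> x _; exact: cl_norm1_mul_phase.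
by rewrite ler_sqr ?nnegrE ?cl_norm1_ge0 //; exact: (le_trans (cl_norm1_ge0 _) h).
Qed.

(* The cross term of [cft f w = c - s I] is odd in [w], so it cancels between [w] and [- w]. *)
Theorem cl_plancherel f : L1 f -> L2 f ->
  (\int[dx]_w (cl_sqrnorm (cft f w))%:E = ((2 * pi) ^+ n)%:E * \int[dx]_x (cl_sqrnorm (f x))%:E)%E.
Proof.
move=> f1 f2; have mf := f1.1.
have [F FE] : exists F : V -> R, forall w, cl_sqrnorm (cft f w) = F w by exists (fun w => cl_sqrnorm (cft f w)).
under eq_integral do rewrite FE.
have mF : measurable_fun setT F.
  by rewrite -(funext FE); exact: (measurable_cl_sqrnorm (cl_measurable_cft mf)).
have F0 w : 0 <= F w by rewrite -FE cl_sqrnorm_ge0.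
have mN : measurable_fun setT (fun w : V => - w).
  have := measurable_mx_scale (R := R) (m := n) (n := 1) (- 1).
  by under eq_fun do rewrite scaleN1r.
have reflect : (\int[dx]_w (F (- w))%:E = \int[dx]_w (F w)%:E)%E.
  have F0' w : (0 <= (F w)%:E)%E by rewrite lee_fin.
  have mF' : measurable_fun setT (fun w => (F w)%:E) by apply/measurable_EFinP.
  rewrite -[RHS](integral_reflect (0 : V) mF' F0'); apply: eq_integral => w _.
  by rewrite sub0r.
have trig w : F w + F (- w) =
    2 * \sum_A (cos_transform (f^~ A) w ^+ 2 + sin_transform (f^~ A) w ^+ 2).
  rewrite -!FE (cft_trigN w f1) (cft_trig w f1).
  have sq M N : cl_sqrnorm (M - N * I) + cl_sqrnorm (M + N * I) = 2 * \sum_A (M A ^+ 2 + N A ^+ 2).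
    rewrite cl_sqrnormB cl_sqrnormD (cl_sqrnorm_mulI hn N) big_split /= -(cl_sqrnormE M) -(cl_sqrnormE N); ring.
  rewrite sq; congr (_ * _); apply: eq_bigr => A _.
  by rewrite [cl_cos_transform f w A]ffunE [cl_sin_transform f w A]ffunE.
have twice : (2%:E * \int[dx]_w (F w)%:E =
    2%:E * (((2 * pi) ^+ n)%:E * \int[dx]_x (cl_sqrnorm (f x))%:E))%E.
  have two (X : \bar R) : (2%:E * X = X + X)%E by rewrite mule_natl mule2n.
  rewrite [LHS]two -{2}reflect -ge0_integralD //; last 4 first.
  - by move=> w _; rewrite lee_fin.
  - by apply/measurable_EFinP.
  - by move=> w _; rewrite lee_fin.
  - by apply/measurable_EFinP; exact: (measurableT_comp mF mN).
  have mcs A : measurable_fun setT (fun w => cos_transform (f^~ A) w ^+ 2 + sin_transform (f^~ A) w ^+ 2).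
    exact: (measurable_trig_transform (f1.2 A)).
  under eq_integral do rewrite -EFinD trig EFinM.
  have cs0 A w : 0 <= cos_transform (f^~ A) w ^+ 2 + sin_transform (f^~ A) w ^+ 2.
    by rewrite addr_ge0 ?sqr_ge0.
  rewrite ge0_integralZl_EFin //; last 2 first.
  - by move=> w _; rewrite lee_fin sumr_ge0.
  - by apply/measurable_EFinP; apply: measurable_sum => A.
  congr (_ * _)%E; under eq_integral do rewrite -sumEFin.
  rewrite ge0_integral_sum //; last 2 first.
  - by move=> A; apply/measurable_EFinP.
  - by move=> A w _; rewrite lee_fin.
  under eq_bigr => A _ do rewrite (scalar_plancherel (f1.2 A) (L2_coef A f2)).
  under [in RHS]eq_integral do rewrite cl_sqrnormE -sumEFin.
  rewrite ge0_integral_sum //; last 2 first.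
  - by move=> A; apply/measurable_EFinP; apply: measurable_funX; exact: mf.
  - by move=> A x _; rewrite lee_fin sqr_ge0.
  rewrite ge0_sume_distrr // => A _; apply: integral_ge0 => x _; by rewrite lee_fin sqr_ge0.
have := congr1 (fun z : \bar R => (2^-1)%:E * z)%E twice.
by rewrite !muleA -!EFinM mulVf // !mul1r mul1e.
Qed.

End CliffordPlancherel.

(** * Estimates in L2 *)

Section L2Tools.
Context d (T : measurableType d) (R : realType) (n : nat).
Variables (mu : {measure set T -> \bar R}) (D : set T).
Hypothesis mD : measurable D.
Local Notation cl := (clifford R n).
Implicit Types F G H : T -> cl.

Lemma cl_sqrnormD_le (M N : cl) : cl_sqrnorm (M + N) <= 2 * cl_sqrnorm M + 2 * cl_sqrnorm N.
Proof.
by have := cl_sqrnorm_ge0 (M - N); rewrite cl_sqrnormB cl_sqrnormD; lra.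
Qed.

Lemma measurable_sqrnormE F : cl_measurable F -> measurable_fun D (fun x => (cl_sqrnorm (F x))%:E).
Proof.
by move=> mF; apply/measurable_EFinP; apply: measurable_funTS; exact: measurable_cl_sqrnorm.
Qed.

Lemma integral_sqrnorm_ge0 F : (0 <= \int[mu]_(x in D) (cl_sqrnorm (F x))%:E)%E.
Proof. by apply: integral_ge0 => x _; rewrite lee_fin cl_sqrnorm_ge0. Qed.

Lemma integral_sqrnorm_lin2 F G H (a b : R) : cl_measurable F -> cl_measurable G -> cl_measurable H ->
  0 <= a -> 0 <= b ->
  (forall x, cl_sqrnorm (H x) <= a * cl_sqrnorm (F x) + b * cl_sqrnorm (G x)) ->
  (\int[mu]_(x in D) (cl_sqrnorm (H x))%:E <=
   a%:E * \int[mu]_(x in D) (cl_sqrnorm (F x))%:E + b%:E * \int[mu]_(x in D) (cl_sqrnorm (G x))%:E)%E.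
Proof.
move=> mF mG mH a0 b0 h; apply: integral_le_lin2 => //; try (by move=> x; exact: cl_sqrnorm_ge0);
  by apply: measurable_funTS; exact: measurable_cl_sqrnorm.
Qed.

Lemma integral_sqrnorm_scale F H (a : R) : cl_measurable F -> cl_measurable H -> 0 <= a ->
  (forall x, D x -> cl_sqrnorm (H x) <= a * cl_sqrnorm (F x)) ->
  (\int[mu]_(x in D) (cl_sqrnorm (H x))%:E <= a%:E * \int[mu]_(x in D) (cl_sqrnorm (F x))%:E)%E.
Proof.
move=> mF mH a0 h; rewrite -ge0_integralZl_EFin //; last 2 first.
- by move=> x _; rewrite lee_fin cl_sqrnorm_ge0.
- exact: measurable_sqrnormE.
apply: ge0_le_integral => //.
- by move=> x _; rewrite lee_fin cl_sqrnorm_ge0.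
- exact: measurable_sqrnormE.
- by apply: measurable_funeM; exact: measurable_sqrnormE.
Qed.

(** Continuity of the squared norm under L2 convergence. The quasi-triangle inequality with a free
    parameter t > 0, used in both directions, stands in for Minkowski's inequality. *)
Lemma cvg_integral_sqrnorm (F : nat -> T -> cl) G : (forall k, cl_measurable (F k)) -> cl_measurable G ->
  (\int[mu]_(x in D) (cl_sqrnorm (G x))%:E < +oo)%E ->
  (\int[mu]_(x in D) (cl_sqrnorm (F k x - G x))%:E)%E @[k --> \oo] --> 0%E ->
  (\int[mu]_(x in D) (cl_sqrnorm (F k x))%:E)%E @[k --> \oo] -->
  (\int[mu]_(x in D) (cl_sqrnorm (G x))%:E)%E.
Proof.
move=> mF mG Goo FG; have mFG k := cl_measurableB (mF k) mG.
apply: (cvge_quasi _ _ _ _ _ _ FG) => //; try (by move=> *; exact: integral_sqrnorm_ge0).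
- move=> t k t0; apply: integral_sqrnorm_lin2 => //; rewrite ?addr_ge0 ?invr_ge0 //; try exact: ltW.
  by move=> x; exact: cl_sqrnorm_quasi.
move=> t k t0; apply: integral_sqrnorm_lin2 => //; rewrite ?addr_ge0 ?invr_ge0 //; try exact: ltW.
by move=> x; rewrite -(cl_sqrnormN (F k x - G x)) opprB; exact: cl_sqrnorm_quasi.
Qed.

End L2Tools.

(* [2 c a v <= a v^2 + c^2 a] is integrated for the optimal constant [c]. *)
Lemma weighted_cauchy_schwarz d (T : measurableType d) (R : realType) (mu : {measure set T -> \bar R}) (a v : T -> R) :
  (forall x, 0 <= a x) -> (forall x, 0 <= v x) ->
  mu.-integrable setT (EFin \o a) -> measurable_fun setT v ->
  mu.-integrable setT (fun x => (a x * v x)%:E) ->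
  (((\int[mu]_x (a x * v x)) ^+ 2)%:E <=
   (\int[mu]_x a x + 1)%:E * \int[mu]_x (a x * v x ^+ 2)%:E)%E.
Proof.
move=> a0 v0 ai mv avi; set X := \int[mu]_x _; set m := \int[mu]_x a x; set J := (\int[mu]_x _)%E.
have ma : measurable_fun setT a by apply/measurable_EFinP; exact: measurable_int ai.
have X0 : 0 <= X by apply: Rintegral_ge0 => x _; rewrite mulr_ge0.
have m0 : 0 <= m by apply: Rintegral_ge0 => x _.
have J0 : (0 <= J)%E by apply: integral_ge0 => x _; rewrite lee_fin mulr_ge0 // sqr_ge0.
have m1 : 0 < m + 1 by rewrite ltr_pwDr.
(* Dividing by m + 1 rather than m keeps the quotient meaningful when the weight integrates to 0;
   the price is the [+ 1] in the conclusion. *)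
set c := X / (m + 1); have c0 : 0 <= c by rewrite divr_ge0 // ltW.
have : ((2 * c * X)%:E <= 1%:E * J + (c ^+ 2)%:E * m%:E)%E.
  have -> : ((2 * c * X)%:E = \int[mu]_x (2 * c * (a x * v x))%:E)%E.
    have -> : ((2 * c * X)%:E = (2 * c)%:E * \int[mu]_x (a x * v x)%:E)%E.
      by rewrite EFinM /X /Rintegral fineK // integrable_fin_num.
    have c2 : 0 <= 2 * c by exact: mulr_ge0.
    rewrite -ge0_integralZl_EFin //.
    - by move=> x _; rewrite lee_fin mulr_ge0.
    - exact: measurable_int avi.
  have -> : (m%:E = \int[mu]_x (a x)%:E)%E by rewrite /m /Rintegral fineK // integrable_fin_num.
  apply: integral_le_lin2 => //.
  - by apply: measurable_funM => //; apply: measurable_funX.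
  - by apply: measurable_funM => //; apply: measurable_funM.
  - exact: sqr_ge0.
  - by move=> x; rewrite mulr_ge0 // sqr_ge0.
  - by move=> x; apply: mulr_ge0; exact: mulr_ge0.
  move=> x; have := mulr_ge0 (a0 x) (sqr_ge0 (v x - c)); lra.
case: J J0 => [J| |//] J0; last by move=> _; rewrite gt0_muley ?lte_fin // leey.
rewrite -!EFinM -EFinD !lee_fin mul1r => h.
have E : X = c * (m + 1) by rewrite /c divfK // gt_eqF.
have : c * X <= J.
  have : c ^+ 2 * m <= c * X by rewrite E expr2 -mulrA ler_wpM2l // ler_wpM2l // lerDl.
  lra.
move=> h2; have -> : X ^+ 2 = (m + 1) * (c * X) by rewrite expr2 {1}E mulrAC mulrC.
by rewrite ler_pM2l.
Qed.

Lemma lin2_lty (R : realType) (a c : R) (X Y : \bar R) : 0 <= a -> 0 <= c ->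
  (X < +oo)%E -> (Y < +oo)%E -> (a%:E * X + c%:E * Y < +oo)%E.
Proof. by move=> a0 c0 Xoo Yoo; apply: lte_add_pinfty; apply: lte_mul_pinfty. Qed.

(** * Correlation *)

Section Convolution.
Variables (R : realType) (n : nat).
Local Notation cl := (clifford R n).
Local Notation I := (pseudoscalar R n).
Local Notation V := 'cV[R]_n.
Local Notation dx := (lebesgue_cv (R := R) n).
Implicit Types (f g u : V -> cl) (w x b : V).

Lemma L2_lin2 f g (h : V -> cl) (a c : R) : cl_measurable h -> 0 <= a -> 0 <= c -> L2 f -> L2 g ->
  (forall x, cl_sqrnorm (h x) <= a * cl_sqrnorm (f x) + c * cl_sqrnorm (g x)) -> L2 h.
Proof.
move=> mh a0 c0 [mf f2] [mg g2] hh; split; first exact: mh.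
apply: le_lt_trans; first exact: (integral_sqrnorm_lin2 dx measurableT mf mg mh a0 c0 hh).
exact: (lin2_lty a0 c0 f2 g2).
Qed.

Lemma L2_scale f (h : V -> cl) (a : R) : cl_measurable h -> 0 <= a -> L2 f ->
  (forall x, cl_sqrnorm (h x) <= a * cl_sqrnorm (f x)) -> L2 h.
Proof.
move=> mh a0 f2 hh; apply: (L2_lin2 mh a0 (lexx 0) f2 f2) => x.
by rewrite mul0r addr0.
Qed.

Lemma L2B f g : L2 f -> L2 g -> L2 (fun x => f x - g x).
Proof.
move=> f2 g2; apply: (L2_lin2 (a := 2) (c := 2) _ _ _ f2 g2) => //.
  by apply: cl_measurableB; [exact: f2.1|exact: g2.1].
by move=> x; rewrite -(cl_sqrnormN (g x)); exact: cl_sqrnormD_le.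
Qed.

Lemma L2D f g : L2 f -> L2 g -> L2 (fun x => f x + g x).
Proof.
move=> f2 g2; apply: (L2_lin2 (a := 2) (c := 2) _ _ _ f2 g2) => //.
  by apply: cl_measurableD; [exact: f2.1|exact: g2.1].
by move=> x; exact: cl_sqrnormD_le.
Qed.

Lemma L2_mulr f M : L2 f -> L2 (fun x => f x * M).
Proof.
move=> f2; apply: (L2_scale (a := cl_dim R n ^+ 2 * cl_sqrnorm M) _ _ f2).
- by apply: cl_measurableM; [exact: f2.1|exact: cl_measurable_cst].
- by rewrite mulr_ge0 ?sqr_ge0 ?cl_sqrnorm_ge0.
by move=> x; apply: (le_trans (cl_sqrnormM _ _)); rewrite [X in _ * X <= _]mulrC mulrA.
Qed.

Lemma L2_mull f M : L2 f -> L2 (fun x => M * f x).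
Proof.
move=> f2; apply: (L2_scale (a := cl_dim R n ^+ 2 * cl_sqrnorm M) _ _ f2).
- by apply: cl_measurableM; [exact: cl_measurable_cst|exact: f2.1].
- by rewrite mulr_ge0 ?sqr_ge0 ?cl_sqrnorm_ge0.
by move=> x; apply: (le_trans (cl_sqrnormM _ _)); rewrite mulrA.
Qed.

Lemma L1_linear f L : cl_linear L -> cl_measurable (fun x => L (f x)) -> L1 f -> L1 (fun x => L (f x)).
Proof. by move=> hL mL [mf fi]; split=> //; exact: cl_integrable_linear. Qed.

Lemma L1D f g : L1 f -> L1 g -> L1 (fun x => f x + g x).
Proof.
by move=> [mf fi] [mg gi]; split; [exact: cl_measurableD|exact: cl_integrableD].
Qed.

Lemma L1N f : L1 f -> L1 (fun x => - f x).
Proof.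
move=> f1; have hL : cl_linear (fun M : cl => - M).
  by split=> [M N|c M]; rewrite ?opprD ?scalerN.
by apply: (L1_linear hL) => //; apply: cl_measurableN; exact: f1.1.
Qed.

Lemma measurable_sub2 : measurable_fun setT (fun p : V * V => p.2 - p.1).
Proof.
have -> : (fun p : V * V => p.2 - p.1) = (fun p => p.1 + p.2) \o (fun p : V * V => (p.2, -1 *: p.1)).
  by apply/funext => p /=; rewrite scaleN1r.
apply: (measurableT_comp (@measurable_mx_add R n 1)); apply/measurable_fun_pairP; split => /=.
  exact: measurable_snd.
exact: (measurableT_comp (@measurable_mx_scale R n 1 (- 1)) measurable_fst).
Qed.

Lemma measurable_subr b : measurable_fun setT (fun x : V => x - b).
Proof. exact: measurable_mx_addr. Qed.

Lemma integral_shift_sqrnorm u b : cl_measurable u ->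
  (\int[dx]_x (cl_sqrnorm (u (x - b)%R))%:E = \int[dx]_x (cl_sqrnorm (u x))%:E)%E.
Proof.
move=> mu; have := @integral_translate R n (- b) (fun x => (cl_sqrnorm (u x))%:E).
by apply=> [|x]; [exact: measurable_sqrnormE|rewrite lee_fin cl_sqrnorm_ge0].
Qed.

Lemma L2_shift u b : L2 u -> L2 (fun x => u (x - b)).
Proof.
move=> [mu u2]; split; first exact: (cl_measurable_comp (measurable_subr b)).
by rewrite integral_shift_sqrnorm.
Qed.

Lemma cl_integrable_mul_reverse f g : L2 f -> L2 g ->
  cl_integrable dx setT (fun x => f x * reverse (g x)).
Proof.
move=> f2 g2.
apply: (cl_integrable_bound measurableT (h := fun x => cl_dim R n * (cl_sqrnorm (f x) + cl_sqrnorm (g x)))).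
- by apply: cl_measurableM; [exact: f2.1|apply: cl_measurable_reverse; exact: g2.1].
- apply: (integrable_scaleR measurableT); apply: (integrable_addR measurableT); exact: L2_integrable.
move=> x; apply: (le_trans (cl_norm1M _ _)); rewrite cl_norm1_reverse; exact: cl_norm1_prod_le.
Qed.

Definition cl_conv f u b : cl := cl_integral dx setT (fun x => f x * reverse (u (x - b))).

Lemma cl_measurable_conv f u : cl_measurable f -> cl_measurable u -> cl_measurable (cl_conv f u).
Proof.
move=> mf mu; apply: (cl_measurable_integral2 dx (F := fun b x => f x * reverse (u (x - b)))).
apply: cl_measurableM; first exact: (cl_measurable_comp measurable_snd).
by apply: cl_measurable_reverse; exact: (cl_measurable_comp measurable_sub2).
Qed.

(** Tonelli with [b] integrated first: b |-> x - b preserves Lebesgue measure, so the inner integral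
    is the norm of f(x) times the L1 norm of [u]. *)
Lemma integrable_conv_norm1 f u : L1 f -> L1 u ->
  (dx \x dx)%E.-integrable setT (fun p : V * V => (cl_norm1 (f p.2) * cl_norm1 (u (p.2 - p.1)))%:E).
Proof.
move=> f1 u1; have mF := measurable_cl_norm1 f1.1; have mU := measurable_cl_norm1 u1.1.
have mFU : measurable_fun setT (fun p : V * V => cl_norm1 (f p.2) * cl_norm1 (u (p.2 - p.1))).
  apply: measurable_funM; first exact: (measurableT_comp mF measurable_snd).
  exact: (measurableT_comp mU measurable_sub2).
apply: (integrable_prod21 (f := fun b x => cl_norm1 (f x) * cl_norm1 (u (x - b)))) => //.
have mUE : measurable_fun setT (fun x => (cl_norm1 (u x))%:E) by apply/measurable_EFinP.
have fin g : L1 g -> exists2 m : R, 0 <= m & (\int[dx]_x (cl_norm1 (g x))%:E = m%:E)%E.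
  move=> g1; have /integrableP[_] := L1_norm1 g1.
  under eq_integral do rewrite /= ger0_norm ?cl_norm1_ge0 //.
  move=> goo; exists (fine (\int[dx]_x (cl_norm1 (g x))%:E)%E).
    by apply/fine_ge0/integral_ge0 => x _; rewrite lee_fin cl_norm1_ge0.
  rewrite fineK // ge0_fin_numE //.
  by apply: integral_ge0 => x _; rewrite lee_fin cl_norm1_ge0.
have [mu mu0 Emu] := fin _ u1; have [mf mf0 Emf] := fin _ f1.
have E x : (\int[dx]_b `|cl_norm1 (f x) * cl_norm1 (u (x - b))|%:E = (mu * cl_norm1 (f x))%:E)%E.
  transitivity ((cl_norm1 (f x))%:E * \int[dx]_b (cl_norm1 (u (x - b)%R))%:E)%E.
    rewrite -ge0_integralZl_EFin ?cl_norm1_ge0 //.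
    - by apply: eq_integral => b _; rewrite ger0_norm ?mulr_ge0 ?cl_norm1_ge0 // EFinM.
    - by move=> b _; rewrite lee_fin cl_norm1_ge0.
    - have := measurable_mx_scale (R := R) (m := n) (n := 1) (- 1) => mN.
      apply/measurable_EFinP; apply: (measurableT_comp mU).
      have -> : (fun b : V => x - b) = (fun b => b + x) \o (fun b : V => -1 *: b).
        by apply/funext => b /=; rewrite scaleN1r addrC.
      exact: (measurableT_comp (@measurable_mx_addr R n 1 x) mN).
  rewrite (@integral_reflect R n x (fun y => (cl_norm1 (u y))%:E)) //; last first.
    by move=> y; rewrite lee_fin cl_norm1_ge0.
  by rewrite Emu mulrC.
under eq_integral do rewrite E EFinM.
rewrite ge0_integralZl_EFin //.
- by rewrite Emf -EFinM ltry.
- by move=> x _; rewrite lee_fin cl_norm1_ge0.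
- by apply/measurable_EFinP.
Qed.

Lemma cl_integrable_conv_phase f u (t : V -> R) : measurable_fun setT t -> L1 f -> L1 u ->
  cl_integrable (dx \x dx)%E setT
    (fun p : V * V => f p.2 * reverse (u (p.2 - p.1)) * phase n (t p.1)).
Proof.
move=> mt f1 u1.
apply: (cl_integrable_bound measurableT (h := fun p : V * V => 2 * (cl_norm1 (f p.2) * cl_norm1 (u (p.2 - p.1))))).
- apply: cl_measurableM.
    apply: cl_measurableM; first exact: (cl_measurable_comp measurable_snd f1.1).
    by apply: cl_measurable_reverse; exact: (cl_measurable_comp measurable_sub2 u1.1).
  by apply: cl_measurable_phase; exact: (measurableT_comp mt measurable_fst).
- exact: (integrable_scaleR measurableT 2 (integrable_conv_norm1 f1 u1)).
move=> p; apply: (le_trans (cl_norm1_mul_phase _ _)); rewrite ler_pM2l //.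
by apply: (le_trans (cl_norm1M _ _)); rewrite cl_norm1_reverse.
Qed.

Lemma phase0 : phase n (0 : R) = 1.
Proof. by rewrite /phase cos0 sin0 scale0r addr0 scale1r. Qed.

Lemma L1_conv f u : L1 f -> L1 u -> L1 (cl_conv f u).
Proof.
move=> f1 u1; split; first by apply: cl_measurable_conv; [exact: f1.1|exact: u1.1].
have m0 : measurable_fun setT (fun _ : V => 0 : R) by exact: measurable_cst.
have h := cl_integrable_conv_phase m0 f1 u1.
have {}h : cl_integrable (dx \x dx)%E setT (fun p : V * V => f p.2 * reverse (u (p.2 - p.1))).
  by have := h; under eq_fun do rewrite phase0 mulr1.
exact: (cl_integrable_integral2 (F := fun b x => f x * reverse (u (x - b))) h).
Qed.

Lemma cl_norm1_conv_le f u b : L2 f -> L2 u ->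
  cl_norm1 (cl_conv f u b) <= cl_dim R n * (\int[dx]_x cl_sqrnorm (f x) + \int[dx]_x cl_sqrnorm (u x)).
Proof.
move=> f2 u2; have fu := cl_integrable_mul_reverse f2 (L2_shift b u2).
have uE : \int[dx]_x cl_sqrnorm (u x) = \int[dx]_x cl_sqrnorm (u (x - b)).
  by rewrite /Rintegral integral_shift_sqrnorm //; exact: u2.1.
apply: (le_trans (cl_integral_norm1 measurableT fu)); rewrite uE.
have i1 := L2_integrable f2; have i2 := L2_integrable (L2_shift b u2).
rewrite -(RintegralD measurableT i1 i2) -(RintegralZl _ measurableT (integrable_addR measurableT i1 i2)).
apply: le_Rintegral.
- exact: measurableT.
- exact: (integrable_cl_norm1 measurableT fu).
- exact: (integrable_scaleR measurableT _ (integrable_addR measurableT i1 i2)).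
move=> x _; apply: (le_trans (cl_norm1M _ _)); rewrite cl_norm1_reverse; exact: cl_norm1_prod_le.
Qed.

(** The correlation is integrable and bounded by some [B], so its squared norm is at most [B] times
    its norm. *)
Lemma L2_conv f u : L1 f -> L2 f -> L1 u -> L2 u -> L2 (cl_conv f u).
Proof.
move=> f1 f2 u1 u2; have c1 := L1_conv f1 u1; split; first exact: c1.1.
set B := cl_dim R n * (\int[dx]_x cl_sqrnorm (f x) + \int[dx]_x cl_sqrnorm (u x)).
have Bc b : cl_norm1 (cl_conv f u b) <= B by exact: cl_norm1_conv_le.
have i := integrable_scaleR measurableT B (L1_norm1 c1).
have : dx.-integrable setT (EFin \o (fun b => cl_sqrnorm (cl_conv f u b))).
  apply: (le_normr_integrable _ i); first by apply: measurable_cl_sqrnorm; exact: c1.1.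
  move=> b; have c0 := cl_norm1_ge0 (cl_conv f u b); have B0 := le_trans c0 (Bc b).
  rewrite ger0_norm ?cl_sqrnorm_ge0 // (ger0_norm (mulr_ge0 B0 c0)).
  by apply: (le_trans (sqrnorm_le_norm1 _)); rewrite expr2 ler_wpM2r.
move=> /integrableP[_]; by under eq_integral do rewrite /= ger0_norm ?cl_sqrnorm_ge0 //.
Qed.

End Convolution.

Section ConvolutionPlancherel.
Variables (R : realType) (n : nat).
Local Notation cl := (clifford R n).
Local Notation I := (pseudoscalar R n).
Local Notation V := 'cV[R]_n.
Local Notation dx := (lebesgue_cv (R := R) n).
Implicit Types (f g u : V -> cl) (w x b : V).

Lemma measurable_reflect x : measurable_fun setT (fun b : V => x - b).
Proof.
have -> : (fun b : V => x - b) = (fun b => b + x) \o (fun b : V => -1 *: b).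
  by apply/funext => b /=; rewrite scaleN1r addrC.
exact: (measurableT_comp (@measurable_mx_addr R n 1 x) (@measurable_mx_scale R n 1 (- 1))).
Qed.

Lemma scales_reflect x : scales_integral dx (fun b : V => x - b) 1.
Proof.
split; first exact: measurable_reflect.
by move=> F mF F0; rewrite (integral_reflect x mF F0) mul1e.
Qed.

Lemma cl_linear_opp : cl_linear (fun M : cl => - M).
Proof. by split=> [M N|c M]; rewrite ?opprD ?scalerN. Qed.

Lemma cl_integralB d (T : measurableType d) (mu : {measure set T -> \bar R}) (D : set T) (F G : T -> cl) :
  measurable D -> cl_integrable mu D F -> cl_integrable mu D G ->
  cl_integral mu D (fun x : T => F x - G x) = cl_integral mu D F - cl_integral mu D G.
Proof.
move=> mD Fi Gi; rewrite cl_integralD //; last exact: (cl_integrable_linear mD cl_linear_opp Gi).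
by rewrite (cl_integral_linear mD cl_linear_opp Gi).
Qed.

Lemma convB f u (v : V -> cl) b : L2 f -> L2 u -> L2 v ->
  cl_conv f (fun x => u x - v x) b = cl_conv f u b - cl_conv f v b.
Proof.
move=> f2 u2 v2; rewrite /cl_conv -cl_integralB //; last 2 first.
- exact: (cl_integrable_mul_reverse f2 (L2_shift b u2)).
- exact: (cl_integrable_mul_reverse f2 (L2_shift b v2)).
by apply: eq_cl_integral => x _; rewrite reverseB mulrBr.
Qed.

(** Young's inequality for L1 against L2: Cauchy-Schwarz with weight |f|, then Tonelli. Since the
    constant depends on [f] alone, correlation with a fixed [f] is continuous in [u] for the L2
    norm. *)
Lemma young_conv f : L1 f -> L2 f -> exists2 K : R, 0 <= K & forall u, L2 u ->
  (\int[dx]_b (cl_sqrnorm (cl_conv f u b))%:E <= K%:E * \int[dx]_x (cl_sqrnorm (u x))%:E)%E.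
Proof.
move=> f1 f2; have fi := L1_norm1 f1.
set m := \int[dx]_x cl_norm1 (f x).
have m0 : 0 <= m by apply: Rintegral_ge0 => x _; exact: cl_norm1_ge0.
have m1 : 0 <= m + 1 by rewrite addr_ge0.
have mE : (\int[dx]_x (cl_norm1 (f x))%:E = m%:E)%E.
  by rewrite /m /Rintegral fineK // integrable_fin_num.
have ma := measurable_cl_norm1 f1.1.
exists ((m + 1) * (cl_dim R n * m)); first by rewrite !mulr_ge0 ?cl_dim_ge0.
move=> u u2; have mv := measurable_cl_norm1 u2.1.
pose J b := (\int[dx]_x (cl_norm1 (f x) * cl_norm1 (u (x - b)%R) ^+ 2)%:E)%E.
have mFJ : measurable_fun setT (fun p : V * V => cl_norm1 (f p.2) * cl_norm1 (u (p.2 - p.1)%R) ^+ 2).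
  apply: measurable_funM; first exact: (measurableT_comp ma measurable_snd).
  by apply: measurable_funX; exact: (measurableT_comp mv (@measurable_sub2 R n)).
have J0 b : (0 <= J b)%E.
  by apply: integral_ge0 => x _; rewrite lee_fin mulr_ge0 ?sqr_ge0 ?cl_norm1_ge0.
have mJ : measurable_fun setT J.
  have m2 : measurable_fun setT (fun p : V * V => (cl_norm1 (f p.2) * cl_norm1 (u (p.2 - p.1)%R) ^+ 2)%:E).
    by apply/measurable_EFinP.
  apply: (measurable_fun_fubini_tonelli_F (m2 := dx) _ m2) => p.
  by rewrite lee_fin mulr_ge0 ?sqr_ge0 ?cl_norm1_ge0.
have cJ b : ((cl_sqrnorm (cl_conv f u b))%:E <= (m + 1)%:E * J b)%E.
  have ub := L2_shift b u2.
  have fub := cl_integrable_mul_reverse f2 ub.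
  have avi : dx.-integrable setT (fun x => (cl_norm1 (f x) * cl_norm1 (u (x - b)))%:E).
    have gi := integrable_scaleR measurableT (cl_dim R n)
       (integrable_addR measurableT (L2_integrable f2) (L2_integrable ub)).
    apply: (le_normr_integrable _ gi).
      by apply: measurable_funM => //; apply: measurable_cl_norm1; exact: ub.1.
    move=> x; have h := cl_norm1_prod_le (f x) (u (x - b)).
    rewrite ger0_norm; last by rewrite mulr_ge0 ?cl_norm1_ge0.
    exact: (le_trans h (ler_norm _)).
  have mub : measurable_fun setT (fun x => cl_norm1 (u (x - b))) by apply: measurable_cl_norm1; exact: ub.1.
  have cs := weighted_cauchy_schwarz (fun x => cl_norm1_ge0 (f x)) (fun x => cl_norm1_ge0 (u (x - b))) fi mub avi.
  apply: (le_trans _ cs); rewrite lee_fin; apply: (le_trans (sqrnorm_le_norm1 _)).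
  have X0 : 0 <= \int[dx]_x (cl_norm1 (f x) * cl_norm1 (u (x - b))).
    by apply: Rintegral_ge0 => x _; rewrite mulr_ge0 ?cl_norm1_ge0.
  have h : cl_norm1 (cl_conv f u b) <= \int[dx]_x (cl_norm1 (f x) * cl_norm1 (u (x - b))).
    apply: (le_trans (cl_integral_norm1 measurableT fub)); apply: le_Rintegral.
    - exact: measurableT.
    - exact: (integrable_cl_norm1 measurableT fub).
    - exact: avi.
    by move=> x _; apply: (le_trans (cl_norm1M _ _)); rewrite cl_norm1_reverse.
  by rewrite ler_sqr ?nnegrE ?cl_norm1_ge0.
have mc := cl_measurable_conv f1.1 u2.1.
apply: (@le_trans _ _ (\int[dx]_b ((m + 1)%:E * J b))%E).
  apply: ge0_le_integral.
  - exact: measurableT.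
  - by move=> b _; rewrite lee_fin cl_sqrnorm_ge0.
  - exact: measurable_sqrnormE.
  - exact: (measurable_funeM _ mJ).
  - by move=> b _; exact: cJ.
rewrite (ge0_integralZl_EFin dx measurableT (fun b _ => J0 b) mJ m1) EFinM -muleA.
apply: lee_wpmul2l; first by rewrite lee_fin.
have mf2 : measurable_fun setT (fun p : V * V => (cl_norm1 (f p.2) * cl_norm1 (u (p.2 - p.1)%R) ^+ 2)%:E).
  by apply/measurable_EFinP.
rewrite /J (tonelli (fun b x => (cl_norm1 (f x) * cl_norm1 (u (x - b)%R) ^+ 2)%:E) mf2); last first.
  by move=> b x; rewrite lee_fin mulr_ge0 ?sqr_ge0 ?cl_norm1_ge0.
have v20 y : (0 <= (cl_norm1 (u y) ^+ 2)%:E)%E by rewrite lee_fin sqr_ge0.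
have mv2 : measurable_fun setT (fun y => (cl_norm1 (u y) ^+ 2)%:E).
  by apply/measurable_EFinP; exact: measurable_funX.
set W := (\int[dx]_y (cl_norm1 (u y) ^+ 2)%:E)%E.
have W0 : (0 <= W)%E by apply: integral_ge0 => y _; exact: v20.
have E x : (\int[dx]_b (cl_norm1 (f x) * cl_norm1 (u (x - b)%R) ^+ 2)%:E = (cl_norm1 (f x))%:E * W)%E.
  rewrite /W -(integral_reflect x mv2 v20) -ge0_integralZl_EFin ?cl_norm1_ge0 //.
  exact: (measurableT_comp mv2 (measurable_reflect x)).
under eq_integral do rewrite E.
have mEa : measurable_fun setT (fun x => (cl_norm1 (f x))%:E) by apply/measurable_EFinP.
have a0 x : setT x -> (0 <= (cl_norm1 (f x))%:E)%E by move=> _; rewrite lee_fin cl_norm1_ge0.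
rewrite (ge0_integralZr dx measurableT mEa a0 W0) mE [(cl_dim R n * m)%R]mulrC EFinM -muleA.
apply: lee_wpmul2l; first by rewrite lee_fin.
have us0 y : setT y -> (0 <= (cl_sqrnorm (u y))%:E)%E by move=> _; rewrite lee_fin cl_sqrnorm_ge0.
have mus := measurable_sqrnormE (D := setT) u2.1.
rewrite -(ge0_integralZl_EFin dx measurableT us0 mus (cl_dim_ge0 R n)).
apply: ge0_le_integral.
- exact: measurableT.
- by move=> y _; exact: v20.
- exact: mv2.
- exact: (measurable_funeM _ mus).
- by move=> y _; rewrite -EFinM lee_fin; exact: cl_norm1_sqr.
Qed.

Hypothesis hn : (n %% 4 = 2 \/ n %% 4 = 3)%N.

Lemma dotZl (s : R) w x : dot (s *: w) x = s * dot w x.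
Proof. by rewrite /dot mulr_sumr; apply: eq_bigr => i _; rewrite mxE mulrA. Qed.

Lemma cftB f g w : L1 f -> L1 g -> cft (fun x => f x - g x) w = cft f w - cft g w.
Proof.
move=> f1 g1; rewrite !cftE // -cl_integralB //.
- by apply: eq_cl_integral => x _; rewrite mulrBl.
- exact: (cl_integrable_phase (measurable_Ndot w) f1).
- exact: (cl_integrable_phase (measurable_Ndot w) g1).
Qed.

Lemma cft_linear_comm (L : cl -> cl) f w : cl_linear L -> (forall M t, L (M * phase n t) = L M * phase n t) ->
  L1 f -> cft (fun x => L (f x)) w = L (cft f w).
Proof.
move=> hL Lp f1; rewrite !cftE // -(cl_integral_linear measurableT hL); last first.
  exact: (cl_integrable_phase (measurable_Ndot w) f1).
by apply: eq_cl_integral => x _; rewrite Lp.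
Qed.

(** For fixed x the substitution y = x - b splits the phase into one part at x and one at y. The
    phase has to cross the reversed value of [u], and this crossing turns the frequency w into s
    w. *)
Lemma cft_conv (s : R) f u w : s = 1 \/ s = -1 -> (forall x, twisted s (u x)) ->
  L1 f -> L2 f -> L1 u -> L2 u ->
  cft (cl_conv f u) w = cft f (s *: w) * reverse (cft u (s *: w)).
Proof.
move=> hs ut f1 f2 u1 u2; rewrite cftE //.
pose F b x := f x * reverse (u (x - b)) * phase n (- dot w b).
have Fi : cl_integrable (dx \x dx)%E setT (fun p : V * V => F p.1 p.2).
  exact: (cl_integrable_conv_phase (measurable_Ndot w) f1 u1).
transitivity (cl_integral dx setT (fun b => cl_integral dx setT (F b))).
  apply: eq_cl_integral => b _; rewrite /F -(cl_integral_linear measurableT (cl_linear_mulr _)) //.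
  exact: (cl_integrable_mul_reverse f2 (L2_shift b u2)).
rewrite (cl_integral_swap Fi).
have ui : cl_integrable dx setT (fun y => u y * phase n (- dot (s *: w) y)).
  exact: (cl_integrable_phase (measurable_Ndot _) u1).
have fi : cl_integrable dx setT (fun x => f x * phase n (- dot (s *: w) x)).
  exact: (cl_integrable_phase (measurable_Ndot _) f1).
have inner_b x : cl_integral dx setT (F^~ x) =
    f x * phase n (- dot (s *: w) x) * reverse (cft u (s *: w)).
  rewrite (cftE hn) -(cl_integral_linear measurableT (@cl_linear_reverse R n) ui).
  have rui := cl_integrable_linear measurableT (@cl_linear_reverse R n) ui.
  rewrite -(cl_integral_linear measurableT (cl_linear_mull _) rui).
  have G1 := cl_integrable_linear measurableT (cl_linear_mull (f x * phase n (- dot (s *: w) x))) rui.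
  rewrite -[RHS]scale1r -(scales_cl_integral (scales_reflect x) G1).
  apply: eq_cl_integral => b _; rewrite /F reverseM (reverse_phase hn) opprK.
  rewrite -!mulrA; congr (_ * _).
  (* The reverse of a twisted multivector is twisted with the same sign, so the phase moves to its
     left. *)
  rewrite (twisted_phase _ hs); last exact: (twisted_reverse hn hs (ut _)).
  rewrite mulrA -(phaseD hn); congr (phase n _ * _); rewrite dotBr !dotZl; ring.
under eq_cl_integral do rewrite inner_b.
by rewrite (cl_integral_linear measurableT (cl_linear_mulr _) fi) -(cftE hn f (s *: w)).
Qed.

(** Plancherel applied to the correlation itself; the reflection w |-> s w of the frequencies is
    then undone, as it preserves Lebesgue measure. *)
Lemma conv_plancherel (s : R) f u : s = 1 \/ s = -1 -> (forall x, twisted s (u x)) ->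
  L1 f -> L2 f -> L1 u -> L2 u ->
  (\int[dx]_w (cl_sqrnorm (cft f w * reverse (cft u w)))%:E =
   ((2 * pi) ^+ n)%:E * \int[dx]_b (cl_sqrnorm (cl_conv f u b))%:E)%E.
Proof.
move=> hs ut f1 f2 u1 u2.
rewrite -(cl_plancherel hn (L1_conv f1 u1) (L2_conv f1 f2 u1 u2)).
under [RHS]eq_integral do rewrite (cft_conv _ hs ut f1 f2 u1 u2).
have s0 : s != 0 by case: hs => ->; rewrite ?oppr_eq0 oner_eq0.
have [F FE] : exists F : V -> cl, F = fun w => cft f w * reverse (cft u w) by eexists.
have mF : cl_measurable F.
  rewrite FE; apply: cl_measurableM; first exact: (cl_measurable_cft hn f1.1).
  by apply: cl_measurable_reverse; exact: (cl_measurable_cft hn u1.1).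
transitivity (\int[dx]_w (cl_sqrnorm (F w))%:E)%E; first by rewrite FE.
transitivity (\int[dx]_w (cl_sqrnorm (F (s *: w)))%:E)%E; last by rewrite FE.
have [_ sc] := scales_affine (0 : V) s0.
have := sc (fun w => (cl_sqrnorm (F w))%:E) (measurable_sqrnormE (D := setT) mF).
have -> : `|s|^-1 ^+ n = 1 by case: hs => ->; rewrite ?normrN normr1 invr1 expr1n.
rewrite mul1e => <-; last by move=> x; rewrite lee_fin cl_sqrnorm_ge0.
by apply: eq_integral => w _; rewrite addr0.
Qed.
End ConvolutionPlancherel.

(** * Fourier transform in L2 *)

Section FourierL2.
Variables (R : realType) (n : nat).
Local Notation cl := (clifford R n).
Local Notation V := 'cV[R]_n.
Local Notation dx := (lebesgue_cv (R := R) n).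
Implicit Types (f g u phi h : V -> cl) (w x b : V).

(** Almost-everywhere identities are carried through limits and changes of variables in this
    integral form, which spares handling exceptional sets. *)
Lemma integral_sqrnorm_eq0 f : cl_measurable f ->
  (\int[dx]_x (cl_sqrnorm (f x))%:E = 0)%E <-> {ae dx, forall x, f x = 0}.
Proof.
move=> mf; have mE := measurable_sqrnormE (D := setT) mf.
have [h1 h2] := ae_eq_integral_abs dx measurableT mE.
have E : (\int[dx]_x `|(cl_sqrnorm (f x))%:E| = \int[dx]_x (cl_sqrnorm (f x))%:E)%E.
  by apply: eq_integral => x _; rewrite /= ger0_norm ?cl_sqrnorm_ge0.
rewrite E in h1 h2; split.
  move=> /h1; apply: filterS => x /(_ Logic.I) /= [] s0.
  apply/ffunP => A; rewrite cl0E; apply/eqP; rewrite -sqrf_eq0 eq_le sqr_ge0 andbT -s0.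
  exact: sqr_coef_le.
move=> h; apply: h2; apply: filterS h => x -> _.
by rewrite cl_sqrnormE big1 // => A _; rewrite cl0E expr0n.
Qed.

Lemma cvge0_lin2 (a c : R) (p q r : nat -> \bar R) : 0 <= a -> 0 <= c ->
  (forall k, 0 <= r k)%E -> (forall k, r k <= a%:E * p k + c%:E * q k)%E ->
  p @ \oo --> 0%E -> q @ \oo --> 0%E -> r @ \oo --> 0%E.
Proof.
move=> a0 c0 r0 rpq p0 q0; apply: (@squeeze0 _ _ (fun k => a%:E * p k + c%:E * q k)%E).
  by move=> k; rewrite r0 rpq.
have := cvgeD _ (cvge0Zl a p0) (cvge0Zl c q0); rewrite adde0; apply.
by rewrite fin_num_adde_defl.
Qed.

Lemma cl_sqrnorm_le_sub (M N : cl) : cl_sqrnorm N <= 2 * cl_sqrnorm (M - N) + 2 * cl_sqrnorm M.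
Proof.
have {1}-> : N = - (M - N) + M by rewrite opprB subrK.
by apply: (le_trans (cl_sqrnormD_le _ _)); rewrite cl_sqrnormN.
Qed.

Lemma cvg_sqrnormB f g (F G : nat -> V -> cl) : cl_measurable f -> cl_measurable g ->
  (forall k, cl_measurable (F k)) -> (forall k, cl_measurable (G k)) ->
  (\int[dx]_x (cl_sqrnorm (F k x - f x))%:E)%E @[k --> \oo] --> 0%E ->
  (\int[dx]_x (cl_sqrnorm (G k x - g x))%:E)%E @[k --> \oo] --> 0%E ->
  (\int[dx]_x (cl_sqrnorm ((F k x - G k x) - (f x - g x)))%:E)%E @[k --> \oo] --> 0%E.
Proof.
move=> mf mg mF mG Ff Gg; apply: (cvge0_lin2 (a := 2) (c := 2) _ _ _ _ Ff Gg) => //.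
  by move=> k; exact: integral_sqrnorm_ge0.
move=> k; apply: integral_sqrnorm_lin2 => //; try exact: cl_measurableB.
  by apply: cl_measurableB; exact: cl_measurableB.
move=> x; have -> : F k x - G k x - (f x - g x) = (F k x - f x) - (G k x - g x).
  by apply/ffunP => A; rewrite !(cl_addE, cl_oppE); ring.
by apply: (le_trans (cl_sqrnormD_le _ _)); rewrite cl_sqrnormN.
Qed.

Hypothesis hn : (n %% 4 = 2 \/ n %% 4 = 3)%N.

(** Plancherel applied to the difference of two approximating sequences: both tend to [phi], so
    their transforms have the same L2 limit. *)
Lemma is_cft_L2_unique phi h h' : is_cft_L2 phi h -> is_cft_L2 phi h' ->
  {ae dx, forall w, h w - h' w = 0}.
Proof.
move=> [[mphi p2] [[mh h2] [u [u12 u0 uh]]]] [_ [[mh' h2'] [v [v12 v0 vh]]]].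
apply/integral_sqrnorm_eq0; first exact: cl_measurableB.
have mu k := (u12 k).1.1; have mv k := (v12 k).1.1.
have mfu k := cl_measurable_cft hn (mu k); have mfv k := cl_measurable_cft hn (mv k).
have uv0 : (\int[dx]_x (cl_sqrnorm (u k x - v k x))%:E)%E @[k --> \oo] --> 0%E.
  apply: cvg_trans (cvg_sqrnormB mphi mphi mu mv u0 v0).
  apply: near_eq_cvg; apply: nearW => k; apply: eq_integral => x _.
  by rewrite subrr subr0.
have fuv0 : (\int[dx]_w (cl_sqrnorm (cft (u k) w - cft (v k) w))%:E)%E @[k --> \oo] --> 0%E.
  have := cvge0Zl ((2 * pi) ^+ n) uv0.
  apply: cvg_trans; apply: near_eq_cvg; apply: nearW => k.
  have [uk1 uk2] := u12 k; have [vk1 vk2] := v12 k.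
  rewrite -(cl_plancherel hn (L1D uk1 (L1N vk1)) (L2B uk2 vk2)).
  by apply: eq_integral => w _; rewrite cftB.
have := cvg_sqrnormB mh mh' mfu mfv uh vh.
move=> hh.
have : (\int[dx]_w (cl_sqrnorm (h w - h' w))%:E)%E @[_ --> \oo] --> 0%E.
  apply: (cvge0_lin2 (a := 2) (c := 2) _ _ _ _ hh fuv0) => //.
    by move=> k; exact: integral_sqrnorm_ge0.
  move=> k; apply: integral_sqrnorm_lin2 => //; try exact: cl_measurableB.
    by apply: cl_measurableB; exact: cl_measurableB.
  by move=> w; exact: cl_sqrnorm_le_sub.
move=> /(cvg_lim (@ereal_hausdorff R)) <-; by rewrite lim_cst.
Qed.

Section Twisted.
Variables (s : R) (hs : s = 1 \/ s = -1).
Variables (phi h : V -> cl).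
Hypotheses (phih : is_cft_L2 phi h) (tphi : {ae dx, forall x, twist s (phi x) - phi x = 0}).

Lemma cl_measurable_twist f : cl_measurable f -> cl_measurable (fun x => twist s (f x)).
Proof.
move=> mf; apply: cl_measurableZ; first exact: measurable_cst.
apply: cl_measurableB => //; apply: cl_measurableZ; first exact: measurable_cst.
apply: cl_measurableM; last exact: cl_measurable_cst.
by apply: cl_measurableM => //; exact: cl_measurable_cst.
Qed.

(** The approximants provided by the definition are projected by [twist s]. This does not increase
    norms, commutes with [cft] and fixes [phi] almost everywhere, so convergence to [phi] is
    preserved while each approximant becomes twisted at every point. *)
Lemma twisted_approx : exists v : nat -> V -> cl,
  [/\ forall k, L1 (v k) /\ L2 (v k), forall k x, twisted s (v k x),
      (\int[dx]_x (cl_sqrnorm (v k x - phi x))%:E)%E @[k --> \oo] --> 0%E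
    & (\int[dx]_w (cl_sqrnorm (cft (v k) w - twist s (h w)))%:E)%E @[k --> \oo] --> 0%E].
Proof.
have [[mphi p2] [[mh h2] [u [u12 u0 uh]]]] := phih.
have mu k := (u12 k).1.1; have mtu k := cl_measurable_twist (mu k).
have twist_cft k w : cft (fun x => twist s (u k x)) w = twist s (cft (u k) w).
  have tm M t : twist s (M * phase n t) = twist s M * phase n t by exact: twist_mulphase.
  have := @cft_linear_comm R n hn (@twist R n s) (u k) w (@cl_linear_twist R n s) tm (u12 k).1.
  exact.
exists (fun k x => twist s (u k x)); split.
- move=> k; split.
    by have := @L1_linear R n (u k) (@twist R n s) (@cl_linear_twist R n s) (mtu k) (u12 k).1; exact.
  apply: (L2_scale (mtu k) ler01 (u12 k).2) => x; rewrite mul1r; exact: cl_sqrnorm_twist.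
- by move=> k x; exact: twisted_twist.
- have t0 : (\int[dx]_x (cl_sqrnorm (twist s (phi x) - phi x))%:E = 0)%E.
    by apply/integral_sqrnorm_eq0 => //; apply: cl_measurableB => //; exact: cl_measurable_twist.
  have c0 : (\int[dx]_x (cl_sqrnorm (twist s (phi x) - phi x))%:E)%E @[_ --> \oo] --> 0%E.
    by rewrite t0; exact: cvg_cst.
  apply: (cvge0_lin2 (a := 2) (c := 2) _ _ _ _ u0 c0) => //.
    by move=> k; exact: integral_sqrnorm_ge0.
  move=> k; apply: integral_sqrnorm_lin2 => //; try exact: cl_measurableB.
    by apply: cl_measurableB => //; exact: cl_measurable_twist.
  move=> x; have -> : twist s (u k x) - phi x = twist s (u k x - phi x) + (twist s (phi x) - phi x).
    by rewrite twistB addrA subrK.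
  apply: (le_trans (cl_sqrnormD_le _ _)); rewrite lerD2r ler_pM2l //; exact: cl_sqrnorm_twist.
apply: (squeeze0 _ uh) => k; rewrite integral_sqrnorm_ge0 /= -[leRHS]mul1e.
apply: integral_sqrnorm_scale => //.
- by apply: cl_measurableB => //; exact: cl_measurable_cft.
- by apply: cl_measurableB; [exact: cl_measurable_cft|exact: cl_measurable_twist].
by move=> w _; rewrite mul1r twist_cft -twistB; exact: cl_sqrnorm_twist.
Qed.

(** The twisted approximants show that the projection of [h] is also a transform of [phi];
    uniqueness identifies it with [h]. *)
Lemma is_cft_L2_twisted : {ae dx, forall w, twist s (h w) - h w = 0}.
Proof.
have [v [v12 _ v0 vh]] := twisted_approx; have [p2 [h2 _]] := phih.
apply: (is_cft_L2_unique (phi := phi) _ phih); split; first exact: p2.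
split; last by exists v; split; [exact: v12|exact: v0|exact: vh].
apply: (L2_scale (cl_measurable_twist h2.1) ler01 h2) => x.
by rewrite mul1r; exact: cl_sqrnorm_twist.
Qed.

(** Passage to the limit along twisted approximants of [phi]. On the frequency side [cft f] is
    bounded because [f] is in L1; on the other side Young's inequality controls the correlations. *)
Lemma conv_plancherel_L2 f : L1 f -> L2 f ->
  (\int[dx]_w (cl_sqrnorm (cft f w * reverse (h w)))%:E =
   ((2 * pi) ^+ n)%:E * \int[dx]_b (cl_sqrnorm (cl_conv f phi b))%:E)%E.
Proof.
move=> f1 f2; have [v [v12 tv v0 vh]] := twisted_approx; have [p2 [h2 _]] := phih.
have mv k := (v12 k).1.1.
have th2 : L2 (fun w => twist s (h w)).
  apply: (L2_scale (cl_measurable_twist h2.1) ler01 h2) => x.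
  by rewrite mul1r; exact: cl_sqrnorm_twist.
have mfh := cl_measurable_cft hn f1.1.
have mfrev u : cl_measurable u -> cl_measurable (fun w => cft f w * reverse (u w)).
  by move=> mu; apply: cl_measurableM => //; exact: cl_measurable_reverse.
set B := cl_dim R n ^+ 2 * (2 * \int[dx]_x cl_norm1 (f x)) ^+ 2.
have B0 : 0 <= B by rewrite mulr_ge0 ?sqr_ge0.
have bound w M : cl_sqrnorm (cft f w * reverse M) <= B * cl_sqrnorm M.
  apply: (le_trans (cl_sqrnormM _ _)); rewrite cl_sqrnorm_reverse /B -mulrA ler_wpM2l ?sqr_ge0 //.
  by rewrite ler_wpM2r ?cl_sqrnorm_ge0 //; exact: cl_sqrnorm_cft_le.
have lim1 : (\int[dx]_w (cl_sqrnorm (cft f w * reverse (cft (v k) w)))%:E)%E @[k --> \oo] -->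
    (\int[dx]_w (cl_sqrnorm (cft f w * reverse (twist s (h w))))%:E)%E.
  apply: (@cvg_integral_sqrnorm _ _ _ _ dx setT measurableT (fun k w => cft f w * reverse (cft (v k) w))
    (fun w => cft f w * reverse (twist s (h w)))).
  - by move=> k; apply: mfrev; exact: cl_measurable_cft.
  - by apply: mfrev; exact: th2.1.
  - have := L2_scale (mfrev _ th2.1) B0 th2; case=> // w; exact: bound.
  apply: (squeeze0 _ (cvge0Zl B vh)) => k; rewrite integral_sqrnorm_ge0 /=.
  apply: integral_sqrnorm_scale => //.
  - by apply: cl_measurableB; [exact: cl_measurable_cft|exact: th2.1].
  - by apply: cl_measurableB; apply: mfrev; [exact: cl_measurable_cft|exact: th2.1].
  by move=> w _; rewrite -mulrBr -reverseB; exact: bound.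
have [K K0 young] := young_conv f1 f2.
have lim2 : (\int[dx]_b (cl_sqrnorm (cl_conv f (v k) b))%:E)%E @[k --> \oo] -->
    (\int[dx]_b (cl_sqrnorm (cl_conv f phi b))%:E)%E.
  apply: (@cvg_integral_sqrnorm _ _ _ _ dx setT measurableT (fun k b => cl_conv f (v k) b) (cl_conv f phi)).
  - by move=> k; exact: (cl_measurable_conv f1.1 (mv k)).
  - exact: (cl_measurable_conv f1.1 p2.1).
  - apply: (le_lt_trans (young _ p2)); apply: lte_mul_pinfty; rewrite ?lee_fin //; exact: p2.2.
  apply: (squeeze0 _ (cvge0Zl K v0)) => k; rewrite integral_sqrnorm_ge0 /=.
  apply: le_trans (young _ (L2B (v12 k).2 p2)).
  by under [leLHS]eq_integral do rewrite -(convB _ f2 (v12 k).2 p2).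
have ae_h : (\int[dx]_w (cl_sqrnorm (cft f w * reverse (h w)))%:E =
    \int[dx]_w (cl_sqrnorm (cft f w * reverse (twist s (h w))))%:E)%E.
  apply: ae_eq_integral => //.
  - exact: (measurable_sqrnormE (D := setT) (mfrev _ h2.1)).
  - exact: (measurable_sqrnormE (D := setT) (mfrev _ th2.1)).
  by apply: filterS is_cft_L2_twisted => w /eqP; rewrite subr_eq0 => /eqP ->.
rewrite ae_h -(cvg_lim (@ereal_hausdorff R) lim1); apply: (cvg_lim (@ereal_hausdorff R)).
have := cvgeZl (isT : ((2 * pi) ^+ n)%:E \is a fin_num) lim2.
apply: cvg_trans; apply: near_eq_cvg; apply: nearW => k.
by rewrite (conv_plancherel hn hs (tv k) f1 f2 (v12 k).1 (v12 k).2).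
Qed.

End Twisted.
End FourierL2.

Lemma scales_integral_comp d (T : measurableType d) (R : realType) (mu : {measure set T -> \bar R})
    (p q : T -> T) (c e : R) :
  scales_integral mu p c -> scales_integral mu q e -> scales_integral mu (fun x => p (q x)) (e * c).
Proof.
move=> [mp hp] [mq hq]; split; first exact: (measurableT_comp mp mq).
move=> F mF F0; have := hq (F \o p) (measurableT_comp mF mp) (fun x => F0 (p x)).
by move=> /= ->; rewrite hp // EFinM muleA.
Qed.

Lemma dot_orthogonal (R : realType) n (B : 'M[R]_n) (a : R) (w x : 'cV[R]_n) :
  B *m B^T = 1%:M -> a != 0 -> dot (a *: (B *m w)) (B *m (a^-1 *: x)) = dot w x.
Proof.
move=> BB a0; rewrite !dotE linearZ /= trmx_mul -scalemxAl -!scalemxAr scalerA mulfV // scale1r.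
by rewrite mulmxA -(mulmxA w^T) (mulmx1C BB) mulmx1.
Qed.

(** * Daughter wavelets *)

Section Daughter.
Variables (R : realType) (n : nat).
Local Notation cl := (clifford R n).
Local Notation V := 'cV[R]_n.
Local Notation dx := (lebesgue_cv (R := R) n).
Implicit Types (f g u psi psih : V -> cl) (w x b : V).
Variables (a : R) (r : SO R n).
Hypothesis a0 : 0 < a.
Local Notation A := (val (r^-1)%g).
Local Notation c := (a `^ (- n%:R / 2)).
Local Notation D u := (daughter u a r 0).

Let AA : A *m A^T = 1%:M.
Proof. by have /andP[/eqP] := valP (r^-1)%g. Qed.

(** The translation parameter is set to 0, since the correlation variable accounts for it. The
    Jacobian a^n comes from the dilation alone, the rotation contributing 1. *)
Lemma scales_daughter : scales_integral dx (fun x => A *m (a^-1 *: (x - 0))) (a ^+ n).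
Proof.
have an0 : a^-1 != 0 by rewrite invr_neq0 // gt_eqF.
have := scales_integral_comp (scales_orthogonal AA) (scales_affine (0 : V) an0).
rewrite mulr1 gtr0_norm ?invr_gt0 // invrK.
by under [X in scales_integral _ X _ -> _]eq_fun do rewrite addr0 -[X in a^-1 *: X]subr0.
Qed.

Lemma scales_dilate : scales_integral dx (fun w => a *: (A *m w)) (a^-1 ^+ n).
Proof.
have an0 : a != 0 by rewrite gt_eqF.
have := scales_integral_comp (scales_affine (0 : V) an0) (scales_orthogonal AA).
by rewrite mul1r gtr0_norm //; under [X in scales_integral _ X _ -> _]eq_fun do rewrite addr0.
Qed.

(** The normalization a^(-n/2) serves this purpose: its square cancels the Jacobian, so that passing
    to the daughter wavelet is an L2 isometry. *)
Lemma daughter_coef_sqr : c ^+ 2 * a ^+ n = 1.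
Proof.
rewrite -(powR_mulrn 2 (powR_ge0 _ _)) -powRrM divfK // powRN powR_mulrn ?ltW // mulVf //.
by rewrite expf_neq0 // gt_eqF.
Qed.

Lemma cl_measurable_daughter u : cl_measurable u -> cl_measurable (D u).
Proof.
move=> mu; apply: cl_measurableZ; first exact: measurable_cst.
exact: (cl_measurable_comp scales_daughter.1 mu).
Qed.

Lemma integral_sqrnorm_daughter u : cl_measurable u ->
  (\int[dx]_x (cl_sqrnorm (D u x))%:E = \int[dx]_x (cl_sqrnorm (u x))%:E)%E.
Proof.
move=> mu; have mu2 := measurable_sqrnormE (D := setT) mu.
have h := scales_daughter.2 _ mu2 (fun x => cl_sqrnorm_ge0 (u x)).
have [p pE] : exists p : V -> V, p = fun x => A *m (a^-1 *: (x - 0)) by eexists.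
have c2 : 0 <= c ^+ 2 by exact: sqr_ge0.
transitivity (\int[dx]_x ((c ^+ 2)%:E * (cl_sqrnorm (u (p x)))%:E))%E.
  by apply: eq_integral => x _; rewrite pE /daughter cl_sqrnormZ EFinM.
have mup : measurable_fun setT (fun x => (cl_sqrnorm (u (p x)))%:E).
  by apply: (measurableT_comp mu2); rewrite pE; exact: scales_daughter.1.
have u0 x : setT x -> (0 <= (cl_sqrnorm (u (p x)))%:E)%E by move=> _; rewrite lee_fin cl_sqrnorm_ge0.
rewrite (ge0_integralZl_EFin dx measurableT u0 mup c2).
by rewrite pE h muleA -EFinM daughter_coef_sqr mul1e.
Qed.

Lemma daughterB u v x : D (fun y => u y - v y) x = D u x - D v x.
Proof. by rewrite /daughter scalerBr. Qed.

Lemma L2_daughter u : L2 u -> L2 (D u).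
Proof.
move=> [mu u2]; split; first exact: cl_measurable_daughter.
by rewrite integral_sqrnorm_daughter.
Qed.

Lemma L1_daughter u : L1 u -> L1 (D u).
Proof.
move=> [mu ui]; split; first exact: cl_measurable_daughter.
have an0 : 0 <= a ^+ n by rewrite exprn_ge0 // ltW.
have := scales_cl_integrable an0 scales_daughter ui.
exact: (cl_integrable_linear measurableT (cl_linear_scale n c)).
Qed.

Lemma dot_dilate w x : dot (a *: (A *m w)) (A *m (a^-1 *: (x - 0))) = dot w x.
Proof.
by rewrite subr0; apply: dot_orthogonal; [exact: AA|rewrite gt_eqF].
Qed.

Hypothesis hn : (n %% 4 = 2 \/ n %% 4 = 3)%N.

Lemma cft_daughter u w : L1 u -> cft (D u) w = (c * a ^+ n) *: cft u (a *: (A *m w)).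
Proof.
move=> u1; rewrite !cftE //.
have Gi := cl_integrable_phase (measurable_Ndot (a *: (A *m w))) u1.
have an0 : 0 <= a ^+ n by rewrite exprn_ge0 // ltW.
rewrite -scalerA -(scales_cl_integral scales_daughter Gi).
rewrite -(cl_integral_linear measurableT (cl_linear_scale n c)); last first.
  exact: (scales_cl_integrable an0 scales_daughter Gi).
by apply: eq_cl_integral => x _; rewrite dot_dilate /daughter scalerAl.
Qed.

Lemma integral_sqrnorm_dilate u : cl_measurable u ->
  (\int[dx]_w (cl_sqrnorm ((c * a ^+ n) *: u (a *: (A *m w))))%:E = \int[dx]_x (cl_sqrnorm (u x))%:E)%E.
Proof.
move=> mu; have mu2 := measurable_sqrnormE (D := setT) mu.
have h := scales_dilate.2 _ mu2 (fun x => cl_sqrnorm_ge0 (u x)).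
have [p pE] : exists p : V -> V, p = fun w => a *: (A *m w) by eexists.
transitivity (\int[dx]_x ((a ^+ n)%:E * (cl_sqrnorm (u (p x)))%:E))%E.
  apply: eq_integral => x _; rewrite pE cl_sqrnormZ -EFinM; congr (_ * _)%:E.
  by rewrite exprMn [X in _ * X]expr2 mulrA daughter_coef_sqr mul1r.
have an0 : 0 <= a ^+ n by rewrite exprn_ge0 // ltW.
have mup : measurable_fun setT (fun x => (cl_sqrnorm (u (p x)))%:E).
  by apply: (measurableT_comp mu2); rewrite pE; exact: scales_dilate.1.
have u0 x : setT x -> (0 <= (cl_sqrnorm (u (p x)))%:E)%E by move=> _; rewrite lee_fin cl_sqrnorm_ge0.
rewrite (ge0_integralZl_EFin dx measurableT u0 mup an0).
by rewrite pE h muleA -EFinM -exprMn mulfV ?expr1n ?mul1e // gt_eqF.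
Qed.

Lemma cl_measurable_dilate u : cl_measurable u ->
  cl_measurable (fun w => (c * a ^+ n) *: u (a *: (A *m w))).
Proof.
move=> mu; apply: cl_measurableZ; first exact: measurable_cst.
exact: (cl_measurable_comp scales_dilate.1 mu).
Qed.

(** Dilation and rotation act isometrically both on functions and on their transforms, so the
    approximating sequence of [psi] is carried to one for its daughter with unchanged errors. *)
Lemma is_cft_L2_daughter psi psih : is_cft_L2 psi psih ->
  is_cft_L2 (D psi) (fun w => (c * a ^+ n) *: psih (a *: (A *m w))).
Proof.
move=> [p2 [[mh h2] [u [u12 u0 uh]]]]; split; first exact: L2_daughter.
split; first by split; [exact: cl_measurable_dilate|rewrite integral_sqrnorm_dilate].
have mu k := (u12 k).1.1.
exists (fun k => D (u k)); split.
- by move=> k; split; [exact: (L1_daughter (u12 k).1)|exact: (L2_daughter (u12 k).2)].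
- apply: cvg_trans u0; apply: near_eq_cvg; apply: nearW => k.
  rewrite -(integral_sqrnorm_daughter (cl_measurableB (mu k) p2.1)).
  by apply: eq_integral => x _; rewrite daughterB.
apply: cvg_trans uh; apply: near_eq_cvg; apply: nearW => k.
have mc : cl_measurable (cft (u k)) by exact: cl_measurable_cft.
rewrite -(integral_sqrnorm_dilate (cl_measurableB mc mh)).
by apply: eq_integral => w _; rewrite (cft_daughter w (u12 k).1) scalerBr.
Qed.

(** The defect of twistedness has zero L2 norm, and forming the daughter preserves that norm and
    commutes with [twist]. *)
Lemma daughter_twisted (s : R) psi : cl_measurable psi ->
  {ae dx, forall x, twist s (psi x) - psi x = 0} ->
  {ae dx, forall x, twist s (D psi x) - D psi x = 0}.
Proof.
move=> mp; have mtp : cl_measurable (fun x => twist s (psi x) - psi x).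
  by apply: cl_measurableB => //; exact: cl_measurable_twist.
move=> /(integral_sqrnorm_eq0 mtp); rewrite -(integral_sqrnorm_daughter mtp).
move=> /(integral_sqrnorm_eq0 (cl_measurable_daughter mtp)); apply: filterS => x.
rewrite daughterB /daughter; move=> <-; congr (_ - _).
by rewrite (cl_linear_twist n s).2.
Qed.

Lemma daughter_shift psi b x : daughter psi a r b x = D psi (x - b).
Proof. by rewrite /daughter subr0. Qed.

Lemma cwt_conv psi f b : cwt psi f a r b = cl_conv f (D psi) b.
Proof. by apply: eq_cl_integral => x _; rewrite daughter_shift. Qed.

Lemma sqrnorm_mul_reverse (M P : cl) : cl_sqrnorm (M * reverse P) = cl_dot (M * (reverse P * P)) M.
Proof. by rewrite mulrA cl_dotMr cl_dot_sqr. Qed.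

(** The transform of the daughter carries the factor c a^n, where c = a^(-n/2). Its square is a^n,
    precisely the power of [a] in [admissibility_integrand]. *)
Lemma cwt_plancherel (s : R) psi psih f : s = 1 \/ s = -1 ->
  {ae dx, forall x, twist s (psi x) - psi x = 0} -> is_cft_L2 psi psih -> L1 f -> L2 f ->
  (\int[dx]_w (cl_dot (cft f w * admissibility_integrand psih w a r) (cft f w))%:E =
   ((2 * pi) ^+ n)%:E * \int[dx]_b (cl_sqrnorm (cwt psi f a r b))%:E)%E.
Proof.
move=> hs tp ph f1 f2; have mp := ph.1.1.
have h := conv_plancherel_L2 hn hs (is_cft_L2_daughter ph) (daughter_twisted mp tp) f1 f2.
transitivity (((2 * pi) ^+ n)%:E * \int[dx]_b (cl_sqrnorm (cl_conv f (D psi) b))%:E)%E; last first.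
  apply: (congr1 (fun X => ((2 * pi) ^+ n)%:E * X)%E); apply: eq_integral => b _.
  exact: (congr1 (fun M => (cl_sqrnorm M)%:E) (esym (cwt_conv psi f b))).
apply: etrans h; apply: eq_integral => w _; congr (_%:E).
rewrite /admissibility_integrand /=; set M := cft f w; set P := psih _.
rewrite reverseZ -!scalerAr cl_sqrnormZ cl_dotZl sqrnorm_mul_reverse.
by rewrite exprMn [(a ^+ n) ^+ 2]expr2 (mulrA (c ^+ 2)) daughter_coef_sqr mul1r.
Qed.

End Daughter.

(** * Fatou bounds and polarization of square-integrable functions *)

Section NonnegPolar.
Context d (T : measurableType d) (R : realType) (n : nat) (mu : {measure set T -> \bar R}).
Local Notation cl := (clifford R n).
Implicit Types F G : T -> cl.

(** Fatou's lemma for pointwise limits, used where a bound on the integrals is known but no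
    dominating function is. *)
Lemma integral_cvg_le (u : nat -> T -> R) (v : T -> R) (B : \bar R) :
  (forall k, measurable_fun setT (u k)) -> (forall k x, 0 <= u k x) ->
  (forall x, u k x @[k --> \oo] --> v x) -> (forall k, (\int[mu]_x (u k x)%:E <= B)%E) ->
  (\int[mu]_x (v x)%:E <= B)%E.
Proof.
move=> mu_ u0 uv uB.
have muE k : measurable_fun setT (fun x => (u k x)%:E) by apply/measurable_EFinP.
have := fatou mu measurableT muE (fun k x _ => u0 k x).
have -> : (\int[mu]_x limn_einf (fun k => (u k x)%:E) = \int[mu]_x (v x)%:E)%E.
  apply: eq_integral => x _.
  have ux : (u k x)%:E @[k --> \oo] --> (v x)%:E by apply: cvg_EFin; [exact: nearW|exact: uv].
  exact: (cvg_limn_einf_sup ux).1.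
move=> h; apply: (le_trans h); rewrite limn_einf_lim; apply: lime_le; first exact: is_cvg_einfs.
by apply: nearW => k; apply: ge_ereal_inf; exists (\int[mu]_x (u k x)%:E)%E => //; exists k => /=.
Qed.

Definition sqr_integrable F := cl_measurable F /\ (\int[mu]_x (cl_sqrnorm (F x))%:E < +oo)%E.

Lemma sqr_integrable_integrable F : sqr_integrable F ->
  mu.-integrable setT (EFin \o (fun x => cl_sqrnorm (F x))).
Proof.
move=> [mF Foo]; apply/integrableP; split; first exact: (measurable_sqrnormE (D := setT) mF).
by under eq_integral do rewrite /= ger0_norm ?cl_sqrnorm_ge0 //.
Qed.

Lemma sqr_integrableD F G : sqr_integrable F -> sqr_integrable G -> sqr_integrable (fun x => F x + G x).
Proof.
move=> [mF Foo] [mG Goo]; have mFG := cl_measurableD mF mG; split; first exact: mFG.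
have h := integral_sqrnorm_lin2 mu measurableT mF mG mFG (ler0n R 2) (ler0n R 2)
  (fun x => cl_sqrnormD_le (F x) (G x)).
exact: (le_lt_trans h (lin2_lty (ler0n R 2) (ler0n R 2) Foo Goo)).
Qed.

Lemma sqr_integrableN F : sqr_integrable F -> sqr_integrable (fun x => - F x).
Proof.
move=> [mF Foo]; split; first exact: cl_measurableN.
by under eq_integral do rewrite cl_sqrnormN.
Qed.

Lemma integrable_cl_dot F G : sqr_integrable F -> sqr_integrable G ->
  mu.-integrable setT (EFin \o (fun x => cl_dot (F x) (G x))).
Proof.
move=> hF hG; have i := integrable_addR measurableT (sqr_integrable_integrable hF) (sqr_integrable_integrable hG).
apply: (le_normr_integrable _ i); first exact: (measurable_cl_dot hF.1 hG.1).
by move=> x; rewrite [leRHS]ger0_norm ?addr_ge0 ?cl_sqrnorm_ge0 //; exact: cl_dot_norm_le.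
Qed.

Lemma Rintegral_polar F G : sqr_integrable F -> sqr_integrable G ->
  \int[mu]_x cl_dot (F x) (G x) =
  (\int[mu]_x cl_sqrnorm (F x + G x) - \int[mu]_x cl_sqrnorm (F x - G x)) / 4.
Proof.
move=> hF hG; have ip := sqr_integrable_integrable (sqr_integrableD hF hG).
have im := sqr_integrable_integrable (sqr_integrableD hF (sqr_integrableN hG)).
rewrite -(RintegralB measurableT ip im).
rewrite -(RintegralZr _ measurableT (integrable_subR measurableT ip im)).
by apply: eq_Rintegral => x _; rewrite cl_polar.
Qed.

End NonnegPolar.

(** * The quadratic form of a constant commuting with the pseudoscalar *)

Section Quadratic.
Variables (R : realType) (n : nat).
Local Notation cl := (clifford R n).
Local Notation I := (pseudoscalar R n).
Local Notation V := 'cV[R]_n.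
Local Notation dx := (lebesgue_cv (R := R) n).
Implicit Types (f g : V -> cl).

Hypothesis hn : (n %% 4 = 2 \/ n %% 4 = 3)%N.

Lemma cft_L2 f : L1 f -> L2 f -> L2 (cft f).
Proof.
move=> f1 f2; split; first exact: (cl_measurable_cft hn f1.1).
rewrite (cl_plancherel hn f1 f2); apply: lte_mul_pinfty => //; last exact: f2.2.
by rewrite lee_fin exprn_ge0 // mulr_ge0 // pi_ge0.
Qed.

Lemma cl_plancherel_Rintegral f : L1 f -> L2 f ->
  \int[dx]_w cl_sqrnorm (cft f w) = (2 * pi) ^+ n * \int[dx]_x cl_sqrnorm (f x).
Proof.
move=> f1 f2; rewrite /Rintegral (cl_plancherel hn f1 f2) fineM //.
by rewrite integrable_fin_num //; exact: L2_integrable.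
Qed.

Lemma cftD f g w : L1 f -> L1 g -> cft (fun x => f x + g x) w = cft f w + cft g w.
Proof.
move=> f1 g1; rewrite !cftE // -cl_integralD //.
- by apply: eq_cl_integral => x _; rewrite mulrDl.
- exact: (cl_integrable_phase (measurable_Ndot w) f1).
- exact: (cl_integrable_phase (measurable_Ndot w) g1).
Qed.

Lemma cl_plancherel_dot f g : L1 f -> L2 f -> L1 g -> L2 g ->
  \int[dx]_w cl_dot (cft f w) (cft g w) = (2 * pi) ^+ n * \int[dx]_x cl_dot (f x) (g x).
Proof.
move=> f1 f2 g1 g2; rewrite (Rintegral_polar f2 g2) (Rintegral_polar (cft_L2 f1 f2) (cft_L2 g1 g2)).
have e1 : \int[dx]_w cl_sqrnorm (cft f w + cft g w) = (2 * pi) ^+ n * \int[dx]_x cl_sqrnorm (f x + g x).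
  rewrite -(cl_plancherel_Rintegral (L1D f1 g1) (L2D f2 g2)).
  by apply: eq_Rintegral => w _; rewrite cftD.
have e2 : \int[dx]_w cl_sqrnorm (cft f w - cft g w) = (2 * pi) ^+ n * \int[dx]_x cl_sqrnorm (f x - g x).
  rewrite -(cl_plancherel_Rintegral (L1D f1 (L1N g1)) (L2B f2 g2)).
  by apply: eq_Rintegral => w _; rewrite cftB.
by rewrite e1 e2 -mulrBr -mulrA.
Qed.

(** The unit ball has positive measure, so a null set cannot contain it. Properties of [C] can
    therefore be read off at a single good frequency. *)
Lemma ae_exists (P : V -> Prop) : {ae dx, forall x, P x} -> exists x, P x.
Proof.
move=> h; apply: contrapT => nP; have nP' x : ~ P x by move=> Px; apply: nP; exists x.
have [E [mE E0 PE]] := h; have := cv_ball_gt0 R n.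
have : (dx (cv_ball R n) <= dx E)%E.
  apply: le_measure; rewrite ?inE; [exact: measurable_cv_ball|exact: mE|].
  by move=> x _; apply: PE => Px; exact: (nP' x).
by rewrite E0 => /le_lt_trans h2 /h2; rewrite ltxx.
Qed.

(** As [C] commutes with [I], it commutes with every phase, so the transform of x |-> f(x) C is f^
    C. The polarized Plancherel identity is applied to this function and [f]. *)
Lemma plancherel_quadratic (C : cl) f : GRing.comm C I ->
  L1 f -> L2 f ->
  (\int[dx]_w (cl_dot (cft f w * C) (cft f w))%:E =
   ((2 * pi) ^+ n)%:E * \int[dx]_x (cl_dot (f x * C) (f x))%:E)%E.
Proof.
move=> CI f1 f2.
have mfC : cl_measurable (fun x => f x * C).
  by apply: cl_measurableM; [exact: f1.1|exact: cl_measurable_cst].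
have fC1 : L1 (fun x => f x * C) by exact: (L1_linear (cl_linear_mulr C) mfC f1).
have fC2 : L2 (fun x => f x * C) by exact: L2_mulr.
have Cp (M : cl) t : M * phase n t * C = M * C * phase n t.
  have : phase n t * C = C * phase n t.
    by rewrite /phase mulrDl mulrDr -!scalerAl -!scalerAr mul1r mulr1 CI.
  by rewrite -!mulrA => ->.
have cE w : cft (fun x => f x * C) w = cft f w * C.
  exact: (cft_linear_comm hn w (cl_linear_mulr C) Cp f1).
have i1 := integrable_cl_dot (cft_L2 fC1 fC2) (cft_L2 f1 f2).
have i2 := integrable_cl_dot fC2 f2.
have h := congr1 EFin (cl_plancherel_dot fC1 fC2 f1 f2).
have h1 := fineK (integrable_fin_num measurableT i1).
have h2 := fineK (integrable_fin_num measurableT i2).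
rewrite EFinM {1}/Rintegral h1 {1}/Rintegral h2 in h.
by apply: etrans h; apply: eq_integral => w _; rewrite /= cE.
Qed.
End Quadratic.

(** * Integration over the similitude group *)

Section Weight.
Variables (R : realType) (n : nat) (haar : probability (SO R n) R).
Local Notation cl := (clifford R n).
Local Notation I := (pseudoscalar R n).
Local Notation V := 'cV[R]_n.
Local Notation dx := (lebesgue_cv (R := R) n).
Local Notation G := (measurableTypeR R * SO R n)%type.
Local Notation leb := (@lebesgue_measure R).
Implicit Types (f g psi psih : V -> cl).

(* The density of [dmu], extended by 0 to [a <= 0] so that integrals over
   [mu_domain] become integrals over the whole product. *)
Definition haar_weight (p : G) : R := if 0 < (p.1 : R) then (p.1 : R) ^- n.+1 else 0.

Lemma haar_weight_ge0 p : 0 <= haar_weight p.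
Proof. by rewrite /haar_weight; case: ifP => // p0; rewrite invr_ge0 exprn_ge0 // ltW. Qed.

Lemma measurable_invr : measurable_fun [set: measurableTypeR R] (fun x : measurableTypeR R => (x : R)^-1).
Proof.
(* The power with exponent -1 is identified with the inverse on nonnegative bases, hence the detour
   through x^2; at x = 0 both sides are 0. *)
have -> : (fun x : measurableTypeR R => (x : R)^-1) = (fun x => (x : R) * ((x : R) ^+ 2) `^ (- 1)).
  apply/funext => x; rewrite powR_inv1 ?sqr_ge0 // expr2 invfM.
  by have [->|x0] := eqVneq (x : R) 0; rewrite ?invr0 ?mul0r // mulVKf.
apply: measurable_funM; first exact: measurable_id.
apply: (measurableT_comp (measurable_powR (- 1))).
by apply: measurable_funX; exact: measurable_id.
Qed.

Lemma measurable_haar_weight : measurable_fun setT haar_weight.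
Proof.
apply: measurable_fun_ifT.
- by apply: measurable_fun_ltr; [exact: measurable_cst|exact: measurable_fst].
- have h : measurable_fun setT (fun p : G => (p.1 : R) ^+ n.+1) by apply: measurable_funX; exact: measurable_fst.
  exact: (measurableT_comp measurable_invr h).
exact: measurable_cst.
Qed.

Lemma measurable_mu_domain : measurable (@mu_domain R n : set G).
Proof. by apply: measurableX => //; exact: measurable_itv. Qed.

Lemma mu_domainE (p : G) : (p \in (@mu_domain R n : set G)) = (0 < (p.1 : R)).
Proof.
by apply/idP/idP; rewrite inE /mu_domain /=; [move=> [/= h _]|move=> h; split=> //=];
  move: h; rewrite in_itv /= andbT.
Qed.

Definition dilation_measure := sigma_finite_prod leb haar.
Local Notation nu := dilation_measure.

Lemma mu_integrableE (F : R -> SO R n -> cl) : mu_integrable haar F <->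
  cl_integrable nu setT (fun p : G => haar_weight p *: F p.1 p.2).
Proof.
have E A : ((fun p : G => ((p.1 ^- n.+1 *: F p.1 p.2) A)%:E) \_ (@mu_domain R n : set G)) =
   (fun p : G => ((haar_weight p *: F p.1 p.2) A)%:E).
  apply/funext => p; rewrite patchE mu_domainE /haar_weight; case: ifP => // _.
  by rewrite scale0r cl0E.
split=> h A.
  by have := h A; move=> /(integrable_mkcond _ measurable_mu_domain); rewrite E.
by apply/(integrable_mkcond _ measurable_mu_domain); rewrite E; exact: h.
Qed.

Lemma mu_integralE (F : R -> SO R n -> cl) :
  mu_integral haar F = cl_integral nu setT (fun p : G => haar_weight p *: F p.1 p.2).
Proof.
apply/ffunP => A; rewrite [LHS]ffunE [RHS]ffunE.
apply: (etrans (Rintegral_mkcond _ _ _)); apply: eq_Rintegral => p _.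
rewrite patchE mu_domainE /haar_weight; case: ifP => // _.
by rewrite scale0r cl0E.
Qed.

Lemma sim_domainE (p : G * V) :
  (p \in ((@mu_domain R n : set G) `*` setT : set (G * V))) = (0 < (p.1.1 : R)).
Proof.
rewrite -mu_domainE; apply/idP/idP; first by rewrite inE => -[h _]; rewrite inE.
by rewrite inE => h; rewrite inE; split.
Qed.

Lemma sim_integrableE (F : R -> SO R n -> V -> cl) : sim_integrable haar F <->
  cl_integrable (nu \x dx)%E setT (fun p : G * V => haar_weight p.1 *: F p.1.1 p.1.2 p.2).
Proof.
have mD : measurable ((@mu_domain R n : set G) `*` setT : set (G * V)).
  by apply: measurableX => //; exact: measurable_mu_domain.
have E A : ((fun p : G * V => ((p.1.1 ^- n.+1 *: F p.1.1 p.1.2 p.2) A)%:E) \_ ((@mu_domain R n : set G) `*` setT)) =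
   (fun p : G * V => ((haar_weight p.1 *: F p.1.1 p.1.2 p.2) A)%:E).
  apply/funext => p; rewrite patchE sim_domainE /haar_weight; case: ifP => // _.
  by rewrite scale0r cl0E.
split=> h A.
  by have := h A; move=> /(integrable_mkcond _ mD); rewrite E.
by apply/(integrable_mkcond _ mD); rewrite E; exact: h.
Qed.

Lemma sim_integralE (F : R -> SO R n -> V -> cl) : sim_integral haar F =
  cl_integral (nu \x dx)%E setT (fun p : G * V => haar_weight p.1 *: F p.1.1 p.1.2 p.2).
Proof.
apply/ffunP => A; rewrite [LHS]ffunE [RHS]ffunE.
apply: (etrans (Rintegral_mkcond _ _ _)); apply: eq_Rintegral => p _.
rewrite patchE sim_domainE /haar_weight; case: ifP => // _.
by rewrite scale0r cl0E.
Qed.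

Lemma measurable_soV : measurable_fun setT (fun r : SO R n => val (r^-1)%g).
Proof.
apply: measurable_fun_matrix => i j.
have -> : (fun r : SO R n => val (r^-1)%g i j) = (fun r => val r j i).
  by apply/funext => r; rewrite mxE.
exact: (measurableT_comp (@measurable_coord R n n j i) (@measurable_so_val R n)).
Qed.

Lemma cl_measurable_cwt psi f : cl_measurable psi -> cl_measurable f ->
  cl_measurable (fun p : G * V => cwt psi f p.1.1 p.1.2 p.2).
Proof.
move=> mpsi mf.
apply: (cl_measurable_integral2 dx (F := fun (p : G * V) x => f x * reverse (daughter psi p.1.1 p.1.2 p.2 x))).
apply: cl_measurableM; first exact: (cl_measurable_comp measurable_snd mf).
apply: cl_measurable_reverse.
have m11 : measurable_fun setT (fun q : G * V * V => q.1.1.1).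
  exact: (measurableT_comp measurable_fst (measurableT_comp measurable_fst measurable_fst)).
apply: cl_measurableZ; first exact: (measurableT_comp (measurable_powR _) m11).
apply: cl_measurable_comp mpsi.
apply: (measurableT_comp (@measurable_mulmx R n n 1) (g := fun q : G * V * V =>
  (val (q.1.1.2^-1)%g, (q.1.1.1 : R)^-1 *: (q.2 - q.1.2)))).
apply/measurable_fun_pairP; split => /=.
  apply: (measurableT_comp measurable_soV).
  exact: (measurableT_comp measurable_snd (measurableT_comp measurable_fst measurable_fst)).
apply: (measurableT_comp (@measurable_mx_scale2 R n 1) (g := fun q : G * V * V =>
  ((q.1.1.1 : R)^-1, (q.2 - q.1.2)))).
apply/measurable_fun_pairP; split => /=; first exact: (measurableT_comp measurable_invr m11).
apply: (measurableT_comp (@measurable_sub2 R n) (g := fun q : G * V * V => (q.1.2, q.2))).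
apply/measurable_fun_pairP; split => /=; last exact: measurable_snd.
exact: (measurableT_comp measurable_snd measurable_fst).
Qed.

Lemma measurable_dilate : measurable_fun setT
  (fun q : G * V => (q.1.1 : R) *: (val (q.1.2^-1)%g *m q.2)).
Proof.
apply: (measurableT_comp (@measurable_mx_scale2 R n 1) (g := fun q : G * V =>
  ((q.1.1 : R), val (q.1.2^-1)%g *m q.2))).
apply/measurable_fun_pairP; split => /=; first exact: (measurableT_comp measurable_fst measurable_fst).
apply: (measurableT_comp (@measurable_mulmx R n n 1) (g := fun q : G * V => (val (q.1.2^-1)%g, q.2))).
apply/measurable_fun_pairP; split => /=; last exact: measurable_snd.
by apply: (measurableT_comp measurable_soV); exact: (measurableT_comp measurable_snd measurable_fst).
Qed.

Lemma cl_measurable_admissibility psih : cl_measurable psih ->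
  cl_measurable (fun q : G * V => admissibility_integrand psih q.2 q.1.1 q.1.2).
Proof.
move=> mh; have mP := cl_measurable_comp measurable_dilate mh.
apply: cl_measurableZ.
  by apply: measurable_funX; exact: (measurableT_comp measurable_fst measurable_fst).
by apply: cl_measurableM => //; exact: cl_measurable_reverse.
Qed.

End Weight.

(** * The energy identity and properties of the admissibility constant *)

Section Energy.
Variables (R : realType) (n : nat) (haar : probability (SO R n) R).
Local Notation cl := (clifford R n).
Local Notation I := (pseudoscalar R n).
Local Notation V := 'cV[R]_n.
Local Notation dx := (lebesgue_cv (R := R) n).
Local Notation G := (measurableTypeR R * SO R n)%type.
Local Notation nu := (dilation_measure haar).
Variables (psi psih : V -> cl) (C : cl) (s : R).
Implicit Types (f g : V -> cl) (w x b : V) (p : G).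
Hypotheses (hn : (n %% 4 = 2 \/ n %% 4 = 3)%N) (hs : s = 1 \/ s = -1).
Hypotheses (tpsi : {ae dx, forall x, twist s (psi x) - psi x = 0}) (ph : is_cft_L2 psi psih).
Hypothesis hC : {ae dx, forall w, mu_integrable haar (admissibility_integrand psih w) /\
           mu_integral haar (admissibility_integrand psih w) = C}.
Local Notation adm := (admissibility_integrand psih).

Let mpsih : cl_measurable psih. Proof. exact: ph.2.1.1. Qed.
Let mpsi : cl_measurable psi. Proof. exact: ph.1.1. Qed.

(* The square root of the density is put in the transform, so that the energy on
   the similitude group is a plain L2 norm. *)
Definition weighted_cwt f (q : G * V) : cl :=
  Num.sqrt (haar_weight q.1) *: cwt psi f q.1.1 q.1.2 q.2.

Lemma sqrnorm_weighted_cwt f q :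
  cl_sqrnorm (weighted_cwt f q) = haar_weight q.1 * cl_sqrnorm (cwt psi f q.1.1 q.1.2 q.2).
Proof. by rewrite cl_sqrnormZ sqr_sqrtr // haar_weight_ge0. Qed.

Lemma cl_measurable_weighted_cwt f : cl_measurable psi -> cl_measurable f -> cl_measurable (weighted_cwt f).
Proof.
move=> mp mf; apply: cl_measurableZ; last exact: (cl_measurable_cwt mp mf).
apply: (measurableT_comp (continuous_measurable_fun (@sqrt_continuous R))).
exact: (measurableT_comp (@measurable_haar_weight R n) measurable_fst).
Qed.

Lemma weighted_adm_dot_ge0 p w M : 0 <= haar_weight p * cl_dot (M * adm w p.1 p.2) M.
Proof.
rewrite /haar_weight; case: ifP => [p0|_]; last by rewrite mul0r.
rewrite -scalerAr cl_dotZl -sqrnorm_mul_reverse.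
by rewrite !mulr_ge0 ?cl_sqrnorm_ge0 ?invr_ge0 ?exprn_ge0 ?(ltW p0).
Qed.

Lemma cl_linear_sandwich M : cl_linear (fun N : cl => M * N * reverse M).
Proof. exact: (cl_linear_comp (cl_linear_mulr (reverse M)) (cl_linear_mull M)). Qed.

(** The map N |-> M N rev(M) is linear and so passes through the integral defining [C]; its scalar
    part is the Euclidean product of M N and M. *)
Lemma integral_adm_dot M w : mu_integrable haar (adm w) -> mu_integral haar (adm w) = C ->
  (\int[nu]_p (haar_weight p * cl_dot (M * adm w p.1 p.2) M)%:E = (cl_dot (M * C) M)%:E)%E.
Proof.
move=> /mu_integrableE wi; rewrite mu_integralE => <-.
have Li := cl_integrable_linear measurableT (cl_linear_sandwich M) wi.
have := cl_integral_linear measurableT (cl_linear_sandwich M) wi.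
move=> /ffunP/(_ finset.set0); rewrite ffunE -[X in _ = X -> _]/(scalar_part _) scalar_mul_reverse => <-.
rewrite /Rintegral fineK; last exact: (integrable_fin_num measurableT (Li finset.set0)).
apply: eq_integral => p _; congr (_%:E).
by rewrite -[RHS]/(scalar_part _) scalar_mul_reverse -(scalerAr (haar_weight p)) cl_dotZl.
Qed.

Lemma admissibility_dot_ge0 M : 0 <= cl_dot (M * C) M.
Proof.
have [w [wi wC]] := ae_exists hC.
rewrite -lee_fin -(integral_adm_dot M wi wC); apply: integral_ge0 => p _.
by rewrite lee_fin weighted_adm_dot_ge0.
Qed.

(** Already the integrand, a real multiple of rev(P) P, is invariant under reversal. *)
Lemma reverse_admissibility : reverse C = C.
Proof.
have [w [/mu_integrableE wi]] := ae_exists hC; rewrite mu_integralE => <-.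
rewrite -(cl_integral_linear measurableT (@cl_linear_reverse R n) wi).
apply: eq_cl_integral => p _; rewrite reverseZ /admissibility_integrand reverseZ.
by rewrite reverseM reverseK.
Qed.

(** The sign [s] is met twice, once when [I] crosses P and once when it crosses rev(P), and s^2 =
    1. *)
Lemma twisted_adm (P : cl) : twisted s P -> reverse P * P * I = I * (reverse P * P).
Proof.
move=> tP; rewrite -mulrA tP -scalerAr (mulrA (reverse P)) (twisted_reverse hn hs tP).
rewrite -scalerAl scalerA (mulrA I).
by case: hs => ->; rewrite ?mulrNN mulr1 scale1r.
Qed.

(* For almost all [w], [psih (a r^-1 w)] is twisted for almost all [(a, r)]:
   dilations and rotations preserve null sets. *)
Lemma admissibility_comm : GRing.comm C I.
Proof.
pose g w := twist s (psih w) - psih w.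
have mg : cl_measurable g by apply: cl_measurableB => //; exact: cl_measurable_twist.
have g0 : (\int[dx]_w (cl_sqrnorm (g w))%:E = 0)%E.
  by apply/(integral_sqrnorm_eq0 mg); exact: (is_cft_L2_twisted hn hs ph tpsi).
(* The squared defect of twistedness of [psih] along the orbit of [w], weighted by the density. Its
   integral over [w] vanishes for each [p], and Tonelli moves this to almost every [w]. *)
pose H p w := haar_weight p * cl_sqrnorm (g (p.1 *: (val (p.2^-1)%g *m w))).
have H0 p w : 0 <= H p w by rewrite mulr_ge0 ?haar_weight_ge0 ?cl_sqrnorm_ge0.
have mH : measurable_fun setT (fun q : G * V => H q.1 q.2).
  apply: measurable_funM.
    exact: (measurableT_comp (@measurable_haar_weight R n) measurable_fst).
  by apply: measurable_cl_sqrnorm; exact: (cl_measurable_comp (@measurable_dilate R n) mg).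
have mHE : measurable_fun setT (fun q : G * V => (H q.1 q.2)%:E) by apply/measurable_EFinP.
have zero p : (\int[dx]_w (H p w)%:E = 0)%E.
  rewrite /H /haar_weight; case: ifP => [p0|_]; last first.
    by under eq_integral do rewrite mul0r; rewrite integral0.
  under eq_integral do rewrite EFinM.
  have [md sd] := scales_dilate p.2 p0.
  have mgE := measurable_sqrnormE (D := setT) mg.
  have gE0 w : (0 <= (cl_sqrnorm (g w))%:E)%E by rewrite lee_fin cl_sqrnorm_ge0.
  have w0 : 0 <= p.1 ^- n.+1 :> R by rewrite invr_ge0 exprn_ge0 // ltW.
  rewrite (ge0_integralZl_EFin dx measurableT (fun w _ => gE0 _) (measurableT_comp mgE md) w0).
  by rewrite (sd _ mgE gE0) g0 !mule0.
have swap : (\int[dx]_w \int[nu]_p (H p w)%:E = 0)%E.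
  rewrite -(tonelli (fun p w => (H p w)%:E) mHE (fun p w => H0 p w)).
  by under eq_integral do rewrite zero; rewrite integral0.
have ae0 : {ae dx, forall w, \int[nu]_p (H p w)%:E = 0}%E.
  have mI : measurable_fun setT (fun w => \int[nu]_p (H p w)%:E)%E.
    exact: (measurable_fun_fubini_tonelli_G (m1 := nu) _ mHE (fun q => H0 q.1 q.2)).
  have := (ae_eq_integral_abs dx measurableT mI).1.
  have -> : (\int[dx]_w `|\int[nu]_p (H p w)%:E| = 0)%E.
    apply: etrans swap; apply: eq_integral => w _; rewrite gee0_abs //.
    by apply: integral_ge0 => p _; rewrite lee_fin.
  by move=> /(_ erefl); apply: filterS => w /(_ Logic.I).
(* One frequency is enough: there the integral is equal to [C], and [psih] is twisted at almost all
   points of the orbit where the density is nonzero. *)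
have [w [[wi wC] w0]] : exists w, (mu_integrable haar (adm w) /\ mu_integral haar (adm w) = C) /\
    (\int[nu]_p (H p w)%:E = 0)%E.
  by apply: ae_exists; apply: filterS2 hC ae0 => w ? ?; split.
move/mu_integrableE: wi => wi; rewrite mu_integralE in wC.
have mHw : measurable_fun setT (fun p => (H p w)%:E).
  by apply/measurable_EFinP; exact: (measurableT_comp mH (measurable_pair2 w)).
have aeH : {ae nu, forall p, H p w = 0}.
  have := (ae_eq_integral_abs nu measurableT mHw).1.
  have -> : (\int[nu]_p `|(H p w)%:E| = 0)%E.
    by apply: etrans w0; apply: eq_integral => p _; rewrite gee0_abs // lee_fin.
  by move=> /(_ erefl); apply: filterS => p /(_ Logic.I) /= [].
have hL : cl_linear (fun N : cl => N * I - I * N).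
  exact: (cl_linear_sub (cl_linear_mulr I) (cl_linear_mull I)).
rewrite /GRing.comm; apply/eqP; rewrite -subr_eq0 -wC -(cl_integral_linear measurableT hL wi).
have madm : cl_measurable (fun p => haar_weight p *: adm w p.1 p.2).
  apply: cl_measurableZ; first exact: measurable_haar_weight.
  exact: (cl_measurable_comp (measurable_pair2 w) (cl_measurable_admissibility mpsih)).
have mI : cl_measurable (fun _ : G => I) by exact: cl_measurable_cst.
rewrite (ae_eq_cl_integral (mu := nu) measurableT (G := fun=> 0)).
- by apply/eqP/ffunP => A; rewrite ffunE cl0E /Rintegral integral0_eq // => p _; rewrite /= cl0E.
- by apply: cl_measurableB; apply: cl_measurableM.
- exact: cl_measurable_cst.
apply: filterS aeH => p /eqP; rewrite mulf_eq0 => /orP[/eqP ->|/eqP gp] _.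
  by rewrite scale0r mul0r mulr0 subrr.
rewrite /admissibility_integrand /=; set P := psih _.
have tP : twisted s P.
  have : g (p.1 *: (val (p.2^-1)%g *m w)) = 0.
    apply/ffunP => A; rewrite cl0E; apply/eqP; rewrite -sqrf_eq0 eq_le sqr_ge0 andbT -gp.
    exact: sqr_coef_le.
  by rewrite /g -/P => /eqP; rewrite subr_eq0 => /eqP <-; exact: twisted_twist.
by rewrite -!scalerAl -!scalerAr (twisted_adm tP) subrr.
Qed.

Lemma energy_L1L2 f : L1 f -> L2 f ->
  (\int[(nu \x dx)%E]_q (cl_sqrnorm (weighted_cwt f q))%:E =
   \int[dx]_x (cl_dot (f x * C) (f x))%:E)%E.
Proof.
move=> f1 f2; set K := (2 * pi : R) ^+ n.
have K0 : 0 < K by rewrite exprn_gt0 // mulr_gt0 // pi_gt0.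
suff h : (K%:E * \int[(nu \x dx)%E]_q (cl_sqrnorm (weighted_cwt f q))%:E =
    K%:E * \int[dx]_x (cl_dot (f x * C) (f x))%:E)%E.
  have := congr1 (fun z : \bar R => (K^-1)%:E * z)%E h.
  by rewrite !muleA -!EFinM mulVf ?mul1e // gt_eqF.
rewrite -(plancherel_quadratic hn admissibility_comm f1 f2).
have mW := cl_measurable_weighted_cwt mpsi f1.1.
have mWE := measurable_sqrnormE (D := setT) mW.
have W0 q : (0 <= (cl_sqrnorm (weighted_cwt f q))%:E)%E by rewrite lee_fin cl_sqrnorm_ge0.
rewrite (fubini_tonelli1 (m1 := nu) (m2 := dx) _ mWE W0).
have mfh := cl_measurable_cft hn f1.1.
pose H p w := haar_weight p * cl_dot (cft f w * adm w p.1 p.2) (cft f w).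
have H0 p w : (0 <= (H p w)%:E)%E by rewrite lee_fin weighted_adm_dot_ge0.
have mH : measurable_fun setT (fun q : G * V => (H q.1 q.2)%:E).
  apply/measurable_EFinP; apply: measurable_funM.
    exact: (measurableT_comp (@measurable_haar_weight R n) measurable_fst).
  have mf2 := cl_measurable_comp (measurable_snd : measurable_fun setT (@snd G V)) mfh.
  apply: measurable_cl_dot => //; apply: cl_measurableM => //.
  exact: cl_measurable_admissibility.
have step p : (K%:E * fubini_F dx (fun q => (cl_sqrnorm (weighted_cwt f q))%:E) p = \int[dx]_w (H p w)%:E)%E.
  rewrite /fubini_F /H.
  have [p0|p0] := boolP (0 < (p.1 : R)); last first.
    have z : haar_weight p = 0 by rewrite /haar_weight (negbTE p0).
    rewrite z; under [RHS]eq_integral do rewrite mul0r.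
    under eq_integral do rewrite sqrnorm_weighted_cwt /= z mul0r.
    by rewrite !integral0 mule0.
  have mT : measurable_fun setT (fun b => (cl_sqrnorm (cwt psi f p.1 p.2 b))%:E).
    apply: (measurable_sqrnormE (D := setT) (F := fun b => cwt psi f p.1 p.2 b)).
    exact: (cl_measurable_comp (measurable_pair1 p) (cl_measurable_cwt mpsi f1.1)).
  have T0 b : setT b -> (0 <= (cl_sqrnorm (cwt psi f p.1 p.2 b))%:E)%E.
    by move=> _; rewrite lee_fin cl_sqrnorm_ge0.
  transitivity ((haar_weight p)%:E * (K%:E * \int[dx]_b (cl_sqrnorm (cwt psi f p.1 p.2 b))%:E))%E.
    rewrite muleCA; apply: (congr1 (fun z => K%:E * z)%E).
    rewrite -(ge0_integralZl_EFin dx measurableT T0 mT (haar_weight_ge0 p)).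
    by apply: eq_integral => b _; rewrite sqrnorm_weighted_cwt EFinM.
  rewrite -(cwt_plancherel p.2 p0 hn hs tpsi ph f1 f2).
  have mD : measurable_fun setT (fun w => (cl_dot (cft f w * adm w p.1 p.2) (cft f w))%:E).
    apply/measurable_EFinP; apply: measurable_cl_dot => //; apply: cl_measurableM => //.
    exact: (cl_measurable_comp (measurable_pair1 p) (cl_measurable_admissibility mpsih)).
  rewrite -(ge0_integralZl_EFin dx measurableT _ mD (haar_weight_ge0 p)) //.
  move=> w _; rewrite lee_fin -scalerAr cl_dotZl -sqrnorm_mul_reverse.
  by rewrite mulr_ge0 ?cl_sqrnorm_ge0 // exprn_ge0 // ltW.
have mF : measurable_fun setT (fubini_F dx (fun q => (cl_sqrnorm (weighted_cwt f q))%:E)).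
  exact: (measurable_fun_fubini_tonelli_F (m2 := dx) _ mWE W0).
have F0 p : setT p -> (0 <= fubini_F dx (fun q => (cl_sqrnorm (weighted_cwt f q))%:E) p)%E.
  by move=> _; apply: integral_ge0 => b _; exact: W0.
rewrite -(ge0_integralZl_EFin nu measurableT F0 mF (ltW K0)).
under eq_integral do rewrite step.
(* From here (a, r) is integrated at a fixed frequency, where the admissibility condition produces
   [C] for almost every w. *)
rewrite (tonelli (fun p w => (H p w)%:E) mH H0).
apply: ae_eq_integral => //.
- exact: (measurable_fun_fubini_tonelli_G (m1 := nu) _ mH (fun q => H0 q.1 q.2)).
- apply/measurable_EFinP; apply: measurable_cl_dot => //; apply: cl_measurableM => //.
by apply: filterS hC => w [wi wC] _; exact: integral_adm_dot.
Qed.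

End Energy.

(** * Extension to L2 and polarization *)

Section Truncation.
Variables (R : realType) (n : nat).
Local Notation cl := (clifford R n).
Local Notation V := 'cV[R]_n.
Local Notation dx := (lebesgue_cv (R := R) n).
Implicit Types (f : V -> cl) (x : V) (k : nat).

Definition cube_indic k x : R := \1_(open_cube k) x.

Lemma cube_indic_ge0 k x : 0 <= cube_indic k x.
Proof. by rewrite /cube_indic indicE. Qed.

Lemma cube_indic_le1 k x : cube_indic k x <= 1.
Proof. by rewrite /cube_indic indicE; case: (_ \in _). Qed.

Lemma cube_indic_sqr k x : cube_indic k x ^+ 2 = cube_indic k x.
Proof. by rewrite /cube_indic indicE; case: (_ \in _); rewrite ?expr1n ?expr0n. Qed.

Lemma measurable_cube_indic k : measurable_fun setT (cube_indic k).
Proof. by apply: measurable_indic; exact: measurable_open_cube. Qed.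

Lemma near_cube_indic x : \forall k \near \oo, cube_indic k x = 1.
Proof.
apply: filterS (near_open_cube x) => k xk.
by rewrite /cube_indic indicE mem_set.
Qed.

Definition trunc f k x : cl := cube_indic k x *: f x.

Lemma cl_measurable_trunc f k : cl_measurable f -> cl_measurable (trunc f k).
Proof. by move=> mf; apply: cl_measurableZ => //; exact: measurable_cube_indic. Qed.

Lemma L2_trunc f k : L2 f -> L2 (trunc f k).
Proof.
move=> f2; apply: (L2_scale (cl_measurable_trunc k f2.1) ler01 f2) => x.
by rewrite cl_sqrnormZ cube_indic_sqr ler_wpM2r ?cl_sqrnorm_ge0 ?cube_indic_le1.
Qed.

(** On the cube t <= 1 + t^2 bounds the norm by the indicator plus a multiple of the squared norm;
    the cube has finite measure. *)
Lemma L1_trunc f k : L2 f -> L1 (trunc f k).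
Proof.
move=> f2; have mt := cl_measurable_trunc k f2.1; split; first exact: mt.
have i1 : dx.-integrable setT (EFin \o cube_indic k).
  by apply: integrable_indic_finite; [exact: measurable_open_cube|exact: open_cube_lty].
have i2 := integrable_scaleR measurableT (cl_dim R n) (L2_integrable f2).
apply: (cl_integrable_bound measurableT mt (integrable_addR measurableT i1 i2)) => x.
rewrite cl_norm1Z ger0_norm ?cube_indic_ge0 //.
have h1 := cl_norm1_sqr (f x); have h2 := sqr_ge0 (cl_norm1 (f x) - cube_indic k x).
have h3 := cube_indic_sqr k x; have := cube_indic_ge0 k x.
have := cl_norm1_ge0 (f x); rewrite sqrrB h3 in h2.
have := sqr_ge0 (cl_norm1 (f x)); lra.
Qed.

Lemma cvg_Rintegral_trunc (g : V -> R) : dx.-integrable setT (EFin \o g) ->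
  \int[dx]_x (cube_indic k x * g x) @[k --> \oo] --> \int[dx]_x g x.
Proof.
move=> gi; have mg : measurable_fun setT g by apply/measurable_EFinP; exact: measurable_int gi.
have mk k : measurable_fun setT (fun x => (cube_indic k x * g x)%:E).
  by apply/measurable_EFinP; apply: measurable_funM => //; exact: measurable_cube_indic.
have mgE : measurable_fun setT (fun x => (g x)%:E) by apply/measurable_EFinP.
have lim x : (cube_indic k x * g x)%:E @[k --> \oo] --> (g x)%:E.
  apply: cvg_near_cst; apply: filterS (near_cube_indic x) => k ->.
  by rewrite mul1r.
have ig := integrable_norm gi.
have bd x k : setT x -> (`|(cube_indic k x * g x)%:E| <= `|(g x)%:E|)%E.
  move=> _; rewrite !abse_EFin lee_fin normrM ler_piMl //.
  by rewrite ger0_norm ?cube_indic_ge0 // cube_indic_le1.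
have [_ _] := @dominated_convergence _ _ _ dx setT measurableT (fun k x => (cube_indic k x * g x)%:E)
  (fun x => (g x)%:E) (fun x => `|(g x)%:E|%E) mk mgE (aeW _ (fun x _ => lim x)) ig
  (aeW _ bd).
move=> h; rewrite /Rintegral; apply: fine_cvg.
rewrite fineK; last exact: (integrable_fin_num measurableT gi).
exact: h.
Qed.

Lemma trunc_cvg_L2 f : L2 f ->
  (\int[dx]_x (cl_sqrnorm (trunc f k x - f x))%:E)%E @[k --> \oo] --> 0%E.
Proof.
move=> f2; apply: (dominated_cvg0 (g := fun x => cl_sqrnorm (f x))).
- exact: measurableT.
- move=> k; apply: measurable_cl_sqrnorm; apply: cl_measurableB; [exact: (cl_measurable_trunc k f2.1)|exact: f2.1].
- exact: L2_integrable.
- move=> k x _; rewrite cl_sqrnorm_ge0 /= /trunc -{2}(scale1r (f x)) -scalerBl cl_sqrnormZ.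
  rewrite ler_piMl ?cl_sqrnorm_ge0 //; have := cube_indic_ge0 k x; have := cube_indic_le1 k x.
  have := cube_indic_sqr k x; rewrite sqrrB expr1n mulr1 => ->; rewrite mulr2n; lra.
move=> x _; apply: cvg_near_cst; apply: filterS (near_cube_indic x) => k h.
by rewrite /trunc h scale1r subrr -cl_dot_sqr -(scale0r (0 : cl)) cl_dotZl mul0r.
Qed.

End Truncation.

Section Extension.
Variables (R : realType) (n : nat) (haar : probability (SO R n) R).
Local Notation cl := (clifford R n).
Local Notation V := 'cV[R]_n.
Local Notation dx := (lebesgue_cv (R := R) n).
Local Notation G := (measurableTypeR R * SO R n)%type.
Local Notation nu := (dilation_measure haar).
Variables (psi : V -> cl) (C : cl).
Implicit Types (f g h : V -> cl) (x : V) (q : G * V).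
Local Notation W := (weighted_cwt psi).
Local Notation energy f := (\int[(nu \x dx)%E]_q (cl_sqrnorm (W f q))%:E)%E.
Hypothesis psi2 : L2 psi.

Lemma weighted_cwt0 f q : ~~ (0 < (q.1.1 : R)) -> W f q = 0.
Proof. by move=> a0; rewrite /weighted_cwt /haar_weight (negbTE a0) sqrtr0 scale0r. Qed.

Lemma L2_daughter_shift (a : R) (r : SO R n) b : 0 < a -> L2 (daughter psi a r b).
Proof.
move=> a0; have := L2_shift b (L2_daughter r a0 psi2).
by rewrite (_ : daughter psi a r b = fun x => daughter psi a r 0 (x - b)) //; apply/funext => x; exact: daughter_shift.
Qed.

Lemma cl_integrable_cwt f (a : R) (r : SO R n) b : 0 < a -> L2 f ->
  cl_integrable dx setT (fun x => f x * reverse (daughter psi a r b x)).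
Proof. by move=> a0 f2; exact: (cl_integrable_mul_reverse f2 (L2_daughter_shift r b a0)). Qed.

Lemma weighted_cwtD f g q : L2 f -> L2 g -> W (fun x => f x + g x) q = W f q + W g q.
Proof.
move=> f2 g2; have [a0|a0] := boolP (0 < (q.1.1 : R)); last by rewrite !weighted_cwt0 // addr0.
rewrite /weighted_cwt -scalerDr; congr (_ *: _).
rewrite /cwt -(cl_integralD measurableT (cl_integrable_cwt _ _ a0 f2) (cl_integrable_cwt _ _ a0 g2)).
by apply: eq_cl_integral => x _; rewrite mulrDl.
Qed.

Lemma weighted_cwtB f g q : L2 f -> L2 g -> W (fun x => f x - g x) q = W f q - W g q.
Proof.
move=> f2 g2; have [a0|a0] := boolP (0 < (q.1.1 : R)); last by rewrite !weighted_cwt0 // subr0.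
rewrite /weighted_cwt -scalerBr; congr (_ *: _).
rewrite /cwt -(cl_integralB measurableT (cl_integrable_cwt _ _ a0 f2) (cl_integrable_cwt _ _ a0 g2)).
by apply: eq_cl_integral => x _; rewrite mulrBl.
Qed.

Lemma weighted_cwt_mull M f q : L2 f -> W (fun x => M * f x) q = M * W f q.
Proof.
move=> f2; have [a0|a0] := boolP (0 < (q.1.1 : R)); last by rewrite !weighted_cwt0 // mulr0.
rewrite /weighted_cwt -scalerAr; congr (_ *: _).
rewrite /cwt -(cl_integral_linear measurableT (cl_linear_mull M) (cl_integrable_cwt _ _ a0 f2)).
by apply: eq_cl_integral => x _; rewrite mulrA.
Qed.

(** At a fixed point of the group each coefficient of the transform is the integral of an integrable
    function, so dominated convergence applies to the truncations. *)
Lemma weighted_cwt_trunc_cvg f q : L2 f ->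
  cl_sqrnorm (W (trunc f k) q) @[k --> \oo] --> cl_sqrnorm (W f q).
Proof.
move=> f2; have [a0|a0] := boolP (0 < (q.1.1 : R)); last first.
  by under eq_fun do rewrite weighted_cwt0 //; rewrite weighted_cwt0 //; exact: cvg_cst.
have coef A : W (trunc f k) q A @[k --> \oo] --> W f q A.
  have fi := cl_integrable_cwt q.1.2 q.2 a0 f2 A.
  have := cvg_Rintegral_trunc fi => h.
  rewrite /weighted_cwt cl_scaleE /cwt ffunE; under eq_fun do rewrite cl_scaleE /cwt ffunE.
  apply: cvgM; first exact: cvg_cst.
  apply: cvg_trans h; apply: near_eq_cvg; apply: nearW => k.
  by apply: eq_Rintegral => x _; rewrite /trunc -scalerAl cl_scaleE.
rewrite cl_sqrnormE; under eq_fun do rewrite cl_sqrnormE.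
by apply: cvg_big => [|A _]; [exact: add_continuous|rewrite expr2; under eq_fun do rewrite expr2; exact: cvgM].
Qed.

Hypotheses (C0 : forall M : cl, 0 <= cl_dot (M * C) M) (rC : reverse C = C).
Hypothesis energy12 : forall f, L1 f -> L2 f ->
  energy f = (\int[dx]_x (cl_dot (f x * C) (f x))%:E)%E.

(** The two summands come from |(M C, M)| <= |M C|^2 + |M|^2. The bound is crude, but only its
    finiteness matters. *)
Let B : R := cl_dim R n ^+ 2 * cl_sqrnorm C + 1.
Let B0 : 0 <= B. Proof. by rewrite addr_ge0 // mulr_ge0 ?sqr_ge0 ?cl_sqrnorm_ge0. Qed.

Lemma cl_dot_C_le M : cl_dot (M * C) M <= B * cl_sqrnorm M.
Proof.
apply: (le_trans (ler_norm _)); apply: (le_trans (cl_dot_norm_le _ _)).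
rewrite /B mulrDl mul1r lerD2r; apply: (le_trans (cl_sqrnormM _ _)).
by rewrite [X in _ * X <= _]mulrC mulrA.
Qed.

Lemma integrable_dot_C f g : L2 f -> L2 g -> dx.-integrable setT (EFin \o (fun x => cl_dot (f x * C) (g x))).
Proof. by move=> f2 g2; exact: (integrable_cl_dot (L2_mulr C f2) g2). Qed.

Lemma measurable_weighted_cwt f : cl_measurable f -> cl_measurable (W f).
Proof. by move=> mf; exact: (cl_measurable_weighted_cwt psi2.1 mf). Qed.

(** The identity holds for truncations, where the right-hand side is bounded uniformly, and Fatou
    passes this bound to [f]. Square integrability of the transform is thus available before
    equality is. *)
Lemma energy_bound f : L2 f -> (energy f <= B%:E * \int[dx]_x (cl_sqrnorm (f x))%:E)%E.
Proof.
move=> f2; apply: (@integral_cvg_le _ _ _ _ (fun k q => cl_sqrnorm (W (trunc f k) q))).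
- by move=> k; apply: measurable_cl_sqrnorm; apply: measurable_weighted_cwt; exact: (cl_measurable_trunc k f2.1).
- by move=> k q; exact: cl_sqrnorm_ge0.
- by move=> q; exact: weighted_cwt_trunc_cvg.
move=> k; rewrite (energy12 (L1_trunc k f2) (L2_trunc k f2)).
have mf := measurable_sqrnormE (D := setT) f2.1.
have f0 x : setT x -> (0 <= (cl_sqrnorm (f x))%:E)%E by move=> _; rewrite lee_fin cl_sqrnorm_ge0.
rewrite -(ge0_integralZl_EFin dx measurableT f0 mf B0).
apply: ge0_le_integral.
- exact: measurableT.
- by move=> x _; rewrite lee_fin C0.
- exact: (measurable_int _ (integrable_dot_C (L2_trunc k f2) (L2_trunc k f2))).
- exact: (measurable_funeM _ mf).
move=> x _; rewrite -EFinM lee_fin; apply: (le_trans (cl_dot_C_le _)).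
rewrite ler_wpM2l // /trunc cl_sqrnormZ cube_indic_sqr.
by rewrite ler_piMl ?cl_sqrnorm_ge0 ?cube_indic_le1.
Qed.

Lemma sqr_integrable_W f : L2 f -> sqr_integrable (nu \x dx)%E (W f).
Proof.
move=> f2; split; first exact: (measurable_weighted_cwt f2.1).
by apply: (le_lt_trans (energy_bound f2)); apply: lte_mul_pinfty; rewrite ?lee_fin //; exact: f2.2.
Qed.

(** The preceding bound, applied to trunc f k - f, makes the transforms converge in L2, so their
    energies converge. The right-hand side converges by domination, the cut-off being equal to its
    own square. *)
Lemma energy_L2 f : L2 f -> energy f = (\int[dx]_x cl_dot (f x * C) (f x))%:E.
Proof.
move=> f2.
have lim1 : energy (trunc f k) @[k --> \oo] --> energy f.
  apply: (@cvg_integral_sqrnorm _ _ _ _ (nu \x dx)%E setT measurableT (fun k => W (trunc f k)) (W f)).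
  - by move=> k; apply: measurable_weighted_cwt; exact: (cl_measurable_trunc k f2.1).
  - exact: (measurable_weighted_cwt f2.1).
  - exact: (sqr_integrable_W f2).2.
  apply: (squeeze0 _ (cvge0Zl B (trunc_cvg_L2 f2))) => k; rewrite integral_sqrnorm_ge0 /=.
  apply: le_trans (energy_bound (L2B (L2_trunc k f2) f2)).
  by under [leLHS]eq_integral do rewrite -(weighted_cwtB _ (L2_trunc k f2) f2).
have lim2 : energy (trunc f k) @[k --> \oo] --> (\int[dx]_x cl_dot (f x * C) (f x))%:E.
  have h := cvg_Rintegral_trunc (integrable_dot_C f2 f2).
  have h' : (\int[dx]_x (cube_indic k x * cl_dot (f x * C) (f x)))%:E @[k --> \oo] -->
     (\int[dx]_x cl_dot (f x * C) (f x))%:E by apply: cvg_EFin; [exact: nearW|exact: h].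
  apply: cvg_trans h'; apply: near_eq_cvg; apply: nearW => k.
  have ti := integrable_dot_C (L2_trunc k f2) (L2_trunc k f2).
  rewrite (energy12 (L1_trunc k f2) (L2_trunc k f2)) -(fineK (integrable_fin_num measurableT ti)).
  congr (_%:E); apply: eq_Rintegral => x _.
  by rewrite /trunc -scalerAl cl_dotZl cl_dotZr mulrA -expr2 cube_indic_sqr.
by rewrite -(cvg_lim (@ereal_hausdorff R) lim1) -(cvg_lim (@ereal_hausdorff R) lim2).
Qed.

(** Polarization of the energy identity. The two cross terms coincide because (M C, N) is symmetric
    in M and N, which is the invariance of [C] under reversal. *)
Lemma weighted_cwt_dot f h : L2 f -> L2 h ->
  \int[(nu \x dx)%E]_q cl_dot (W f q) (W h q) = \int[dx]_x cl_dot (f x * C) (h x).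
Proof.
move=> f2 h2; rewrite (Rintegral_polar (sqr_integrable_W f2) (sqr_integrable_W h2)).
have ip := integrable_dot_C (L2D f2 h2) (L2D f2 h2).
have im := integrable_dot_C (L2B f2 h2) (L2B f2 h2).
have E u : L2 u -> \int[(nu \x dx)%E]_q cl_sqrnorm (W u q) = \int[dx]_x cl_dot (u x * C) (u x).
  by move=> u2; exact: (congr1 fine (energy_L2 u2)).
have -> : \int[(nu \x dx)%E]_q cl_sqrnorm (W f q + W h q) =
    \int[dx]_x cl_dot ((f x + h x) * C) (f x + h x).
  rewrite -(E _ (L2D f2 h2)); apply: eq_Rintegral => q _.
  by rewrite (weighted_cwtD q f2 h2).
have -> : \int[(nu \x dx)%E]_q cl_sqrnorm (W f q - W h q) =
    \int[dx]_x cl_dot ((f x - h x) * C) (f x - h x).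
  rewrite -(E _ (L2B f2 h2)); apply: eq_Rintegral => q _.
  by rewrite (weighted_cwtB q f2 h2).
rewrite -(RintegralB measurableT ip im).
rewrite -(RintegralZr _ measurableT (integrable_subR measurableT ip im)).
apply: eq_Rintegral => x _.
have sym M N : cl_dot (M * C) N = cl_dot (N * C) M by rewrite cl_dotMr rC cl_dotC.
by rewrite !mulrDl !mulNr !cl_dotDl !cl_dotDr !cl_dotNl !cl_dotNr (sym (h x) (f x)); field.
Qed.

Hypothesis Cu : C \is a GRing.unit.

(** The second factor is the reverse of the transform of x |-> g(x) rev(C^-1), and the density is
    shared as two square roots. For a <= 0 the density is 0 and both sides vanish. *)
Lemma weighted_cwt_mul_inner f g q : L2 g ->
  haar_weight q.1 *: (cwt psi f q.1.1 q.1.2 q.2 * inner (fun x => daughter psi q.1.1 q.1.2 q.2 x * C^-1) g) =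
  W f q * reverse (W (fun x => g x * reverse C^-1) q).
Proof.
move=> g2; have [a0|a0] := boolP (0 < (q.1.1 : R)); last first.
  by rewrite (weighted_cwt0 f) // mul0r /haar_weight (negbTE a0) scale0r.
have h2 := L2_mulr (reverse C^-1) g2.
rewrite /weighted_cwt reverseZ -scalerAl -scalerAr scalerA -expr2 sqr_sqrtr ?haar_weight_ge0 //.
congr (_ *: (_ * _)); rewrite /cwt.
rewrite -(cl_integral_linear measurableT (@cl_linear_reverse R n) (cl_integrable_cwt _ _ a0 h2)).
by apply: eq_cl_integral => x _; rewrite !reverseM !reverseK mulrA.
Qed.

(** Each coordinate of the integrand is a Euclidean product of two square-integrable transforms.
    Integrability therefore comes with the formula, and the polarized identity evaluates the
    integral. *)
Theorem weighted_reconstruction f g : L2 f -> L2 g ->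
  let F := fun a r b => cwt psi f a r b * inner (fun x => daughter psi a r b x * C^-1) g in
  sim_integrable haar F /\ inner f g = sim_integral haar F.
Proof.
move=> f2 g2 F; set h := fun x => g x * reverse C^-1.
have h2 : L2 h by exact: L2_mulr.
have FE (q : G * V) A : (haar_weight q.1 *: F q.1.1 q.1.2 q.2) A =
    cl_dot (W f q) (W (fun x => blade R A * h x) q).
  by rewrite /F weighted_cwt_mul_inner // mul_reverseE weighted_cwt_mull.
have eh2 A : L2 (fun x => blade R A * h x) by exact: L2_mull.
split.
  apply/sim_integrableE => A; under eq_fun do rewrite FE.
  exact: (integrable_cl_dot (sqr_integrable_W f2) (sqr_integrable_W (eh2 A))).
rewrite sim_integralE; apply/ffunP => A; rewrite !ffunE.
under [RHS]eq_Rintegral do rewrite FE.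
rewrite (weighted_cwt_dot f2 (eh2 A)); apply: eq_Rintegral => x _.
(* The factor rev(C^-1) on the right of [g] is moved to the other argument as C^-1, where it cancels
   [C]. *)
by rewrite mul_reverseE /h mulrA -cl_dotMr mulrK.
Qed.

End Extension.

(** The sign is -1 only for an odd-valued wavelet with n = 2 mod 4. Twistedness is expressed as the
    vanishing of a measurable defect, the form that survives modification on null sets and changes
    of variables. *)
Lemma wavelet_twisted (R : realType) (n : nat) (psi : 'cV[R]_n -> clifford R n)
    (hn : (n %% 4 = 2 \/ n %% 4 = 3)%N) :
  ((n %% 4 = 2)%N -> {ae lebesgue_cv n, forall x, is_even (psi x)} \/
                     {ae lebesgue_cv n, forall x, is_odd (psi x)}) ->
  exists2 s : R, s = 1 \/ s = -1 & {ae lebesgue_cv n, forall x, twist s (psi x) - psi x = 0}.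
Proof.
case: (hn) => n4 par.
  have [ev|od] := par n4.
    exists 1; first by left.
    apply: filterS ev => x px; apply/eqP; rewrite subr_eq0; apply/eqP.
    by apply: twist_id => //; [left|exact: twisted_even].
  exists (-1); first by right.
  apply: filterS od => x px; apply/eqP; rewrite subr_eq0; apply/eqP.
  by apply: twist_id => //; [right|exact: twisted_odd].
exists 1; first by left.
apply: aeW => x; apply/eqP; rewrite subr_eq0; apply/eqP.
by apply: twist_id => //; [left|exact: twisted_central].
Qed.

Theorem theorem1 (R : realType) (n : nat) (haar : probability (SO R n) R)
    (psi : 'cV[R]_n -> clifford R n) (C : clifford R n)
    (hn : (n %% 4 = 2)%N \/ (n %% 4 = 3)%N)
    (hhaar : is_haar haar)
    (hpsi : admissible haar psi C)
    (f : 'cV[R]_n -> clifford R n) (hf : L2 f)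
    (g : 'cV[R]_n -> clifford R n) (hg : L2 g) :
  sim_integrable haar (fun a r b =>
    cwt psi f a r b * inner (fun x => daughter psi a r b x * C^-1) g) /\
  inner f g = sim_integral haar (fun a r b =>
    cwt psi f a r b * inner (fun x => daughter psi a r b x * C^-1) g).
Proof.
have [psi2 par Cu [psih ph hC]] := hpsi.
have [s hs tpsi] := wavelet_twisted hn par.
apply: (weighted_reconstruction psi2 (admissibility_dot_ge0 hC) (reverse_admissibility hC) _ Cu hf hg).
by move=> u u1 u2; exact: (energy_L1L2 hn hs tpsi ph hC u1 u2).
Qed.
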